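(* Suppose that $H$ is a real separable Hilbert space, and that $M$ and $\lambda$ are (non-negative) Borel measures on $H\setminus\{0\}$ and on $(0,\infty)$, respectively. Then $M^{(\lambda)}$ is a Lévy spectral measure if and only if $$\int_{H\setminus\{0\}}\Big[\|x\|^2\int_0^{\|x\|^{-1}}t^2\,\lambda(dt)+\lambda(\{s:s>\|x\|^{-1}\})\Big]M(dx)=\int_0^\infty\Big[t^2\int_{\{0<\|x\|\le t^{-1}\}}\|x\|^2\,M(dx)+M(\{x:\|x\|>t^{-1}\})\Big]\lambda(dt)<\infty .$$ Moreover, in that case $M$ is a Lévy spectral measure on $H$ and $\lambda$ is a Lévy spectral measure on $\mathbb{R}$.
   Context: The $\lambda$-mixture of $M$ is the measure $M^{(\lambda)}(A):=\int_0^\infty\int_{H\setminus\{0\}}1_A(tx)\,M(dx)\,\lambda(dt)$ for Borel sets $A\subset H\setminus\{0\}$. A Lévy spectral measure on $H$ is a Borel measure $M$ on $H\setminus\{0\}$ which is the third parameter in the Lévy–Khintchine representation of an infinitely divisible Borel probability measure on $H$, whose characteristic function is $$\exp\Big[i\langle y,a\rangle-\tfrac12\langle Ry,y\rangle+\int_{H\setminus\{0\}}\big(e^{i\langle y,x\rangle}-1-i\langle y,x\rangle1_{\{\|x\|\le1\}}(x)\big)M(dx)\Big],\quad y\in H,$$ where $a\in H$ is a shift vector and $R$ is a Gaussian covariance operator. On a Hilbert space (in particular on $\mathbb{R}$) a Borel measure on the space without the origin is a Lévy spectral measure iff it integrates $\min(1,\|x\|^2)$. The measure $\lambda$ on $(0,\infty)$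 is regarded as a measure on $\mathbb{R}$ concentrated on $(0,\infty)$.
   Formalization: In the ''Moreover'' clause, M is shown to be a Lévy spectral measure only when λ ≠ 0, and λ only when M ≠ 0; without this it is false: for M = 0 and λ Lebesgue measure on (0,∞), M^(λ) = 0 is Lévy spectral but λ is not. *)

(* Defs.v *)
From HB Require Import structures.
From mathcomp Require Export all_boot all_order all_algebra.
From mathcomp Require Export sesquilinear complex.
From mathcomp Require Export all_classical all_reals all_analysis.

Set Implicit Arguments.
Unset Strict Implicit.
Unset Printing Implicit Defensive.

Export Order.TTheory GRing.Theory Num.Theory.
Export numFieldNormedType.Exports.

Global Open Scope classical_set_scope.
Global Open Scope ring_scope.

Notation borel T := (g_sigma_algebraType (@open T)).

(* Together with completeness of H, this makes (H, ip) a real Hilbert space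
   whose Hilbert norm is the norm carried by H. *)
Definition hilbert_norm (R : realType) (H : completeNormedModType R)
    (ip : {dot H for idfun}) : Prop :=
  forall x : H, ip x x = `|x| ^+ 2.

Definition separable (T : topologicalType) : Prop :=
  exists2 D : set T, countable D & dense D.

Section ComplexValued.
Context (R : realType).

Definition cexp (z : R[i]) : R[i] :=
  (expR (complex.Re z) * cos (complex.Im z)
     +i* (expR (complex.Re z) * sin (complex.Im z)))%C.

Context d (T : measurableType d) (mu : {measure set T -> \bar R}) (D : set T).

Definition cintegrable (f : T -> R[i]) : Prop :=
  mu.-integrable D (fun x => (complex.Re (f x))%:E) /\
  mu.-integrable D (fun x => (complex.Im (f x))%:E).

Definition cintegral (f : T -> R[i]) : R[i] :=
  (Rintegral mu D (fun x => complex.Re (f x))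
     +i* Rintegral mu D (fun x => complex.Im (f x)))%C.

End ComplexValued.

Section InfinitelyDivisible.
Context (R : realType) (H : completeNormedModType R).

(* Convolution of nu with a set function m.  As a plain set function it needs
   no bundled proof of sigma-additivity; it is only ever compared with a
   measure on Borel sets. *)
Definition convolution (nu : {measure set (borel H) -> \bar R})
    (m : set H -> \bar R) (A : set H) : \bar R :=
  (\int[nu]_x m [set y : H | A ((x : H) + y)%R])%E.

Definition conv_pow (nu : {measure set (borel H) -> \bar R}) (n : nat) :
    set H -> \bar R :=
  iter n (convolution nu) (@dirac _ (borel H) (0 : H) R).

Definition infinitely_divisible (mu : probability (borel H) R) : Prop :=
  forall n : nat, (0 < n)%N ->
    exists nu : probability (borel H) R,
      forall A : set (borel H), measurable A -> mu A = conv_pow nu n A.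

End InfinitelyDivisible.

Section LevyKhintchine.
Context (R : realType) (H : completeNormedModType R) (ip : H -> H -> R).

Definition char_fun (mu : probability (borel H) R) (y : H) : R[i] :=
  cintegral mu setT (fun x : borel H => cexp (0 +i* ip y x)%C).

(* Q is the covariance operator of a centred Gaussian Borel measure on H. *)
Definition gaussian_covariance (Q : {linear H -> H}) : Prop :=
  [/\ continuous Q,
      forall x y : H, ip (Q x) y = ip x (Q y) &
      exists g : probability (borel H) R,
        forall y : H, char_fun g y = cexp (- (ip (Q y) y / 2) +i* 0)%C].

Definition lk_kernel (y x : H) : R[i] :=
  (cexp (0 +i* ip y x) - 1
     - (0 +i* (ip y x * \1_[set z : H | `|z| <= 1] x)))%C.

(* The integral in the exponent is a convergent Lebesgue integral; this has to
   be required explicitly because Rintegral is total. *)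
Definition levy_khintchine (mu : probability (borel H) R) (a : H)
    (Q : {linear H -> H}) (N : {measure set (borel H) -> \bar R}) : Prop :=
  forall y : H,
    cintegrable N [set~ (0 : H)] (lk_kernel y) /\
    char_fun mu y =
      cexp ((0 +i* ip y a) - (ip (Q y) y / 2 +i* 0)
              + cintegral N [set~ (0 : H)] (lk_kernel y))%C.

(* A Borel measure on H \ {0} is identified with the Borel measure on H that
   extends it by 0 at the origin.  The argument is a mere set function, so that it also
   applies to mixtures; being a Borel measure is part of the predicate. *)
Definition levy_spectral (m : set H -> \bar R) : Prop :=
  exists N : {measure set (borel H) -> \bar R},
    [/\ forall A : set (borel H), measurable A -> m A = N A,
        N [set (0 : H)] = 0%E &
        exists (mu : probability (borel H) R) (a : H) (Q : {linear H -> H}),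
          [/\ infinitely_divisible mu, gaussian_covariance Q &
              levy_khintchine mu a Q N]].

End LevyKhintchine.

(* lambda lives on (0, +oo) and M on H \ {0}.  M need not be sigma-finite, in
   which case t |-> M (t^-1 A) may fail to be measurable and the mixture need
   not be additive; hence a set function rather than a bundled measure. *)
Definition mixture (R : realType) (H : completeNormedModType R)
    (lambda : {measure set (measurableTypeR R) -> \bar R})
    (M : {measure set (borel H) -> \bar R}) (A : set H) : \bar R :=
  (\int[lambda]_(t in `]0%R, +oo[)
     \int[M]_(x in [set~ (0%R : H)]) (\1_A ((t : R) *: (x : H)))%:E)%E.

(* Main.v *)
From HB Require Import structures.
Require Import Defs.
From mathcomp Require Import ring lra measurable_realfun.

Set Implicit Arguments.
Unset Strict Implicit.
Unset Printing Implicit Defensive.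

(* Put [g x = min 1 (|x| ^ 2)]. Splitting at [|x| = t ^ -1], the inner integral of the right-hand
side is [\int g (t x) M(dx)], so the right-hand side is the integral of [g] against the mixture,
and the left-hand side is the same double integral in the other order. It remains to know that a
Borel measure [N] without mass at [0] is a Levy spectral measure iff it integrates [g], and to
justify Tonelli: if neither [M] nor [lambda] vanishes, finiteness of the right-hand side makes
both integrate [g], hence sigma-finite. When only the mixture is known to be a measure, it is
tested on the radial sets [g > 2 ^ -k], for which [t |-> M (t^-1 A)] is monotone.

   Sufficiency: cut [N] into shells of finite mass shrinking to [0] fast. The centred compound
Poisson law of a shell has second moment at most [3 \int |x| ^ 2 N(dx)], by Fatou applied to [2
(1 - cos (t u)) / t ^ 2] and Parseval, so independent variables with these laws are almost surely
absolutely summable. Infinite divisibility follows from the same construction for [N / n] and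
uniqueness of characteristic functions.

   Necessity: [|char_fun mu y| = exp (- <Q y, y> / 2 - Psi y)] with [Psi y = \int (1 - cos <y,
x>) N(dx)], so [Psi y <= 1] as soon as [\int (1 - cos <y, x>) mu(dx) <= 1 / 2]. Averaging [y]
over independent random signs along an orthonormal basis turns [cos <y, x>] into the Gaussian
[exp (- s ^ 2 |x| ^ 2 / 2)] in the limit, and bounds [\int_A (1 - exp (- s ^ 2 |x| ^ 2 / 2))
N(dx)] uniformly over the sets [A] of finite mass. *)

(** * Elementary bounds and the complex exponential series *)

(** Neither [M] nor [lambda] is assumed sigma-finite, so no Tonelli exchange is available until both
    are known to integrate a truncated square; that in turn is deduced from finiteness of the
    right-hand side alone. If one of the two measures vanishes, the mixture and both sides are zero
    while the other measure is arbitrary. This is why that case is split off and why the last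
    conclusions assume nonvanishing.

    An infinite-dimensional [H] carries no Gaussian measure with identity covariance; sums of random
    signs replace it. Averages over signs are finite linear combinations, so they commute with
    integrals by linearity, and only the limit uses dominated convergence.

    In the necessity part, [Psi y <= 1] is available only for those [y] at which the mean of
    [1 - cos <y, x>] under [mu] is at most [1 / 2]. The other [y] are controlled by Cauchy-Schwarz
    and by the fact that, in the Gaussian limit, the mean of [(1 - cos) ^ 2] is at most three times
    the squared mean of [1 - cos]. On a set of finite mass the quantity to be bounded is finite, so
    it may be absorbed from the right-hand side. *)

Section RealBounds.
Context {R : realType}.
Implicit Types (x t u z : R) (f g : R -> R).

(** The mean value theorem for [g - f]. The Taylor bounds on [sin], [cos] and [exp] below are
    obtained from one another by comparing derivatives in this way. *)
Lemma le_of_derive f g (df dg : R -> R) :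
  (forall x, is_derive x (1 : R) f (df x)) ->
  (forall x, is_derive x (1 : R) g (dg x)) ->
  f 0 <= g 0 -> (forall x, 0 <= x -> df x <= dg x) ->
  forall x, 0 <= x -> f x <= g x.
Proof.
move=> hf hg fg0 dfg x x0.
pose k y := g y - f y.
case: (@MVT_segment R k (fun y => dg y - df y) 0 x x0).
- apply: continuous_subspaceT => y; apply: differentiable_continuous.
  by apply/derivable1_diffP; exact: ex_derive.
move=> c; rewrite in_itv/= => /andP[c0 cx] /eqP; rewrite subr_eq => /eqP e.
rewrite -subr_ge0 -/(k x) e addr_ge0//; last by rewrite /k subr_ge0.
by rewrite mulr_ge0 ?subr_ge0// dfg.
Qed.

Lemma norm_le_of_derive f g (df dg : R -> R) :
  (forall x, is_derive x (1 : R) f (df x)) ->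
  (forall x, is_derive x (1 : R) g (dg x)) ->
  f 0 = 0 -> 0 <= g 0 -> (forall x, 0 <= x -> `|df x| <= dg x) ->
  forall x, 0 <= x -> `|f x| <= g x.
Proof.
move=> hf hg f0 g0 dfg x x0; rewrite ler_norml lerNl; apply/andP; split.
  apply: (@le_of_derive (fun y => - f y) g (fun y => - df y) dg) => [|y y0|//].
    by rewrite f0 oppr0.
  by rewrite (le_trans (ler_norm _))// normrN dfg.
apply: (@le_of_derive f g df dg) => [|y y0|//]; first by rewrite f0.
by rewrite (le_trans (ler_norm _))// dfg.
Qed.

Lemma sin_le_id x : 0 <= x -> sin x <= x.
Proof.
apply: (@le_of_derive (@sin R) id (@cos R) (fun=> 1)) => [|y _].
- by rewrite sin0.
- exact: cos_le1.
Qed.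

Lemma norm_sin_le x : `|sin x| <= `|x|.
Proof.
have : `|sin `|x| | <= `|x|.
  have [x1|x1] := leP `|x| 1; last by rewrite (le_trans (sin_max _))// ltW.
  rewrite ger0_norm ?sin_le_id//; apply: sin_ge0_pi.
  by rewrite normr_ge0/=; apply: (le_trans x1); have := pi_ge2 R; lra.
by case: (ger0P x) => // _; rewrite sinN normrN.
Qed.

Lemma one_sub_cosE x : 1 - cos x = 2 * sin (x / 2) ^+ 2.
Proof.
have -> : cos x = cos (x / 2 *+ 2) by congr cos; field.
rewrite cos_mulr2n cos2sin2; ring.
Qed.

Lemma one_sub_cos_le x : 1 - cos x <= x ^+ 2 / 2.
Proof.
rewrite one_sub_cosE.
have : sin (x / 2) ^+ 2 <= (x / 2) ^+ 2.
  by rewrite -[leLHS]real_normK ?num_real// -[leRHS]real_normK ?num_real// lerXn2r ?nnegrE// norm_sin_le.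
lra.
Qed.

Lemma one_sub_cos_ge0 x : 0 <= 1 - cos x.
Proof. by rewrite subr_ge0 cos_le1. Qed.

Lemma sin_ge_cubic x : 0 <= x -> x - x ^+ 3 / 6 <= sin x.
Proof.
apply: (@le_of_derive (fun x => x - x ^+ 3 / 6) (@sin R) (fun x => 1 - x ^+ 2 / 2) (@cos R)) => [y||y _].
- by apply: is_derive_eq; rewrite /GRing.scale/=; field.
- by rewrite sin0 expr0n/= mul0r subr0.
- have := one_sub_cos_le y; lra.
Qed.

Lemma cos_le_quartic x : cos x <= 1 - x ^+ 2 / 2 + x ^+ 4 / 24.
Proof.
have h : forall y : R, 0 <= y -> cos y <= 1 - y ^+ 2 / 2 + y ^+ 4 / 24.
  apply: (@le_of_derive (@cos R) (fun y => 1 - y ^+ 2 / 2 + y ^+ 4 / 24) (fun y => - sin y) (fun y => - y + y ^+ 3 / 6)) => [y||y y0].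
  - by apply: is_derive_eq; rewrite /GRing.scale/=; field.
  - by rewrite cos0 !expr0n/= !mul0r subr0 addr0.
  - have := sin_ge_cubic y0; lra.
have := h `|x| (normr_ge0 _); rewrite cos_norm.
rewrite real_normK ?num_real// (_ : `|x| ^+ 4 = x ^+ 4)//.
by rewrite -[4%N]/(2 * 2)%N !exprM real_normK ?num_real.
Qed.

Lemma expRN_le_quadratic u : 0 <= u -> expR (- u) <= 1 - u + u ^+ 2 / 2.
Proof.
have de (y : R) : is_derive y (1 : R) (fun y => expR (- y)) (- expR (- y)).
  apply: is_derive_eq; rewrite /GRing.scale/=; ring.
apply: (@le_of_derive _ (fun u => 1 - u + u ^+ 2 / 2) (fun y => - expR (- y)) (fun y => - 1 + y)) => [y||y y0].
- by apply: is_derive_eq; rewrite /GRing.scale/=; field.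
- by rewrite oppr0 expR0 expr0n/= mul0r !addr0.
- have := expR_ge1Dx (- y); lra.
Qed.

(** Both functions are [1 - z ^ 2 / 2] up to order four. That order is what makes the errors
    negligible in [gauss_prod_cvg], where the steps have size [1 / (k + 1)] and each is repeated
    [(k + 1) ^ 2] times. *)
Lemma norm_cos_sub_gauss z : `|cos z - expR (- (z ^+ 2 / 2))| <= z ^+ 4.
Proof.
have h1 := one_sub_cos_le z; have h2 := cos_le_quartic z.
have h3 := expR_ge1Dx (- (z ^+ 2 / 2)).
have z2 : 0 <= z ^+ 2 / 2 by rewrite divr_ge0// sqr_ge0.
have h4 := expRN_le_quadratic z2.
rewrite ler_norml; lra.
Qed.

(** The quadratic order fits Levy measures, which integrate [|x| ^ 2] near the origin. *)
Lemma norm_sin_sub_id x : `|sin x - x| <= x ^+ 2.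
Proof.
have h : forall y : R, 0 <= y -> y - sin y <= y ^+ 2 / 2.
  apply: (@le_of_derive (fun y => y - sin y) (fun y => y ^+ 2 / 2) (fun y => 1 - cos y) (fun y => y)) => [y||y y0].
  - by apply: is_derive_eq; rewrite /GRing.scale/=; field.
  - by rewrite sin0 expr0n/= mul0r subr0.
  (* The bounds [|s| <= 1] and [|s| <= y / 2] multiply to [2 * s ^ 2 <= y]. *)
  - rewrite one_sub_cosE.
    set s := sin (y / 2).
    have s1 : `|s| <= 1 by exact: sin_max.
    have : `|s| <= y / 2.
      by rewrite (le_trans (norm_sin_le _))// ger0_norm// divr_ge0.
    have : s ^+ 2 = `|s| ^+ 2 by rewrite real_normK ?num_real.
    have := normr_ge0 s.
    by move: `|s| s1 => a; nra.
have {}h (y : R) : 0 <= y -> `|sin y - y| <= y ^+ 2.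
  move=> y0; have := h _ y0; have := sin_le_id y0; have := sqr_ge0 y.
  by rewrite ler_norml; lra.
have [x0|x0] := leP 0 x; first exact: h.
rewrite -normrN (_ : - (sin x - x) = sin (- x) - - x); last by rewrite sinN; ring.
by rewrite -sqrrN; apply: h; lra.
Qed.

(** Telescoping: the factors are exchanged one at a time, all the others being bounded by 1. *)
Lemma norm_prod_sub (a b : nat -> R) n :
  (forall i, `|a i| <= 1) -> (forall i, `|b i| <= 1) ->
  `|\prod_(i < n) a i - \prod_(i < n) b i| <= \sum_(i < n) `|a i - b i|.
Proof.
move=> a1 b1; elim: n => [|n ih]; first by rewrite !big_ord0 subrr normr0.
rewrite !big_ord_recr/=.
set A := \prod_(i < n) a i in ih *; set B := \prod_(i < n) b i in ih *.
have -> : A * a n - B * b n = (A - B) * a n + B * (a n - b n) by ring.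
have B1 : `|B| <= 1.
  by rewrite normr_prod; apply: prodr_ile1 => i; rewrite normr_ge0 b1.
rewrite (le_trans (ler_normD _ _))// !normrM lerD//.
  by rewrite (le_trans _ ih)// ler_piMr.
by rewrite ler_piMl.
Qed.

Lemma norm_exprn_sub (a b : R) n : `|a| <= 1 -> `|b| <= 1 ->
  `|a ^+ n - b ^+ n| <= n%:R * `|a - b|.
Proof.
move=> a1 b1; have := @norm_prod_sub (fun=> a) (fun=> b) n (fun=> a1) (fun=> b1).
by rewrite !prodr_const sumr_const !card_ord mulr_natl.
Qed.

Lemma cvg_of_norm_le (a b e : nat -> R) (l : R) :
  b @ \oo --> l -> e @ \oo --> (0 : R) -> (forall n, `|a n - b n| <= e n) ->
  a @ \oo --> l.
Proof.
move=> bl e0 abe.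
have ab0 : (fun n => a n - b n) @ \oo --> (0 : R).
  apply/cvgr0Pnorm_le => eps eps0.
  move/cvgr0Pnorm_le : e0 => /(_ _ eps0); apply: filterS => n.
  by apply: le_trans; rewrite (le_trans (abe n))// ler_norm.
rewrite [a](_ : _ = (fun n => (a n - b n) + b n)); last first.
  by apply/funext => n; rewrite subrK.
by rewrite -[l]add0r; exact: cvgD.
Qed.

(** A central limit computation: [(k + 1) ^ 2] steps of size [c i / (k + 1)] have total variance
    [c i ^ 2]. Replacing every cosine by its Gaussian costs at most the sum of the
    [c i ^ 4 / (k + 1) ^ 2], while the Gaussian product depends on the sum of squares only. *)
Lemma gauss_prod_cvg (c : nat -> R) (S : R) :
  \sum_(i < k) c i ^+ 2 @[k --> \oo] --> S ->
  \prod_(i < k) cos (c i / k.+1%:R) ^+ (k.+1 * k.+1) @[k --> \oo] -->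
    expR (- (S / 2)).
Proof.
move=> cS.
pose g k := \prod_(i < k) expR (- ((c i / k.+1%:R) ^+ 2 / 2)) ^+ (k.+1 * k.+1).
apply: (@cvg_of_norm_le _ g
    (fun k => (\sum_(i < k) c i ^+ 2) ^+ 2 * (k.+1%:R^-1 * k.+1%:R^-1))).
- have -> : g = (fun k => expR (- ((\sum_(i < k) c i ^+ 2) / 2))).
    apply/funext => k; rewrite /g mulr_suml -sumrN expR_sum; apply: eq_bigr => i _.
    rewrite -expRM_natl; congr expR; rewrite natrM.
    by field.
  apply: continuous_cvg; first exact: continuous_expR.
  by apply: cvgN; apply: cvgMl.
- rewrite -[X in _ --> X](mulr0 (S * S)); apply: cvgM.
    by under eq_fun do rewrite expr2; exact: cvgM.
  rewrite -[X in _ --> X](mulr0 (0 : R)).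
  by apply: cvgM; exact: cvg_harmonic.
move=> k; set N := k.+1%:R.
have le1 (x : R) : `|expR (- (x ^+ 2 / 2))| <= 1.
  by rewrite ger0_norm ?expR_ge0// expR_le1 oppr_le0 divr_ge0// sqr_ge0.
apply: (le_trans (@norm_prod_sub (fun i => cos (c i / N) ^+ (k.+1 * k.+1))
  (fun i => expR (- ((c i / N) ^+ 2 / 2)) ^+ (k.+1 * k.+1)) k _ _)).
- by move=> i; rewrite normrX exprn_ile1// cos_max.
- by move=> i; rewrite normrX exprn_ile1.
apply: (@le_trans _ _ (\sum_(i < k) (c i ^+ 2 * c i ^+ 2) * (N^-1 * N^-1))).
  apply: ler_sum => i _.
  rewrite (le_trans (norm_exprn_sub _ (cos_max _) (le1 _)))//.
  rewrite natrM -/N.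
  have -> : c i ^+ 2 * c i ^+ 2 * (N^-1 * N^-1) = N * N * (c i / N) ^+ 4 by field.
  by rewrite ler_wpM2l ?mulr_ge0// norm_cos_sub_gauss.
rewrite -mulr_suml ler_wpM2r ?mulr_ge0 ?invr_ge0//.
(* The sum of the [c i ^ 4] is at most the square of the sum of the [c i ^ 2], since each square is
   bounded by the whole sum. *)
rewrite expr2 mulr_suml; apply: ler_sum => i _.
rewrite ler_wpM2l ?sqr_ge0//.
by rewrite (bigD1 i)//= lerDl sumr_ge0// => j _; exact: sqr_ge0.
Qed.

Lemma is_derive_exprn (K : R) n (t : R) :
  is_derive t (1 : R) (fun x : R => (K * x) ^+ n.+1) (K * (n.+1%:R * (K * t) ^+ n)).
Proof.
rewrite (_ : (fun x : R => _) = (fun x : R => K * x) ^+ n.+1); last first.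
  by apply/funext => x; rewrite fctE.
by apply: is_derive_eq; rewrite /GRing.scale/=; ring.
Qed.

Definition taylor_sum (c : nat -> R) n t := \sum_(k < n) c k * (t ^+ k / k`!%:R).

Lemma is_derive_taylor_sum (c : nat -> R) n (t : R) :
  is_derive t (1 : R) (taylor_sum c n.+1) (taylor_sum (c \o S) n t).
Proof.
elim: n => [|n ih].
  rewrite /taylor_sum big_ord0.
  have -> : (fun t => \sum_(k < 1) c k * (t ^+ k / k`!%:R)) = cst (c 0%N).
    by apply/funext => s; rewrite big_ord1/= expr0 divr1 mulr1.
  exact: is_derive_cst.
have -> : taylor_sum c n.+2 =
    (fun t => taylor_sum c n.+1 t + c n.+1 * (t ^+ n.+1 / n.+1`!%:R)).
  by apply/funext => s; rewrite /taylor_sum big_ord_recr.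
rewrite /taylor_sum big_ord_recr/= -/(taylor_sum (c \o S) n t).
apply: is_deriveD.
have dE : n`!%:R^-1 = n.+1%:R * n.+1`!%:R^-1 :> R.
  by rewrite factS natrM invfM mulrA mulfV ?mul1r ?pnatr_eq0.
rewrite dE; move: (n.+1`!%:R^-1) => d.
have := is_derive_exprn 1 n t; under eq_fun do rewrite mul1r.
rewrite !mul1r => dX.
by apply: is_derive_eq; rewrite /GRing.scale/=; ring.
Qed.

Section ComplexExponential.
Variables (a b : R) (p q : nat -> R).
Hypotheses (p0 : p 0%N = 1) (q0 : q 0%N = 0).
Hypothesis pS : forall k, p k.+1 = a * p k - b * q k.
Hypothesis qS : forall k, q k.+1 = a * q k + b * p k.

(** [p k + i q k] is [(a + i b) ^ k], and [U], [V] are the real and imaginary parts of the Taylor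
    remainder of [exp ((a + i b) t)] after [n] terms. Differentiation lowers [n] by one; the
    majorant [B] is chosen so that its own derivative dominates the resulting combination of [U n]
    and [V n]. *)
Let U n t := expR (a * t) * cos (b * t) - taylor_sum p n t.
Let V n t := expR (a * t) * sin (b * t) - taylor_sum q n t.
Let B n t := expR (`|a| * t) * (((`|a| + `|b|) * t) ^+ n / n`!%:R).

Let dU n (t : R) : is_derive t (1 : R) (U n.+1) (a * U n t - b * V n t).
Proof.
have dp := is_derive_taylor_sum p n t.
apply: is_derive_eq; rewrite /GRing.scale/= /U /V.
have -> : taylor_sum (p \o S) n t = a * taylor_sum p n t - b * taylor_sum q n t.
  rewrite /taylor_sum !mulr_sumr -sumrB; apply: eq_bigr => i _ /=.
  rewrite pS; ring.
ring.
Qed.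

Let dV n (t : R) : is_derive t (1 : R) (V n.+1) (a * V n t + b * U n t).
Proof.
have dq := is_derive_taylor_sum q n t.
apply: is_derive_eq; rewrite /GRing.scale/= /U /V.
have -> : taylor_sum (q \o S) n t = a * taylor_sum q n t + b * taylor_sum p n t.
  rewrite /taylor_sum !mulr_sumr -big_split; apply: eq_bigr => i _ /=.
  rewrite qS; ring.
ring.
Qed.

Let dB n (t : R) : is_derive t (1 : R) (B n.+1)
  (`|a| * B n.+1 t + (`|a| + `|b|) * B n t).
Proof.
have dE : n`!%:R^-1 = n.+1%:R * n.+1`!%:R^-1 :> R.
  by rewrite factS natrM invfM mulrA mulfV ?mul1r ?pnatr_eq0.
rewrite /B dE; move: (n.+1`!%:R^-1) => d.
have dX := is_derive_exprn (`|a| + `|b|) n t.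
by apply: is_derive_eq; rewrite /GRing.scale/=; ring.
Qed.

Let B_ge0 n t : 0 <= t -> 0 <= B n t.
Proof.
by move=> t0; rewrite mulr_ge0 ?expR_ge0// divr_ge0// exprn_ge0// mulr_ge0.
Qed.

Let taylor_sum0 c n : taylor_sum c n.+1 0 = c 0%N.
Proof.
rewrite /taylor_sum big_ord_recl/= expr0 divr1 mulr1 big1 ?addr0// => i _.
by rewrite expr0n/= mul0r mulr0.
Qed.

Let UV_le n t : 0 <= t -> `|U n t| <= B n t /\ `|V n t| <= B n t.
Proof.
elim: n t => [|n ih] t t0.
  rewrite /U /V /B /taylor_sum !big_ord0 !subr0 expr0 divr1 mulr1.
  have ea : expR (a * t) <= expR (`|a| * t) by rewrite ler_expR ler_wpM2r ?ler_norm.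
  by split; rewrite normrM ger0_norm ?expR_ge0// (le_trans _ ea)// ler_piMr ?expR_ge0 ?cos_max ?sin_max.
have key s : 0 <= s -> forall x y, `|x| <= B n s -> `|y| <= B n s ->
    `|a * x - b * y| <= `|a| * B n.+1 s + (`|a| + `|b|) * B n s.
  move=> s0 x y hx hy.
  rewrite (le_trans (ler_normB _ _))// !normrM mulrDl.
  rewrite (le_trans (lerD (ler_wpM2l _ hx) (ler_wpM2l _ hy)))//.
  by rewrite lerDr mulr_ge0// B_ge0.
have B0 : 0 <= B n.+1 0 by exact: B_ge0.
have U0 : U n.+1 0 = 0.
  by rewrite /U !mulr0 expR0 cos0 mul1r taylor_sum0 p0 subrr.
have V0 : V n.+1 0 = 0.
  by rewrite /V !mulr0 expR0 sin0 mul1r taylor_sum0 q0 subrr.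
split.
  apply: (norm_le_of_derive (dU n) (dB n)) => // s s0.
  by have [hu hv] := ih _ s0; exact: key.
apply: (norm_le_of_derive (dV n) (dB n)) => // s s0.
by have [hu hv] := ih _ s0; rewrite -[b * _]opprK -mulrN key// normrN.
Qed.

Let cvgB : expR `|a| * exp_coeff (`|a| + `|b|) n @[n --> \oo] --> (0 : R).
Proof. by rewrite -(mulr0 (expR `|a|)); apply: cvgMr; exact: cvg_exp_coeff. Qed.

(** The remainder bound at [t = 1] is a constant times a term of the exponential series. Stating the
    powers through their real recursion lets a compound Poisson characteristic function be summed
    without complex analysis. *)
Lemma cexp_series_Re :
  \sum_(k < n) p k / k`!%:R @[n --> \oo] --> expR a * cos b.
Proof.
apply: (@cvg_of_norm_le _ (fun=> expR a * cos b) _ _ (cvg_cst _) cvgB) => n.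
rewrite distrC; have [+ _] := @UV_le n 1 ler01.
rewrite /U /B !mulr1; congr (`|_ - _| <= _).
by apply: eq_bigr => i _; rewrite expr1n mul1r.
Qed.

Lemma cexp_series_Im :
  \sum_(k < n) q k / k`!%:R @[n --> \oo] --> expR a * sin b.
Proof.
apply: (@cvg_of_norm_le _ (fun=> expR a * sin b) _ _ (cvg_cst _) cvgB) => n.
rewrite distrC; have [_ +] := @UV_le n 1 ler01.
rewrite /V /B !mulr1; congr (`|_ - _| <= _).
by apply: eq_bigr => i _; rewrite expr1n mul1r.
Qed.

End ComplexExponential.

End RealBounds.

(** * Orthonormal expansions in a separable Hilbert space *)

(** A predicate on bare functions, so that the development also applies to multiplication on [R^o],
    which is needed for [lambda]. *)
Definition inner_product (R : realType) (H : completeNormedModType R)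
    (ip : H -> H -> R) : Prop :=
  [/\ forall a x y z, ip (a *: x + y) z = a * ip x z + ip y z,
      forall x y, ip x y = ip y x &
      forall x, ip x x = `|x| ^+ 2].

Lemma inner_product_dot (R : realType) (H : completeNormedModType R)
    (ip : {dot H for idfun}) : hilbert_norm ip -> inner_product ip.
Proof.
move=> hip; split => [a x y z|x y|x]; last exact: hip.
  by rewrite linearPl.
by rewrite (@hermitian_subproof _ _ _ _ ip) expr0 mul1r.
Qed.

Lemma inner_product_R (R : realType) :
  inner_product (fun x y : R^o => x * y : R).
Proof.
split => [a x y z|x y|x]; [|exact: mulrC|].
  by rewrite mulrDl -mulrA.
by rewrite real_normK ?num_real// expr2.
Qed.

(** An injection of the dense set into [nat] is inverted; indices without preimage receive the
    default [0]. *)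
Lemma separable_seq (R : realType) (H : completeNormedModType R) :
  separable H -> exists d : nat -> H, forall x e, 0 < e -> exists n, `|x - d n| < e.
Proof.
move=> [D /countable_injP[f] finj dD].
exists (fun n => xget 0 [set x | D x /\ f x = n]) => x e e0.
have [||y []] := dD (ball x e).
- by exists x; exact: ballxx.
- exact: ball_open.
rewrite -ball_normE /= => xy Dy; exists (f y).
case: xgetP => [z _ [Dz fz]|/(_ y)]; last by case.
suff -> : z = y by [].
by apply: finj => //; rewrite inE.
Qed.

Section Hilbert.
Context {R : realType} {H : completeNormedModType R} (ip : H -> H -> R).
Hypothesis hip : inner_product ip.
Implicit Types (x y z : H) (a : R).

Lemma ipC x y : ip x y = ip y x. Proof. by case: hip. Qed.
Lemma ipxx x : ip x x = `|x| ^+ 2. Proof. by case: hip. Qed.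
Lemma ip0l x : ip 0 x = 0.
Proof.
have [h _ _] := hip; have := h 1 0 0 x.
rewrite scaler0 add0r mul1r; lra.
Qed.
Lemma ipDl x y z : ip (x + y) z = ip x z + ip y z.
Proof. by have [h _ _] := hip; rewrite -[x in LHS]scale1r h mul1r. Qed.
Lemma ipZl a x y : ip (a *: x) y = a * ip x y.
Proof. by have [h _ _] := hip; rewrite -[a *: x]addr0 h ip0l addr0. Qed.
Lemma ipNl x y : ip (- x) y = - ip x y.
Proof. by rewrite -scaleN1r ipZl mulN1r. Qed.
Lemma ipBl x y z : ip (x - y) z = ip x z - ip y z.
Proof. by rewrite ipDl ipNl. Qed.
Lemma ip0r x : ip x 0 = 0. Proof. by rewrite ipC ip0l. Qed.
Lemma ipDr x y z : ip x (y + z) = ip x y + ip x z.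
Proof. by rewrite ipC ipDl !(ipC x). Qed.
Lemma ipZr a x y : ip x (a *: y) = a * ip x y.
Proof. by rewrite ipC ipZl (ipC x). Qed.
Lemma ipNr x y : ip x (- y) = - ip x y.
Proof. by rewrite ipC ipNl (ipC x). Qed.
Lemma ipBr x y z : ip x (y - z) = ip x y - ip x z.
Proof. by rewrite ipDr ipNr. Qed.
Lemma ip_suml n (f : nat -> H) y : ip (\sum_(i < n) f i) y = \sum_(i < n) ip (f i) y.
Proof.
by elim: n => [|n ih]; rewrite ?big_ord0 ?ip0l// !big_ord_recr/= ipDl ih.
Qed.
Lemma ip_sumr n (f : nat -> H) y : ip y (\sum_(i < n) f i) = \sum_(i < n) ip y (f i).
Proof. by rewrite ipC ip_suml; apply: eq_bigr => i _; rewrite ipC. Qed.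

Lemma normB_sqr x y : `|x - y| ^+ 2 = `|x| ^+ 2 - 2 * ip x y + `|y| ^+ 2.
Proof. rewrite -!ipxx ipBl !ipBr (ipC y x); ring. Qed.

Lemma normD_sqr x y : `|x + y| ^+ 2 = `|x| ^+ 2 + 2 * ip x y + `|y| ^+ 2.
Proof. rewrite -!ipxx ipDl !ipDr (ipC y x); ring. Qed.

Lemma cauchy_schwarz x y : `|ip x y| <= `|x| * `|y|.
Proof.
have [->|y0] := eqVneq y 0; first by rewrite ip0r !normr0 mulr0.
have ny : 0 < `|y| ^+ 2 by rewrite exprn_gt0// normr_gt0.
have : 0 <= `| (`|y| ^+ 2) *: x - ip x y *: y | ^+ 2 by exact: sqr_ge0.
rewrite normB_sqr ipZl ipZr !normrZ !exprMn !real_normK ?num_real//.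
set c := ip x y.
have -> : (`|y| ^+ 2) ^+ 2 * `|x| ^+ 2 - 2 * (`|y| ^+ 2 * (c * c)) + c ^+ 2 * `|y| ^+ 2
   = `|y| ^+ 2 * ((`|x| * `|y|) ^+ 2 - c ^+ 2) by ring.
rewrite pmulr_rge0// subr_ge0 => h.
by rewrite -ler_sqr ?nnegrE ?mulr_ge0// real_normK ?num_real.
Qed.

Lemma cauchy_schwarz_sq x y : ip x y ^+ 2 <= `|x| ^+ 2 * `|y| ^+ 2.
Proof.
rewrite -exprMn -[leLHS]real_normK ?num_real// lerXn2r ?nnegrE ?mulr_ge0//.
exact: cauchy_schwarz.
Qed.

Lemma ip_continuous y : continuous (ip y).
Proof.
move=> x; apply/cvgrPdist_le => e e0.
have e1 : 0 < e / (`|y| + 1) by rewrite divr_gt0// ltr_wpDl.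
near=> z; rewrite -ipBr.
rewrite (le_trans (cauchy_schwarz _ _))//.
have : `|x - z| <= e / (`|y| + 1) by near: z; apply: cvgr_dist_le.
rewrite ler_pdivlMr ?ltr_wpDl// => h; apply: le_trans h.
by rewrite mulrC ler_wpM2l// lerDl.
Unshelve. all: by end_near. Qed.

Section GramSchmidt.
Variable d : nat -> H.

(* [res n x] is the component of [x] orthogonal to [d 0, ..., d n.-1]; a vanishing residual
   contributes the zero vector, since [0^-1 *: 0 = 0]. *)
Fixpoint res n x : H :=
  if n is m.+1 then
    let u := `|res m (d m)|^-1 *: res m (d m) in res m x - ip (res m x) u *: u
  else x.

Definition gs n : H := `|res n (d n)|^-1 *: res n (d n).

Lemma resS n x : res n.+1 x = res n x - ip (res n x) (gs n) *: gs n.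
Proof. by []. Qed.

Lemma gs_norm n : (gs n = 0) \/ (ip (gs n) (gs n) = 1).
Proof.
rewrite /gs; set r := res n (d n).
have [->|r0] := eqVneq r 0; first by left; rewrite scaler0.
right; rewrite ipxx normrZ exprMn ger0_norm ?invr_ge0//.
by rewrite -exprMn mulVf ?expr1n// normr_eq0.
Qed.

(** Covers both cases of [gs_norm] at once, so that the projection formulas below never ask whether
    a residual vanishes. *)
Lemma ip_gs_idem n x : ip x (gs n) * ip (gs n) (gs n) = ip x (gs n).
Proof. by have [->|->] := gs_norm n; rewrite ?ip0r ?mulr0 ?mulr1. Qed.

Lemma res_ortho n x i : (i < n)%N -> ip (res n x) (gs i) = 0.
Proof.
elim: n x i => // n ih x i; rewrite ltnS leq_eqVlt => /predU1P[->|ni].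
  by rewrite resS ipBl ipZl ip_gs_idem subrr.
have gni : ip (gs n) (gs i) = 0 by rewrite {1}/gs ipZl ih// mulr0.
by rewrite resS ipBl ih// ipZl gni mulr0 subrr.
Qed.

Lemma gs_ortho i j : i != j -> ip (gs i) (gs j) = 0.
Proof.
rewrite neq_ltn => /orP[] ij; last by rewrite {1}/gs ipZl res_ortho// mulr0.
by rewrite ipC {1}/gs ipZl res_ortho// mulr0.
Qed.

Lemma resE n x : res n x = x - \sum_(i < n) ip x (gs i) *: gs i.
Proof.
elim: n => [|n ih]; first by rewrite big_ord0 subr0.
rewrite resS big_ord_recr/= opprD addrA -ih; congr (_ - _ *: _).
rewrite ih ipBl (ip_suml n (fun i => ip x (gs i) *: gs i)) big1 ?subr0// => i _.
by rewrite ipZl gs_ortho ?mulr0// ltn_eqF.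
Qed.

Lemma res_norm n x : `|res n x| ^+ 2 = `|x| ^+ 2 - \sum_(i < n) ip x (gs i) ^+ 2.
Proof.
elim: n => [|n ih]; first by rewrite big_ord0 subr0.
rewrite resS normB_sqr ih big_ord_recr/= ipZr normrZ exprMn -(ipxx (gs n)) real_normK ?num_real//.
have -> : ip (res n x) (gs n) = ip x (gs n).
  rewrite resE ipBl (ip_suml n (fun i => ip x (gs i) *: gs i)) big1 ?subr0// => i _.
  by rewrite ipZl gs_ortho ?mulr0// ltn_eqF.
have := ip_gs_idem n x; set c := ip x (gs n); set g := ip (gs n) (gs n) => cg.
have -> : c ^+ 2 * g = c ^+ 2 by rewrite expr2 -mulrA cg.
ring.
Qed.

Lemma res_le n x : `|res n x| <= `|x|.
Proof.
rewrite -ler_sqr ?nnegrE// res_norm lerBlDr lerDl.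
by apply: sumr_ge0 => i _; exact: sqr_ge0.
Qed.

Lemma resB n x y : res n (x - y) = res n x - res n y.
Proof.
rewrite !resE (eq_bigr (fun i : 'I_n => ip x (gs i) *: gs i - ip y (gs i) *: gs i)).
  by rewrite sumrB opprD addrACA -opprD.
by move=> i _; rewrite ipBl scalerBl.
Qed.

Lemma res_homo m n x : (m <= n)%N -> `|res n x| <= `|res m x|.
Proof.
move=> mn; rewrite -ler_sqr ?nnegrE// !res_norm lerD2l lerN2.
rewrite -(subnKC mn) big_split_ord/= lerDl.
by apply: sumr_ge0 => i _; exact: sqr_ge0.
Qed.

Lemma res_d n : res n.+1 (d n) = 0.
Proof.
rewrite resS /gs; set r := res n (d n).
have [->|r0] := eqVneq r 0; first by rewrite !scaler0 subrr.
rewrite ipZr ipxx scalerA.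
have -> : `|r|^-1 * `|r| ^+ 2 / `|r| = 1.
  by rewrite expr2 mulrA mulVf ?normr_eq0// mul1r mulfV ?normr_eq0.
by rewrite scale1r subrr.
Qed.

Hypothesis ddense : forall x e, 0 < e -> exists n, `|x - d n| < e.

(** From rank [k + 1] on, [d k] has residual 0, so [x] and [x - d k] have the same residual;
    residuals do not exceed the norm, and [d k] can be taken close to [x]. *)
Lemma res_cvg0 x : res n x @[n --> \oo] --> (0 : H).
Proof.
apply/cvgr0Pnorm_le => e /(ddense x)[k xk]; exists k.+1 => // n /= kn.
rewrite (le_trans (res_homo x kn))//.
have -> : res k.+1 x = res k.+1 (x - d k) by rewrite resB res_d subr0.
by rewrite (le_trans (res_le _ _))// ltW.
Qed.

End GramSchmidt.

(** Norm at most 1 instead of exactly 1 admits zero vectors. Finite-dimensional spaces are thus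
    covered without a separate case. *)
Definition parseval_basis (e : nat -> H) : Prop :=
  [/\ forall i j, i != j -> ip (e i) (e j) = 0,
      forall i, ip (e i) (e i) <= 1,
      forall x, \sum_(i < n) ip x (e i) ^+ 2 @[n --> \oo] --> `|x| ^+ 2 &
      forall x, \sum_(i < n) ip x (e i) *: e i @[n --> \oo] --> x].

Lemma exists_parseval_basis : separable H -> exists e, parseval_basis e.
Proof.
move=> /separable_seq[d dd]; exists (gs d); split.
- exact: gs_ortho.
- by move=> i; have [->|->] := gs_norm d i; rewrite ?ip0l ?ler01.
- move=> x; have h := res_cvg0 dd x.
  have {}h : `|res d n x| ^+ 2 @[n --> \oo] --> (0 : R).
    by rewrite -(mulr0 0); apply: cvgM; rewrite -(@normr0 _ H); exact: cvg_norm.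
  rewrite (_ : (fun n => _) = (fun n => `|x| ^+ 2 - `|res d n x| ^+ 2)); last first.
    by apply/funext => n; rewrite res_norm; ring.
  by rewrite -[X in _ --> X]subr0; apply: cvgB => //; exact: cvg_cst.
- move=> x; have h := res_cvg0 dd x.
  rewrite (_ : (fun n => _) = (fun n => x - res d n x)); last first.
    by apply/funext => n; rewrite resE opprB addrC subrK.
  by rewrite -[X in _ --> X]subr0; apply: cvgB => //; exact: cvg_cst.
Qed.

Section Parseval.
Variable e : nat -> H.
Hypothesis he : parseval_basis e.

Lemma parseval x : \sum_(i < n) ip x (e i) ^+ 2 @[n --> \oo] --> `|x| ^+ 2.
Proof. by case: he. Qed.

Lemma parseval_le n x : \sum_(i < n) ip x (e i) ^+ 2 <= `|x| ^+ 2.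
Proof.
have h := @parseval x.
rewrite -(cvg_lim _ h)//; apply: nondecreasing_cvgn_le; last by apply/cvg_ex; eexists; exact: h.
move=> m k mk; rewrite -(subnKC mk) big_split_ord/= lerDl.
by apply: sumr_ge0 => i _; exact: sqr_ge0.
Qed.

Lemma parseval_norm_sum (c : nat -> R) m n : (m <= n)%N ->
  `|\sum_(m <= i < n) c i *: e i| ^+ 2 <= \sum_(m <= i < n) c i ^+ 2.
Proof.
have [ho h1 _ _] := he.
elim: n => [|n ih] mn; first by rewrite !big_geq// normr0 expr0n.
have [mn'|nm] := leqP m n; last by rewrite !big_geq// normr0 expr0n.
rewrite !big_nat_recr//= normD_sqr ipZr.
have -> : ip (\sum_(m <= i < n) c i *: e i) (e n) = 0.
  have : forall k, (k <= n)%N -> ip (\sum_(m <= i < k) c i *: e i) (e n) = 0.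
    elim=> [|k ihk] kn; first by rewrite big_geq// ip0l.
    have [mk|km] := leqP m k; last by rewrite big_geq// ip0l.
    by rewrite big_nat_recr//= ipDl ihk ?(ltnW kn)// ipZl ho ?mulr0 ?addr0// ltn_eqF.
  exact.
rewrite !mulr0 addr0 lerD ?ih// normrZ exprMn real_normK ?num_real// -ipxx.
by rewrite ler_piMr ?sqr_ge0.
Qed.

(** Provides the recentring vector of a compound Poisson law. The representing vector is the sum of
    the [L (e i) *: e i], which converges because [L] tested on its own partial sums bounds the sum
    of the [L (e i) ^ 2] by [K ^ 2]. *)
Lemma riesz (L : H -> R) (K : R) :
  (forall a x y, L (a *: x + y) = a * L x + L y) ->
  (forall x, `|L x| <= K * `|x|) ->
  exists v, forall x, L x = ip x v.
Proof.
move=> Llin LK.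
have L0 : L 0 = 0 by have := Llin 1 0 0; rewrite scaler0 add0r mul1r; lra.
have Lsum n (c : nat -> R) : L (\sum_(i < n) c i *: e i) = \sum_(i < n) c i * L (e i).
  elim: n => [|n ih]; first by rewrite !big_ord0.
  by rewrite !big_ord_recr/= addrC Llin ih addrC.
have K0 : 0 <= K * K.
  by rewrite -expr2 sqr_ge0.
have S_le n : \sum_(i < n) L (e i) ^+ 2 <= K * K.
  set s := \sum_(i < n) _.
  have s0 : 0 <= s by apply: sumr_ge0 => i _; exact: sqr_ge0.
  set v := \sum_(0 <= i < n) L (e i) *: e i.
  have vs : `|v| ^+ 2 <= s.
    by rewrite (le_trans (parseval_norm_sum _ _))// big_mkord.
  have Lv : L v = s.
    by rewrite /v big_mkord (Lsum n (fun i => L (e i))); apply: eq_bigr => i _; rewrite expr2.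
  have := LK v; rewrite Lv ger0_norm// => h.
  (* [s = L v] is at most [K * |v|] and [|v| ^ 2 <= s]; dividing by a nonzero [s] gives the
     bound. *)
  have : s * s <= K * K * s.
    apply: (@le_trans _ _ ((K * `|v|) * (K * `|v|))); first by rewrite ler_pM.
    by rewrite mulrACA ler_wpM2l// -expr2.
  have [->//|sn] := eqVneq s 0.
  by rewrite ler_pM2r// lt0r sn.
have Scvg : cvgn (series (fun i => L (e i) ^+ 2)).
  apply: nondecreasing_is_cvgn.
    by apply: nondecreasing_series => *; exact: sqr_ge0.
  by exists (K * K) => _ [n _ <-]; rewrite seriesEord; exact: S_le.
have vcvg : cvgn (series (fun i => L (e i) *: e i)).
  apply/cauchy_cvgP/cauchy_seriesP => eps eps0.
  move/cauchy_cvgP/cauchy_seriesP : Scvg => /(_ (eps ^+ 2)).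
  rewrite exprn_gt0// => /(_ isT); apply: filterS => -[m n]/=.
  have [mn|nm] := leqP m n; last by rewrite !big_geq ?normr0// ltnW.
  rewrite ger0_norm; last by apply: sumr_ge0 => i _; exact: sqr_ge0.
  move=> h; rewrite -ltr_sqr ?nnegrE ?(ltW eps0)//.
  by rewrite (le_lt_trans _ h)// parseval_norm_sum.
exists (limn (series (fun i => L (e i) *: e i))) => x.
have h1 : ip x (series (fun i => L (e i) *: e i) n) @[n --> \oo] -->
    ip x (limn (series (fun i => L (e i) *: e i))).
  by apply: continuous_cvg; [exact: ip_continuous|exact: vcvg].
have Lcont : continuous L.
  move=> y; apply/cvgrPdist_le => eps eps0.
  have LB z : L y - L z = L (y - z).
    have := Llin (-1) z y; rewrite scaleN1r addrC => ->; ring.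
  have e1 : 0 < eps / (`|K| + 1) by rewrite divr_gt0.
  near=> z; rewrite LB.
  have : `|y - z| <= eps / (`|K| + 1) by near: z; apply: cvgr_dist_le.
  rewrite ler_pdivlMr// => h; rewrite (le_trans (LK _))// (le_trans _ h)// mulrC.
  by rewrite ler_wpM2l// (le_trans (ler_norm _))// lerDl.
have [_ _ _ hx] := he.
have h2 : L (\sum_(i < n) ip x (e i) *: e i) @[n --> \oo] --> L x.
  by apply: continuous_cvg; [exact: Lcont|exact: hx].
move: h1; rewrite (_ : (fun n => _) = (fun n => L (\sum_(i < n) ip x (e i) *: e i))).
  by move=> h1; apply: (cvg_unique _ h2 h1).
apply/funext => n; rewrite seriesEord (ip_sumr n (fun i => L (e i) *: e i)) (Lsum n (fun i => ip x (e i))).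
by apply: eq_bigr => i _; rewrite ipZr mulrC.
Unshelve. all: by end_near. Qed.

End Parseval.
End Hilbert.

(** * Borel measurability through coordinates *)

Section Borel.
Context {R : realType} {H : completeNormedModType R}.

Lemma open_borel (A : set H) : open A -> measurable (A : set (borel H)).
Proof. by move=> oA; exact: sub_sigma_algebra. Qed.

Lemma closed_borel (A : set H) : closed A -> measurable (A : set (borel H)).
Proof.
by move=> cA; rewrite -(setCK A); apply: measurableC; apply: open_borel; exact: closed_openC.
Qed.

Lemma continuous_borel (f : H -> R) :
  continuous f -> measurable_fun [set: borel H] (f : borel H -> R).
Proof.
move=> /continuousP cf; apply: (measurability _ (RGenOpens.measurableE R)).
move=> _ [_ [a [b ->] <-]]; rewrite setTI; apply: open_borel.
by apply: cf; exact: interval_open.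
Qed.

Lemma measurable_norm_borel :
  measurable_fun [set: borel H] ((fun x : H => `|x|) : borel H -> R).
Proof. by apply: continuous_borel; exact: norm_continuous. Qed.

Lemma measurable_set0_borel : measurable ([set 0] : set (borel H)).
Proof. by apply: closed_borel; apply: accessible_closed_set1; apply: hausdorff_accessible; exact: norm_hausdorff. Qed.

Variable ip : H -> H -> R.
Hypothesis hip : inner_product ip.

Lemma measurable_ip (y : H) : measurable_fun [set: borel H] (ip y : borel H -> R).
Proof. by apply: continuous_borel; exact: ip_continuous. Qed.

Variable e : nat -> H.
Hypothesis he : parseval_basis ip e.
Hypothesis hsep : separable H.

(** An open set is a countable union of balls centred on a dense sequence, and by Parseval the
    squared distance to a centre is a limit of sums over coordinates. This is how addition and
    scaling become measurable for the product sigma-algebra rather than for the Borel sets of the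
    product space. *)
Lemma measurable_to_borel d (T : measurableType d) (f : T -> borel H) :
  (forall i, measurable_fun [set: T] (fun t => ip (f t) (e i) : R)) ->
  measurable_fun [set: T] f.
Proof.
move=> mf; apply: (@measurability _ _ _ _ _ _ (@open H : set (set (borel H)))) => //.
move=> _ [U oU <-]; rewrite setTI.
have [s sd] := separable_seq hsep.
pose B n k := [set z : H | `|z - s n| < k.+1%:R^-1].
have -> : f @^-1` U =
    \bigcup_n \bigcup_(k in [set k | B n k `<=` U]) (f @^-1` (B n k)).
  rewrite predeqE => t; split => [Uft|[n _ [k kU]]]; last exact: kU.
  have /nbhs_ballP[r /= r0 rU] : nbhs (f t : H) U by exact: open_nbhs_nbhs.
  have r20 : 0 < r / 2 by rewrite divr_gt0.
  have [k _ /(_ k (leqnn k))/= kr] := near_infty_natSinv_lt (PosNum r20).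
  have [n sn] := sd (f t : H) k.+1%:R^-1 ltac:(by rewrite invr_gt0).
  exists n => //; exists k => //= z /= zn; apply: rU; rewrite -ball_normE /=.
  have -> : (f t : H) - z = ((f t : H) - s n) - (z - s n) by rewrite opprB addrA subrK.
  rewrite (le_lt_trans (ler_normB _ _))// (lt_trans (ltrD sn zn))//.
  by rewrite (splitr r) ltrD.
apply: bigcupT_measurable => n; apply: bigcup_measurable => k _.
have mn : measurable_fun [set: T] (fun t => `|(f t : H) - s n| ^+ 2 : R).
  apply: (@measurable_fun_cvg _ _ _ _
    (fun m t => \sum_(i < m) (ip (f t) (e i) - ip (s n) (e i)) ^+ 2)).
    move=> m; apply: measurable_sum => i; apply: measurable_funX.
    by apply: measurable_funB => //; exact: mf.
  have [_ _ hp _] := he; move=> t _; have := hp ((f t : H) - s n).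
  by under [in X in X -> _]eq_fun do under eq_bigr do rewrite (ipBl hip).
rewrite (_ : _ @^-1` _ =
    (fun t => `|(f t : H) - s n| ^+ 2) @^-1` [set` `]-oo, (k.+1%:R^-1 ^+ 2)[%R]); last first.
  rewrite predeqE => t; rewrite /B /= in_itv/= ltr_sqr ?nnegrE ?invr_ge0//.
by rewrite -[X in measurable X]setTI; exact: mn.
Qed.

Lemma measurable_addH : measurable_fun [set: borel H * borel H]
  ((fun p => (p.1 : H) + (p.2 : H)) : borel H * borel H -> borel H).
Proof.
apply: measurable_to_borel => i.
under eq_fun do rewrite (ipDl hip).
have m1 := measurable_ip (e i).
apply: measurable_funD.
  under eq_fun do rewrite (ipC hip).
  exact: (measurableT_comp m1 measurable_fst).
under eq_fun do rewrite (ipC hip).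
exact: (measurableT_comp m1 measurable_snd).
Qed.

Lemma measurable_scaleH : measurable_fun [set: measurableTypeR R * borel H]
  ((fun p => (p.1 : R) *: (p.2 : H)) : measurableTypeR R * borel H -> borel H).
Proof.
apply: measurable_to_borel => i.
under eq_fun do rewrite (ipZl hip).
have m1 := measurable_ip (e i).
apply: measurable_funM; first exact: measurable_fst.
under eq_fun do rewrite (ipC hip).
exact: (measurableT_comp m1 measurable_snd).
Qed.

Lemma measurable_shift (a : H) :
  measurable_fun [set: borel H] ((fun x => a + (x : H)) : borel H -> borel H).
Proof.
apply: measurable_to_borel => i.
under eq_fun do rewrite (ipDl hip) [ip _ (e i) in X in _ + X](ipC hip).
by apply: measurable_funD => //; exact: measurable_ip.
Qed.

End Borel.

(** * Characteristic functions determine the law *)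

Section BoundedIntegrals.
Context d (T : measurableType d) (R : realType).
Variables (mu : {measure set T -> \bar R}) (D : set T).
Hypotheses (mD : measurable D) (muD : (mu D < +oo)%E).

Lemma bounded_integrable (f : T -> R) (K : R) :
  measurable_fun [set: T] f -> (forall x, `|f x| <= K) ->
  mu.-integrable D (EFin \o f).
Proof.
move=> mf fK; apply: measurable_bounded_integrable => //.
  exact: measurable_funTS.
by exists K; split; [exact: num_real|move=> M KM x _ /=; rewrite (le_trans (fK x))// ltW].
Qed.

Lemma bounded_integrable_cst (r : R) : mu.-integrable D (EFin \o (fun=> r : R)).
Proof. exact: (@bounded_integrable (fun=> r) `|r|). Qed.

Lemma bounded_cvg_Rintegral (f_ : nat -> T -> R) (f : T -> R) (K : R) :
  (forall n, measurable_fun [set: T] (f_ n)) ->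
  (forall n x, `|f_ n x| <= K) -> (forall x, f_ n x @[n --> \oo] --> f x) ->
  \int[mu]_(x in D) f_ n x @[n --> \oo] --> \int[mu]_(x in D) f x.
Proof.
move=> mf fK ff.
have mlim : measurable_fun [set: T] f.
  by apply: (@measurable_fun_cvg _ _ _ _ f_) => // x _; exact: ff.
have flK x : `|f x| <= K.
  have h : `|f_ n x| @[n --> \oo] --> `|f x| by exact: cvg_norm.
  rewrite -(cvg_lim _ h)//; apply: limr_le; first by apply/cvg_ex; eexists; exact: h.
  by apply: nearW => n; exact: fK.
have fi := bounded_integrable mlim flK.
apply: fine_cvg; rewrite fineK; last exact: integrable_fin_num.
apply: (@dominated_cvg _ _ _ mu D mD _ _ (fun=> K%:E)) => //.
- by move=> n; apply/measurable_EFinP; exact: measurable_funTS.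
- by move=> x _; apply: cvg_EFin; [exact: nearW|exact: ff].
- exact: bounded_integrable_cst.
- by move=> n x _; rewrite lee_fin.
Qed.

End BoundedIntegrals.

Lemma measurable_cos d (T : measurableType d) (R : realType) (f : T -> R) :
  measurable_fun [set: T] f -> measurable_fun [set: T] (fun x => cos (f x)).
Proof.
by move=> mf; apply: (measurableT_comp (f := @cos R)) => //;
  apply: continuous_measurable_fun; exact: continuous_cos.
Qed.

Lemma measurable_sin d (T : measurableType d) (R : realType) (f : T -> R) :
  measurable_fun [set: T] f -> measurable_fun [set: T] (fun x => sin (f x)).
Proof.
by move=> mf; apply: (measurableT_comp (f := @sin R)) => //;
  apply: continuous_measurable_fun; exact: continuous_sin.
Qed.

Lemma Rintegral_probability_cst d (T : measurableType d) (R : realType)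
    (P : probability T R) (r : R) : \int[P]_(_ in [set: T]) r = r.
Proof.
rewrite Rintegral_cst// -[RHS]mulr1; congr (_ * _).
exact: (congr1 fine (probability_setT P)).
Qed.

Lemma measurable_onem d (T : measurableType d) (R : realType) (f : T -> R) :
  measurable_fun [set: T] f -> measurable_fun [set: T] (fun x => 1 - f x).
Proof. by move=> mf; apply: measurable_funB => //; exact: measurable_cst. Qed.

(** * Averages over random signs and their Gaussian limit *)

Section Averages.
Context {R : realType} {H : completeNormedModType R}.
Implicit Types (l : seq H) (F G : H -> R) (y : H).

(* [avg l F y] is the mean of [F (y + \sum_(v <- l) eps_v *: v)] over independent uniform signs
   [eps_v]. *)
Fixpoint avg l F y : R :=
  if l is v :: l' then (avg l' F (y + v) + avg l' F (y - v)) / 2 else F y.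

Lemma avg_le l F G y : (forall z, F z <= G z) -> avg l F y <= avg l G y.
Proof.
move=> FG; elim: l y => [|v l ih] y //=.
by rewrite ler_wpM2r ?invr_ge0// lerD.
Qed.

Lemma eq_avg l F G y : (forall z, F z = G z) -> avg l F y = avg l G y.
Proof. by move=> FG; elim: l y => [|v l ih] y //=; rewrite !ih. Qed.

Lemma avg_lin l F G (a b : R) y :
  avg l (fun z => a * F z + b * G z) y = a * avg l F y + b * avg l G y.
Proof. by elim: l y => [|v l ih] y //=; rewrite !ih; field. Qed.

Lemma avg_scale l F (a : R) y : avg l (fun z => a * F z) y = a * avg l F y.
Proof. by elim: l y => [|v l ih] y //=; rewrite !ih; field. Qed.

Lemma avg_cst l (a : R) y : avg l (fun=> a) y = a.
Proof. by elim: l y => [|v l ih] y //=; rewrite !ih; field. Qed.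

(** A sign average is a finite combination of values, so the exchange is mere linearity and requires
    no measurability of [F] in the averaged variable. *)
Lemma avg_Rintegral d (T : measurableType d) (mu : {measure set T -> \bar R})
    (D : set T) l (F : H -> T -> R) y : measurable D ->
  (forall z, mu.-integrable D (EFin \o F z)) ->
  mu.-integrable D (EFin \o (fun x => avg l (F ^~ x) y)) /\
  avg l (fun z => \int[mu]_(x in D) F z x) y =
    \int[mu]_(x in D) avg l (F ^~ x) y.
Proof.
move=> mD iF; elim: l y => [|v l ih] y /=; first by split => //; exact: iF.
have [i1 e1] := ih (y + v); have [i2 e2] := ih (y - v).
have iD : mu.-integrable D (EFin \o (fun x => avg l (F^~ x) (y + v) + avg l (F^~ x) (y - v))).
  exact: (integrableD mD i1 i2).
split.
  have := integrableZl mD 2^-1 iD; apply: eq_integrable => // x _ /=.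
  by rewrite -EFinM mulrC.
by rewrite RintegralZr// RintegralD// e1 e2.
Qed.

Variable ip : H -> H -> R.
Hypothesis hip : inner_product ip.

(** By [cos (a + b) + cos (a - b) = 2 cos a cos b], each sign contributes a factor [cos <v, x>] and
    leaves the phase unchanged. *)
Lemma avg_cos l x (c : R) y :
  avg l (fun z => cos (ip z x + c)) y = cos (ip y x + c) * \prod_(v <- l) cos (ip v x).
Proof.
elim: l y => [|v l ih] y /=; first by rewrite big_nil mulr1.
rewrite !ih big_cons (ipDl hip) (ipBl hip).
have -> : ip y x + ip v x + c = (ip y x + c) + ip v x by ring.
have -> : ip y x - ip v x + c = (ip y x + c) - ip v x by ring.
by rewrite cosD cosB; field.
Qed.

Variable e : nat -> H.
Hypothesis he : parseval_basis ip e.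

(** A random walk in place of a Gaussian vector with variance [s ^ 2] along each of the first [k]
    basis vectors. The number of directions and the refinement grow with the same index, so that a
    single limit suffices. *)
Definition gauss_steps (s : R) (k : nat) : seq H :=
  flatten [seq nseq (k.+1 * k.+1) ((s / k.+1%:R) *: e i) | i <- iota 0 k].

Definition gavg s k F := avg (gauss_steps s k) F 0.

Lemma gavg_cosE s k x c : gavg s k (fun z => cos (ip z x + c)) =
  cos c * \prod_(i < k) cos (s * ip x (e i) / k.+1%:R) ^+ (k.+1 * k.+1).
Proof.
rewrite /gavg avg_cos (ip0l hip) add0r; congr (_ * _).
rewrite /gauss_steps big_flatten big_map.
have -> : iota 0 k = index_iota 0 k by rewrite /index_iota subn0.
rewrite big_mkord.
apply: eq_bigr => i _; rewrite big_nseq iter_mulr_1 (ipZl hip) (ipC hip).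
by congr (cos _ ^+ _); field.
Qed.

Lemma gavg_cos_cvg s x c : gavg s k (fun z => cos (ip z x + c)) @[k --> \oo] -->
  cos c * expR (- (s ^+ 2 * `|x| ^+ 2 / 2)).
Proof.
under eq_fun do rewrite gavg_cosE.
apply: cvgMr.
apply: (@gauss_prod_cvg R (fun i => s * ip x (e i)) (s ^+ 2 * `|x| ^+ 2)).
have [_ _ hp _] := he.
rewrite (_ : (fun k => _) = (fun k => s ^+ 2 * \sum_(i < k) ip x (e i) ^+ 2)).
  by apply: cvgMr; exact: hp.
by apply/funext => k; rewrite mulr_sumr; apply: eq_bigr => i _; rewrite exprMn.
Qed.

Lemma norm_gavg_cos s k x c : `|gavg s k (fun z => cos (ip z x + c))| <= 1.
Proof.
rewrite gavg_cosE normrM -[leRHS]mulr1 ler_pM// ?cos_max// normr_prod.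
by apply: prodr_ile1 => i; rewrite normr_ge0 normrX exprn_ile1// cos_max.
Qed.

End Averages.

Section Characters.
Context {R : realType} {H : completeNormedModType R} (ip : H -> H -> R).
Local Notation law := (probability (borel H) R).

Lemma char_funE (mu : law) y :
  char_fun ip mu y = (\int[mu]_x cos (ip y x) +i* \int[mu]_x sin (ip y x))%C.
Proof.
rewrite /char_fun /cintegral /cexp /=; congr (_ +i* _)%C;
  by apply: eq_Rintegral => x _; rewrite expR0 mul1r.
Qed.

Lemma cexpD (z w : R[i]) : cexp (z + w)%C = (cexp z * cexp w)%C.
Proof.
case: z => a b; case: w => c d; rewrite /cexp /=; congr (_ +i* _)%C.
  by rewrite expRD cosD; ring.
by rewrite expRD sinD; ring.
Qed.

End Characters.

Lemma cvg_expR_decay (R : realType) (c : R) : 0 < c ->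
  expR (- (k%:R * c)) @[k --> \oo] --> (0 : R).
Proof.
move=> c0; under eq_fun => k do rewrite -mulrN expRM_natl.
by apply: cvg_expr; rewrite ger0_norm ?expR_ge0// expR_lt1 oppr_lt0.
Qed.

(** [r] and [d] stand for a squared radius and a squared distance, and the exponent [m] is about
    [k * exp (k r)]. Put [u = exp (- k d)]. If [d <= r], then [m u >= k] and
    [(1 - u) ^ m <= exp (- k)]. If [d > r], then [1 - (1 - u) ^ m <= m u], which is at most
    [k exp (- k (d - r)) + exp (- k d)]. *)
Lemma bump_approx (R : realType) (r d : R) : 0 <= r -> 0 <= d ->
  (fun k => 1 - (1 - expR (- (k%:R * d))) ^+ (Num.truncn (k%:R * expR (k%:R * r))).+1) @ \oo -->
  (if d <= r then 1 else 0 : R).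
Proof.
move=> r0 d0; pose m (k : nat) := (Num.truncn (k%:R * expR (k%:R * r))).+1.
have [dr|dr] := leP d r.
  rewrite -[X in _ --> X]subr0; apply: cvgB; first exact: cvg_cst.
  apply: (@cvg_of_norm_le _ _ (fun=> 0) (fun k => expR (- (k%:R * 1)))).
  - exact: cvg_cst.
  - exact: cvg_expR_decay.
  move=> k; rewrite subr0 mulr1; set u := expR (- (k%:R * d)).
  have u1 : u <= 1 by rewrite expR_le1 oppr_le0 mulr_ge0.
  rewrite ger0_norm; last by rewrite exprn_ge0// subr_ge0.
  apply: (@le_trans _ _ (expR (- u) ^+ m k)).
    by rewrite lerXn2r ?nnegrE ?subr_ge0 ?expR_ge0// expR_ge1Dx.
  rewrite -expRM_natl ler_expR mulrN lerN2.
  apply: (@le_trans _ _ (k%:R * expR (k%:R * r) * u)).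
    rewrite -mulrA -expRD ler_peMr// -[leLHS]expR0 ler_expR -mulrBr.
    by rewrite mulr_ge0// subr_ge0.
  by rewrite ler_wpM2r ?expR_ge0// ltW// truncnS_gt.
have {}d0 : 0 < d by apply: le_lt_trans dr.
(* Half of the gap absorbs the factor [k], the other half provides the decay. *)
have dr2 : 0 < (d - r) / 2 by rewrite divr_gt0// subr_gt0.
apply: (@cvg_of_norm_le _ _ (fun=> 0) (fun k =>
  ((d - r) / 2)^-1 * expR (- (k%:R * ((d - r) / 2))) + expR (- (k%:R * d)))).
- exact: cvg_cst.
- rewrite -[X in _ --> X]addr0; apply: cvgD; last exact: cvg_expR_decay.
  rewrite -[X in _ --> X](mulr0 (((d - r) / 2)^-1)).
  by apply: cvgMr; exact: cvg_expR_decay.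
move=> k; rewrite subr0; set u := expR (- (k%:R * d)).
have u0 : 0 <= u by exact: expR_ge0.
have u1 : u <= 1 by rewrite expR_le1 oppr_le0 mulr_ge0// ltW.
have := @norm_exprn_sub R 1 (1 - u) (m k); rewrite expr1n normr1 => h.
have {h} := h (lexx 1).
rewrite ger0_norm ?subr_ge0// => /(_ _)/le_trans; apply; first by lra.
rewrite opprB addrCA subrr addr0 ger0_norm//.
have mk : (m k)%:R <= k%:R * expR (k%:R * r) + 1.
  by rewrite -natr1 lerD2r truncn_le.
apply: (@le_trans _ _ ((k%:R * expR (k%:R * r) + 1) * u)).
  by rewrite ler_wpM2r.
rewrite mulrDl mul1r lerD2r -mulrA -expRD.
set c := (d - r) / 2.
have -> : k%:R * r + - (k%:R * d) = - (k%:R * c) + - (k%:R * c) by rewrite /c; field.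
rewrite expRD mulrA ler_wpM2r ?expR_ge0//.
rewrite expRN ler_pdivrMr ?expR_gt0// ler_pdivlMl//.
by apply: le_trans (expR_ge1Dx _); rewrite mulrC lerDr.
Qed.

(* A finite measure is determined by its characteristic function: averaging characters over signs
   gives the integrals of Gaussian bumps in the limit, bumps are closed under products, and [1 -
   (1 - u ^+ k) ^+ m] for suitable [m] turns the bump [u] into the indicator of a closed ball. *)
Section Uniqueness.
Context {R : realType} {H : completeNormedModType R} (ip : H -> H -> R).
Local Notation law := (probability (borel H) R).
Hypothesis hip : inner_product ip.
Hypothesis hsep : separable H.
Variables mu nu : law.
Hypothesis hchar : forall y, char_fun ip mu y = char_fun ip nu y.

Let mT (P : law) : (P setT < +oo)%E.
Proof. by rewrite probability_setT ltry. Qed.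

Let mcos (y : H) (c : R) : measurable_fun [set: borel H] ((fun x : H => cos (ip y x + c)) : borel H -> R).
Proof. by apply: measurable_cos; apply: measurable_funD => //; exact: measurable_ip. Qed.

Let icos (P : law) (y : H) (c : R) :
  P.-integrable setT (EFin \o ((fun x : H => cos (ip y x + c)) : borel H -> R)).
Proof. by apply: (bounded_integrable measurableT (mT P) (mcos y c)) => x; exact: cos_max. Qed.

Let isin (P : law) (y : H) :
  P.-integrable setT (EFin \o ((fun x : H => sin (ip y x)) : borel H -> R)).
Proof.
apply: (bounded_integrable measurableT (mT P) (measurable_sin (measurable_ip hip y))).
by move=> x; exact: sin_max.
Qed.

(** The phase will be [- <y, a>], which gives access to bumps centred at any [a]. *)
Let cos_eq (y : H) (c : R) :
  \int[mu]_x cos (ip y x + c) = \int[nu]_x cos (ip y x + c).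
Proof.
have E (P : law) : \int[P]_x cos (ip y x + c) =
    cos c * \int[P]_x cos (ip y x) - sin c * \int[P]_x sin (ip y x).
  have i0 : P.-integrable setT (EFin \o ((fun x : H => cos (ip y x)) : borel H -> R)).
    by have := icos P y 0; congr (_.-integrable _ _); apply/funext => x /=; rewrite addr0.
  have i1 := isin P y.
  rewrite -!RintegralZl// -RintegralB//.
  - by apply: eq_Rintegral => x _; rewrite cosD; ring.
  - exact: (integrableZl _ (cos c) i0).
  - exact: (integrableZl _ (sin c) i1).
by rewrite !E; have := hchar y; rewrite !char_funE => -[-> ->].
Qed.

Definition bump (s : R) (a x : H) : R := expR (- (s * `|x - a| ^+ 2)).

Lemma bump_ge0 s a x : 0 <= bump s a x. Proof. exact: expR_ge0. Qed.

Lemma bump_le1 s a x : 0 <= s -> bump s a x <= 1.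
Proof. by move=> s0; rewrite expR_le1 oppr_le0 mulr_ge0// sqr_ge0. Qed.

Lemma measurable_bump s a : measurable_fun [set: borel H] (bump s a : borel H -> R).
Proof.
apply: continuous_borel => x; apply: continuous_comp; last exact: continuous_expR.
apply: cvgN; apply: cvgMr; under eq_fun do rewrite expr2; rewrite expr2.
have c1 : `|y - a| @[y --> x] --> `|x - a|.
  by apply: cvg_norm; apply: cvgB; [exact: cvg_id|exact: cvg_cst].
exact: cvgM.
Qed.

(** Completing the square around the weighted mean of the two centres; for [s + t = 0] there is no
    such mean, but both bumps are then constantly 1. *)
Lemma bump_mul s a t b : 0 <= s -> 0 <= t ->
  exists c r z, 0 <= r /\ forall x, bump s a x * bump t b x = c * bump r z x.
Proof.
move=> s0 t0; have [st|st] := eqVneq (s + t) 0.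
  have [-> ->] : s = 0 /\ t = 0 by split; lra.
  by exists 1, 0, 0; split => // x; rewrite /bump !mul0r oppr0 expR0.
pose z := (s + t)^-1 *: (s *: a + t *: b).
exists (expR (- (s * t / (s + t) * `|a - b| ^+ 2))), (s + t), z.
split=> [|x]; first exact: addr_ge0.
rewrite /bump -!expRD; congr expR.
rewrite !(normB_sqr hip) /z (ipZr hip) (ipDr hip) !(ipZr hip) normrZ exprMn.
rewrite (normD_sqr hip) !normrZ !exprMn !real_normK ?num_real// (ipZl hip) (ipZr hip).
by field.
Qed.

Let bump_eq s a : 0 <= s -> \int[mu]_x bump s a x = \int[nu]_x bump s a x.
Proof.
move=> s0; have [e he] := exists_parseval_basis hip hsep.
(* With [r ^ 2 / 2 = s], the Gaussian limit of the sign averages is the bump of parameter [s]. *)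
pose r := Num.sqrt (2 * s).
have r2 : r ^+ 2 = 2 * s by rewrite sqr_sqrtr// mulr_ge0.
pose f k (x : H) := gavg e r k (fun z => cos (ip z (x - a) + 0)).
have fE k (P : law) :
   \int[P]_x f k x = gavg e r k (fun z => \int[P]_x cos (ip z x + - ip z a)) /\
   P.-integrable setT (EFin \o (f k : borel H -> R)).
  have [i1 i2] := @avg_Rintegral R H _ (borel H) P setT (gauss_steps e r k)
     (fun z x => cos (ip z x + - ip z a)) 0 measurableT (fun z => icos P z _).
  have ff : f k = fun x => avg (gauss_steps e r k) (fun z => cos (ip z x + - ip z a)) 0.
    by apply/funext => x; apply: eq_avg => z; rewrite (ipBr hip) addr0.
  by rewrite ff; split => //; rewrite -i2.
have cv (P : law) :
    \int[P]_x f k x @[k --> \oo] --> \int[P]_x bump s a x.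
  apply: (@bounded_cvg_Rintegral _ _ _ P setT measurableT (mT P) f (bump s a) 1).
  - by move=> k; have [_ /measurable_int /measurable_EFinP] := fE k P.
  - by move=> k x; exact: norm_gavg_cos.
  - move=> x; have := @gavg_cos_cvg R H ip hip e he r (x - a) 0.
    rewrite cos0 mul1r r2; have -> : 2 * s * `|x - a| ^+ 2 / 2 = s * `|x - a| ^+ 2 by field.
    exact.
have e1 : (fun k => \int[mu]_x f k x) = (fun k => \int[nu]_x f k x).
  by apply/funext => k; rewrite (fE k mu).1 (fE k nu).1; apply: eq_avg => z; exact: cos_eq.
have cvn := cv nu; rewrite -e1 in cvn.
exact: (cvg_unique _ (cv mu) cvn).
Qed.

(** Requiring agreement against every bump, the constant one ([s = 0]) included, is what makes this
    class stable under multiplication by bumps. *)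
Let E : set (H -> R) := [set f | measurable_fun [set: borel H] (f : borel H -> R) /\
  (exists K : R, forall x : H, `|f x| <= K) /\
  forall (s : R) (a : H), 0 <= s -> \int[mu]_x (f x * bump s a x) = \int[nu]_x (f x * bump s a x)].

Let E_bump (f : H -> R) (s : R) a : E f -> 0 <= s -> E (fun x => f x * bump s a x).
Proof.
move=> [mf [[K fK] fE]] s0; split; [|split].
- exact: (measurable_funM mf (measurable_bump s a)).
- exists K => x; rewrite normrM -[leRHS]mulr1 ler_pM//.
  by rewrite ger0_norm ?bump_ge0// bump_le1.
- move=> t b t0; have [c [r [z [r0 h]]]] := @bump_mul s a t b s0 t0.
  have intfb (P : law) : P.-integrable setT
      (EFin \o ((fun x : H => f x * bump r z x) : borel H -> R)).
    apply: (@bounded_integrable _ _ _ _ _ measurableT (mT P) _ K).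
      exact: (@measurable_funM _ (borel H) _ _ _ _ mf (measurable_bump r z)).
    move=> x; rewrite normrM -[leRHS]mulr1 ler_pM//.
    by rewrite ger0_norm ?bump_ge0// bump_le1.
  have hE (P : law) :
      \int[P]_x (f x * bump s a x * bump t b x) = c * \int[P]_x (f x * bump r z x).
    have ifb := intfb P; rewrite -RintegralZl//; apply: eq_Rintegral => x _.
    by rewrite -mulrA h; ring.
  by rewrite !hE fE.
Qed.

Let E_int (f : H -> R) (P : law) (s : R) a : E f -> 0 <= s ->
  P.-integrable setT (EFin \o ((fun x : H => f x * bump s a x) : borel H -> R)).
Proof.
move=> Ef s0; have [mf [[K fK] _]] := E_bump a Ef s0.
exact: (@bounded_integrable _ _ _ _ _ measurableT (mT P) _ K).
Qed.

Let E_lin f g (a b : R) : E f -> E g -> E (fun x => a * f x + b * g x).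
Proof.
move=> Ef Eg; have [mf [[K fK] fE]] := Ef; have [mg [[L gL] gE]] := Eg.
split; [|split].
- have mc (c : R) : measurable_fun [set: borel H] (fun=> c : R) by exact: measurable_cst.
  exact: (measurable_funD (measurable_funM (mc a) mf) (measurable_funM (mc b) mg)).
- exists (`|a| * K + `|b| * L) => x; rewrite (le_trans (ler_normD _ _))// !normrM.
  by rewrite lerD// ler_wpM2l.
- move=> s z s0.
  have hE (P : law) : \int[P]_x ((a * f x + b * g x) * bump s z x) =
      a * \int[P]_x (f x * bump s z x) + b * \int[P]_x (g x * bump s z x).
    have i1 := @E_int f P s z Ef s0; have i2 := @E_int g P s z Eg s0.
    rewrite -!RintegralZl// -RintegralD//.
    + by apply: eq_Rintegral => x _; ring.
    + exact: (integrableZl _ a i1).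
    + exact: (integrableZl _ b i2).
  by rewrite !hE fE// gE.
Qed.

Let E_cvg (f_ : nat -> H -> R) (f : H -> R) (K : R) : (forall n, E (f_ n)) ->
  (forall n x, `|f_ n x| <= K) -> (forall x, f_ n x @[n --> \oo] --> f x) -> E f.
Proof.
move=> Ef fK ff; split; [|split].
- have mf n : measurable_fun [set: borel H] (f_ n : borel H -> R) by have [] := Ef n.
  by apply: (@measurable_fun_cvg _ (borel H) R setT f_ f mf) => x _; exact: ff.
- exists K => x.
  have h : `|f_ n x| @[n --> \oo] --> `|f x| by exact: cvg_norm.
  rewrite -(cvg_lim _ h)//; apply: limr_le; first by apply/cvg_ex; eexists; exact: h.
  by apply: nearW => n; exact: fK.
- move=> s a s0.
  have cv (P : law) : \int[P]_x (f_ n x * bump s a x) @[n --> \oo] -->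
      \int[P]_x (f x * bump s a x).
    apply: (@bounded_cvg_Rintegral _ _ _ P setT measurableT (mT P) _ _ K).
    + by move=> n; have [mf _] := Ef n; exact: (measurable_funM mf (measurable_bump s a)).
    + move=> n x; rewrite normrM -[leRHS]mulr1 ler_pM//.
      by rewrite ger0_norm ?bump_ge0// bump_le1.
    + by move=> x; apply: cvgMl; exact: ff.
  have e1 : (fun n => \int[mu]_x (f_ n x * bump s a x)) = (fun n => \int[nu]_x (f_ n x * bump s a x)).
    by apply/funext => n; have [_ [_ ->]] := Ef n.
  have cvn := cv nu; rewrite -e1 in cvn.
  exact: (cvg_unique _ (cv mu) cvn).
Qed.

Let E_pow (f : H -> R) (s : R) a m : E f -> 0 <= s -> E (fun x => f x * (1 - bump s a x) ^+ m).
Proof.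
move=> Ef s0; elim: m => [|m ih].
  by under eq_fun do rewrite expr0 mulr1.
have := @E_lin _ _ 1 (-1) ih (@E_bump _ s a ih s0).
by congr E; apply/funext => x; rewrite exprSr; ring.
Qed.

Let E_ball (f : H -> R) a (r : R) : E f -> 0 <= r -> E (fun x => f x * \1_[set x : H | `|x - a| <= r] x).
Proof.
move=> Ef r0; have [mf [[K fK] _]] := Ef.
pose m k := (Num.truncn (k%:R * expR (k%:R * r ^+ 2))).+1.
apply: (@E_cvg (fun k x => f x * (1 - (1 - bump k%:R a x) ^+ (m k))) _ K).
- move=> k; have := @E_lin _ _ 1 (-1) Ef (@E_pow f k%:R a (m k) Ef (ler0n _ _)).
  by congr E; apply/funext => x; ring.
- move=> k x; rewrite normrM -[leRHS]mulr1 ler_pM//.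
  have b0 := bump_ge0 k%:R a x; have b1 := @bump_le1 k%:R a x (ler0n _ _).
  have : 0 <= (1 - bump k%:R a x) ^+ m k <= 1.
    by rewrite exprn_ge0 ?exprn_ile1//; lra.
  by rewrite ler_norml; lra.
- move=> x; apply: cvgMr; have := @bump_approx R (r ^+ 2) (`|x - a| ^+ 2) (sqr_ge0 _) (sqr_ge0 _).
  rewrite ler_sqr ?nnegrE// indicE.
  suff -> : (x \in [set x : H | `|x - a| <= r]) = (`|x - a| <= r) by case: ifP.
  by apply/idP/idP; rewrite inE.
Qed.

Lemma char_fun_inj (A : set (borel H)) : measurable A -> mu A = nu A.
Proof.
(* The sets whose indicator multiplies [E] into itself are closed under intersection by composition
   of multiplications, so they form a sigma-algebra directly, without a monotone class argument. *)
pose L : set (set H) := [set A | measurable (A : set (borel H)) /\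
  forall f, E f -> E (fun x => f x * \1_A x)].
have LC : forall A, L A -> L (~` A).
  move=> B [mB LB]; split; first exact: measurableC.
  move=> f Ef; have := @E_lin _ _ 1 (-1) Ef (LB f Ef).
  by congr E; apply/funext => x; rewrite !indicE in_setC; case: (x \in B) => /=; ring.
have LI : forall A B, L A -> L B -> L (A `&` B).
  move=> B C [mB LB] [mC LC']; split; first exact: measurableI.
  move=> f Ef; have := LC' _ (LB f Ef).
  by congr E; apply/funext => x; rewrite !indicE in_setI; case: (x \in B); case: (x \in C); rewrite /= ?mulr1 ?mulr0.
have LU : forall A B, L A -> L B -> L (A `|` B).
  by move=> B C LB LC'; rewrite -(setCK (B `|` C)) setCU; apply/LC/LI; exact: LC.
have L0 : L set0.
  split => // f [mf [fK fE]]; under eq_fun do rewrite indic0 mulr0.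
  have := @E_lin f f 0 0; under eq_fun do rewrite !mul0r addr0.
  by apply.
have Lbig : forall F : nat -> set H, (forall n, L (F n)) -> L (\bigcup_n F n).
  move=> F LF; split; first by apply: bigcupT_measurable => n; have [] := LF n.
  move=> f Ef; have [mf [[K fK] _]] := Ef.
  have LG n : L (\big[setU/set0]_(i < n) F i).
    by elim: n => [|n ih]; rewrite ?big_ord0// big_ord_recr; exact: LU.
  apply: (@E_cvg (fun n x => f x * \1_(\big[setU/set0]_(i < n) F i) x) _ K).
  - by move=> n; have [_] := LG n; apply.
  - move=> n x; rewrite normrM -[leRHS]mulr1 ler_pM// indicE.
    by case: (_ \in _); rewrite ?normr1 ?normr0.
  - move=> x; apply: cvgMr; apply: cvg_near_cst.
    have [[i _ Fi]|nF] := pselect ((\bigcup_n F n) x).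
      exists i.+1 => // n /= ni; rewrite !indicE !mem_set//; first by exists i.
      by rewrite -bigcup_mkord; exists i.
    apply: nearW => n; rewrite !indicE !memNset// -bigcup_mkord => -[j _ Fj].
    by apply: nF; exists j.
have Lball a r : 0 <= r -> L [set x : H | `|x - a| <= r].
  move=> r0; split; last by move=> f Ef; exact: E_ball.
  rewrite (_ : [set _ | _] = closed_ball_ Num.norm a r).
    by apply: closed_borel; exact: closed_closed_ball_.
  by apply/seteqP; split => x /=; rewrite distrC.
have Lopen (U : set H) : open U -> L U.
  move=> oU; have [s sd] := separable_seq hsep.
  pose B n k := [set z : H | `|z - s n| <= k.+1%:R^-1].
  pose C n k := if `[< B n k `<=` U >] then B n k else set0.
  have -> : U = \bigcup_n \bigcup_k C n k.
    rewrite predeqE => t; split => [Ut|[n _ [k _]]]; last first.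
      by rewrite /C; case: asboolP => // BU; exact: BU.
    have /nbhs_ballP[r /= r0 rU] : nbhs t U by exact: open_nbhs_nbhs.
    have r20 : 0 < r / 2 by rewrite divr_gt0.
    have [k _ /(_ k (leqnn k))/= kr] := near_infty_natSinv_lt (PosNum r20).
    have [n sn] := sd t k.+1%:R^-1 ltac:(by rewrite invr_gt0).
    exists n => //; exists k => //; rewrite /C asboolT; first exact: ltW.
    move=> z /= zn; apply: rU; rewrite -ball_normE /=.
    have -> : t - z = (t - s n) - (z - s n) by rewrite opprB addrA subrK.
    rewrite (le_lt_trans (ler_normB _ _))// (splitr r) ltrD//; first exact: lt_trans sn kr.
    exact: le_lt_trans zn kr.
  apply: (Lbig _) => n; apply: (Lbig _) => k; rewrite /C; case: asboolP => // _.
  by apply: Lball; rewrite invr_ge0.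
move=> mA.
have saL : sigma_algebra [set: H] L.
  by split => // B LB; rewrite setTD; exact: LC.
have LA : L A by exact: (smallest_sub saL Lopen mA).
have E1 : E (fun=> 1).
  split; [exact: measurable_cst|split; first by exists 1 => x; rewrite normr1].
  move=> s a s0; under eq_Rintegral do rewrite mul1r.
  by under [RHS]eq_Rintegral do rewrite mul1r; exact: bump_eq.
(* The constant function 1 is multiplied by the indicator of [A] and then tested against the bump
   with [s = 0], which is 1. *)
have [_ /(_ _ E1) [_ [_ /(_ 0 0 (lexx _))]]] := LA.
have hE (P : law) : \int[P]_x (1 * \1_A x * bump 0 0 x) = fine (P A).
  transitivity (\int[P]_x (\1_A x : R)); last by rewrite /Rintegral integral_indic// setIT.
  by apply: eq_Rintegral => x _; rewrite /bump mul0r oppr0 expR0 mulr1 mul1r.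
rewrite !hE => h; rewrite -[LHS]fineK ?fin_num_measure// h fineK// fin_num_measure//.
Qed.

End Uniqueness.

(** * A Levy measure integrates the truncated square *)

Section Necessity.
Context {R : realType} {H : completeNormedModType R} (ip : H -> H -> R).
Hypothesis hip : inner_product ip.
Hypothesis hsep : separable H.

(** Formally the mean of [1 - cos <Y, x>] for a Gaussian [Y] with covariance [s ^ 2] times the
    identity; for [s > 0] it dominates a multiple of the truncated square. *)
Definition bell (s : R) (x : H) : R := 1 - expR (- (s ^+ 2 * `|x| ^+ 2 / 2)).

Lemma bell_ge0 s x : 0 <= bell s x.
Proof. by rewrite subr_ge0 expR_le1 oppr_le0 divr_ge0// mulr_ge0// sqr_ge0. Qed.

Lemma bell_le1 s x : bell s x <= 1.
Proof. by rewrite gerBl expR_ge0. Qed.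

Lemma bellE s x : bell s x = 1 - bump (s ^+ 2 / 2) 0 x.
Proof. by rewrite /bell /bump subr0; congr (1 - expR (- _)); field. Qed.

Lemma measurable_bell s : measurable_fun [set: borel H] (bell s : borel H -> R).
Proof.
rewrite (_ : bell s = (fun x => 1 - bump (s ^+ 2 / 2) 0 x)).
  exact: (measurable_onem (measurable_bump _ _)).
by apply/funext => x; exact: bellE.
Qed.

Let U (y x : H) : R := 1 - cos (ip y x).

Let U_ge0 y x : 0 <= U y x. Proof. exact: one_sub_cos_ge0. Qed.

Let U_le2 y x : U y x <= 2. Proof. by rewrite /U; have := cos_geN1 (ip y x); lra. Qed.

Let mU y : measurable_fun [set: borel H] (U y : borel H -> R).
Proof.
have mc := @measurable_cos _ (borel H) R _ (measurable_ip hip y).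
exact: (measurable_onem mc).
Qed.

Variable e : nat -> H.
Hypothesis he : parseval_basis ip e.

Let gU s k x : gavg e s k (fun z => U z x) = 1 - gavg e s k (fun z => cos (ip z x + 0)).
Proof.
rewrite /gavg (@eq_avg _ _ _ _ (fun z => 1 * 1 + (-1) * cos (ip z x + 0))).
  by rewrite avg_lin avg_cst; ring.
by move=> z; rewrite /U addr0; ring.
Qed.

Let gU2 s k x : gavg e s k (fun z => U z x ^+ 2) =
  3 / 2 - 2 * gavg e s k (fun z => cos (ip z x + 0))
        + gavg e s k (fun z => cos (ip z (2 *: x) + 0)) / 2.
Proof.
rewrite /gavg (@eq_avg _ _ _ _ (fun z => 1 *
    ((3 / 2) * 1 + (-2) * cos (ip z x + 0)) + 2^-1 * cos (ip z (2 *: x) + 0))).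
  by rewrite avg_lin (avg_lin _ (fun=> 1)) avg_cst; field.
move=> z; rewrite /U !addr0 (ipZr hip) (mulr_natl (ip z x) 2) cos_mulr2n.
by field.
Qed.

Let gU_cvg s x : gavg e s k (fun z => U z x) @[k --> \oo] --> bell s x.
Proof.
under eq_fun do rewrite gU; apply: cvgB; first exact: cvg_cst.
by have := @gavg_cos_cvg R H ip hip e he s x 0; rewrite cos0 mul1r.
Qed.

(** The variance control behind the averaging argument: it makes the quotient of the mean of [U ^ 2]
    by [bell] at most three times [bell] in the limit. *)
Let gU2_cvg s x : exists2 l, gavg e s k (fun z => U z x ^+ 2) @[k --> \oo] --> l &
  l <= 3 * bell s x ^+ 2.
Proof.
set u := expR (- (s ^+ 2 * `|x| ^+ 2 / 2)).
have u01 : 0 <= u <= 1.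
  by rewrite expR_ge0 expR_le1 oppr_le0 divr_ge0// mulr_ge0// sqr_ge0.
exists (3 / 2 - 2 * u + u ^+ 4 / 2); last first.
  rewrite /bell -/u.
  (* The limit has a double zero at [u = 1], and the cofactor is at most 3 on [[0, 1]]. *)
  have -> : 3 / 2 - 2 * u + u ^+ 4 / 2 = (1 - u) ^+ 2 * ((u ^+ 2 + 2 * u + 3) / 2) by field.
  by rewrite mulrC ler_wpM2r ?sqr_ge0//; nra.
under eq_fun do rewrite gU2.
have c1 := @gavg_cos_cvg R H ip hip e he s x 0.
have c2 := @gavg_cos_cvg R H ip hip e he s (2 *: x) 0.
rewrite cos0 mul1r in c1; rewrite cos0 mul1r in c2.
apply: cvgD; first by apply: cvgB; [exact: cvg_cst|apply: cvgMr; exact: c1].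
apply: cvgMl; rewrite (_ : u ^+ 4 = expR (- (s ^+ 2 * `|2 *: x| ^+ 2 / 2))); first exact: c2.
rewrite /u -expRM_natl normrZ exprMn real_normK ?num_real//; congr expR.
by field.
Qed.

Variable mu : probability (borel H) R.
Variable N : {measure set (borel H) -> \bar R}.
Hypothesis hint : forall y,
  N.-integrable [set~ (0 : H)] (EFin \o (U y : borel H -> R)).
Hypothesis hchar : forall y,
  1 - \int[mu]_x U y x <= expR (- \int[N]_(x in [set~ (0 : H)]) U y x).

Let muT : (mu setT < +oo)%E.
Proof. by rewrite probability_setT ltry. Qed.

Let mC0 : measurable ([set~ (0 : H)] : set (borel H)).
Proof. by apply: measurableC; exact: measurable_set0_borel. Qed.

(** Dominated convergence as [s] tends to 0. The value [48 ^-1] is tuned to the absorption in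
    [bell_bound]. *)
Let small_s : exists2 s : R, 0 < s & \int[mu]_x bell s x <= 48^-1.
Proof.
have c0 : \int[mu]_x bell n.+1%:R^-1 x @[n --> \oo] --> \int[mu]_x (fun=> 0 : R) x.
  apply: (@bounded_cvg_Rintegral _ (borel H) _ mu setT measurableT muT _ _ 1).
  - by move=> n; exact: measurable_bell.
  - by move=> n x; rewrite ger0_norm ?bell_ge0// bell_le1.
  - move=> x; rewrite /bell.
    have inv0 : (n.+1%:R^-1 : R) @[n --> \oo] --> (0 : R) by exact: cvg_harmonic.
    have h : - ((n.+1%:R^-1 : R) ^+ 2 * `|x| ^+ 2 / 2) @[n --> \oo] --> (0 : R).
      rewrite -[X in _ --> X]oppr0; apply: cvgN.
      rewrite -[X in _ --> X](mul0r (2^-1 : R)); apply: cvgMl.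
      rewrite -[X in _ --> X](mul0r (`|x| ^+ 2)); apply: cvgMl.
      rewrite (_ : (fun n => _) = (fun n => n.+1%:R^-1 * n.+1%:R^-1)); last first.
        by apply/funext => n; rewrite expr2.
      by rewrite -[X in _ --> X](mul0r (0 : R)); exact: cvgM.
    rewrite -[X in _ --> X](subrr (1 : R)); apply: cvgB; first exact: cvg_cst.
    by rewrite -[X in _ --> X](@expR0 R); apply: continuous_cvg => //; exact: continuous_expR.
move: c0; rewrite Rintegral_cst// mul0r => /cvgr0Pnorm_le /(_ 48^-1).
rewrite invr_gt0 ltr0n => /(_ isT)[n _ /(_ n (leqnn n))] h.
by exists n.+1%:R^-1; rewrite ?invr_gt0// (le_trans (ler_norm _)).
Qed.

(** The hypothesis forces [exp (- P) >= 1 / 2], hence [1 + P <= exp P <= 2]. *)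
Let Psi_le1 y : \int[mu]_x U y x <= 2^-1 -> \int[N]_(x in [set~ (0 : H)]) U y x <= 1.
Proof.
move=> h; have := hchar y; set P := \int[N]_(x in _) _ => hP.
have h2 : 1 + P <= expR P by exact: expR_ge1Dx.
have : 2^-1 <= expR (- P) by apply: le_trans hP; lra.
rewrite expRN lef_pV2 ?posrE ?expR_gt0// => h3.
by have := le_trans h2 h3; lra.
Qed.

Section FiniteSet.
Variables (A : set H) (s : R).
Hypotheses (mA : measurable (A : set (borel H))) (NA : (N A < +oo)%E).
Hypothesis A0 : A `<=` [set~ 0].
Hypothesis hs : \int[mu]_x bell s x <= 48^-1.

(** Adding [eta] keeps the denominator [h] away from 0, so that [Q] is bounded, while the integral
    of [eta] over [A] stays at most 1 whatever the mass of [A]. *)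
Let eta : R := (fine (N A) + 1)^-1.
Let h x : R := bell s x + eta.

Let eta_gt0 : 0 < eta.
Proof. by rewrite invr_gt0 ltr_wpDl// fine_ge0. Qed.

Let h_gt0 x : 0 < h x.
Proof. by rewrite ltr_wpDl// bell_ge0. Qed.

Let iA (f : H -> R) (K : R) : measurable_fun [set: borel H] (f : borel H -> R) ->
  (forall x, `|f x| <= K) -> N.-integrable A (EFin \o (f : borel H -> R)).
Proof. by move=> mf fK; exact: (bounded_integrable mA NA mf fK). Qed.

Let iT (f : H -> R) (K : R) : measurable_fun [set: borel H] (f : borel H -> R) ->
  (forall x, `|f x| <= K) -> mu.-integrable setT (EFin \o (f : borel H -> R)).
Proof. by move=> mf fK; exact: (bounded_integrable measurableT muT mf fK). Qed.

Let U_norm y x : `|U y x| <= 2.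
Proof. by rewrite ger0_norm. Qed.

Let mh : measurable_fun [set: borel H] (h : borel H -> R).
Proof.
exact: (@measurable_funD _ (borel H) _ _ _ _ (measurable_bell s) (measurable_cst eta)).
Qed.

Let mhV : measurable_fun [set: borel H] ((fun x => (h x)^-1) : borel H -> R).
Proof.
rewrite (_ : (fun x => _) = (fun x => expR (- ln (h x)))); last first.
  by apply/funext => x; rewrite expRN lnK// posrE.
have ml : measurable_fun [set: borel H] ((fun x => ln (h x)) : borel H -> R).
  exact: (@measurableT_comp _ _ _ (borel H) R R (@ln R) _ h (@measurable_ln R) mh).
apply: (measurableT_comp (@measurable_expR R)).
exact: (@measurable_funN _ (borel H) _ _ _ ml).
Qed.

Let Q (y x : H) : R := U y x ^+ 2 * (h x)^-1.

Let Q_ge0 y x : 0 <= Q y x.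
Proof. by rewrite mulr_ge0 ?sqr_ge0// invr_ge0 ltW. Qed.

Let hV_le x : (h x)^-1 <= eta^-1.
Proof. by rewrite lef_pV2 ?posrE// lerDr bell_ge0. Qed.

Let Q_le y x : `|Q y x| <= 4 * eta^-1.
Proof.
rewrite ger0_norm// ler_pM ?sqr_ge0//; first by rewrite invr_ge0 ltW.
have -> : (4 : R) = 2 ^+ 2 by ring.
by rewrite ler_sqr ?nnegrE.
Qed.

Let mQ y : measurable_fun [set: borel H] (Q y : borel H -> R).
Proof.
have mU2 := @measurable_funX _ (borel H) _ _ _ 2%N (mU y).
exact: (@measurable_funM _ (borel H) _ _ _ _ mU2 mhV).
Qed.

Let h_norm x : `|h x| <= 1 + eta.
Proof. by rewrite ger0_norm ?(ltW (h_gt0 x))// lerD2r bell_le1. Qed.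

(* Cauchy-Schwarz in the form [U <= a U ^+ 2 / (2 h) + h / (2 a)] with [a = 6^-1], used only where
   the mean of [U y] under [mu] exceeds [2^-1]. *)
Let key y : \int[N]_(x in A) U y x <=
  1 + 12^-1 * \int[N]_(x in A) Q y x + (6 * \int[N]_(x in A) h x) * \int[mu]_x U y x.
Proof.
set Phi := \int[mu]_x U y x.
have Phi0 : 0 <= Phi by apply: Rintegral_ge0.
have hA0 : 0 <= \int[N]_(x in A) h x by apply: Rintegral_ge0 => x _; rewrite ltW.
have QA0 : 0 <= \int[N]_(x in A) Q y x by apply: Rintegral_ge0.
have [Phi2|Phi2] := leP Phi 2^-1.
  have : \int[N]_(x in A) U y x <= \int[N]_(x in [set~ (0 : H)]) U y x.
    apply: fine_le; [| |apply: ge0_subset_integral => //].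
    - by apply: integrable_fin_num => //; exact: (iA (mU y) (U_norm y)).
    - by apply: integrable_fin_num => //; exact: hint.
    - by apply/measurable_EFinP; apply: measurable_funTS; exact: mU.
    - by move=> x _; rewrite lee_fin.
  move=> /le_trans/(_ (Psi_le1 Phi2))/le_trans; apply.
  by rewrite -addrA lerDl addr_ge0// ?mulr_ge0 ?invr_ge0.
have i1 := iA (mU y) (U_norm y).
have i2 := iA (mQ y) (Q_le y).
have i3 := iA mh h_norm.
have -> : 6 * \int[N]_(x in A) h x * Phi = (6 * Phi) * \int[N]_(x in A) h x by ring.
rewrite -addrA; apply: (@le_trans _ _ (12^-1 * \int[N]_(x in A) Q y x + (6 * Phi) * \int[N]_(x in A) h x)); last first.
  by rewrite lerDr.
rewrite -(RintegralZl 12^-1 mA i2) -(RintegralZl (6 * Phi) mA i3).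
rewrite -(RintegralD mA (integrableZl mA 12^-1 i2) (integrableZl mA (6 * Phi) i3)).
apply: le_Rintegral => //.
  have := integrableD mA (integrableZl mA 12^-1 i2) (integrableZl mA (6 * Phi) i3).
  by apply: eq_integrable.
move=> x _; rewrite /Q; have hx := h_gt0 x; set c := U y x.
have : c <= 12^-1 * (c ^+ 2 / h x) + 3 * h x.
  rewrite -subr_ge0.
  have -> : 12^-1 * (c ^+ 2 / h x) + 3 * h x - c = (c - 6 * h x) ^+ 2 / (12 * h x).
    by field; rewrite gt_eqF.
  by rewrite divr_ge0 ?sqr_ge0// mulr_ge0// ltW.
by move=> /le_trans; apply; rewrite lerD2l ler_wpM2r ?(ltW hx)//; lra.
Qed.

(** [key] holds at every [y] and is affine in the three integrals that depend on [y]; it therefore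
    survives sign averages, which then move inside the integrals. *)
Let gavg_key k : \int[N]_(x in A) gavg e s k (fun z => U z x) <=
  1 + 12^-1 * \int[N]_(x in A) (gavg e s k (fun z => U z x ^+ 2) * (h x)^-1)
    + (6 * \int[N]_(x in A) h x) * \int[mu]_x gavg e s k (fun z => U z x).
Proof.
have [_ e1] := @avg_Rintegral R H _ (borel H) N A (gauss_steps e s k) U 0 mA
  (fun z => iA (mU z) (U_norm z)).
have [_ e2] := @avg_Rintegral R H _ (borel H) N A (gauss_steps e s k) Q 0 mA
  (fun z => iA (mQ z) (Q_le z)).
have [_ e3] := @avg_Rintegral R H _ (borel H) mu setT (gauss_steps e s k) U 0 measurableT
  (fun z => iT (mU z) (U_norm z)).
have := @avg_le R H (gauss_steps e s k) _ _ 0 key.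
rewrite e1 (@eq_avg _ _ _ _ (fun z => 1 * (1 * 1 + 12^-1 * \int[N]_(x in A) Q z x)
    + (6 * \int[N]_(x in A) h x) * \int[mu]_x U z x)); last by move=> z; rewrite !mul1r.
rewrite avg_lin (avg_lin _ (fun=> 1)) avg_cst e2 e3 !mul1r.
move=> /le_trans; apply; rewrite lerD2r lerD2l ler_wpM2l ?invr_ge0//.
rewrite le_eqVlt; apply/orP; left; apply/eqP; apply: eq_Rintegral => x _.
by rewrite /gavg mulrC -avg_scale; apply: eq_avg => z; rewrite /Q mulrC.
Qed.

(** Let [I] and [J] be the integrals of [bell s] and [h] over [A], so [J <= I + 1]. In the limit the
    second term of [gavg_key] is at most [3 J / 12] and the third at most [6 J / 48]. Hence
    [I <= 1 + 3 (I + 1) / 8], and [I], being finite, is at most [11 / 5], a bound independent of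
    [A]. *)
Lemma bell_bound : \int[N]_(x in A) bell s x <= 11 / 5.
Proof.
pose G x : R := lim (gavg e s k (fun z => U z x ^+ 2) @[k --> \oo]).
have GE x : gavg e s k (fun z => U z x ^+ 2) @[k --> \oo] --> G x /\ G x <= 3 * bell s x ^+ 2.
  by have [l cl hl] := gU2_cvg s x; rewrite /G (cvg_lim _ cl).
have gn k x : `|gavg e s k (fun z => U z x)| <= 2.
  rewrite ger0_norm.
    by rewrite -(avg_cst (gauss_steps e s k) 2 0); apply: avg_le.
  by rewrite -(avg_cst (gauss_steps e s k) 0 0); apply: avg_le.
have gn2 k x : `|gavg e s k (fun z => U z x ^+ 2) * (h x)^-1| <= 4 * eta^-1.
  have -> : gavg e s k (fun z => U z x ^+ 2) * (h x)^-1 = avg (gauss_steps e s k) (Q^~ x) 0.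
    by rewrite /gavg mulrC -avg_scale; apply: eq_avg => z; rewrite /Q mulrC.
  rewrite ger0_norm.
    rewrite -(avg_cst (gauss_steps e s k) (4 * eta^-1) 0); apply: avg_le => z.
    by rewrite (le_trans (ler_norm _)).
  by rewrite -(avg_cst (gauss_steps e s k) 0 0); apply: avg_le.
have mgU k : measurable_fun [set: borel H] ((fun x : H => gavg e s k (fun z => U z x)) : borel H -> R).
  have [/measurable_int/measurable_EFinP] := @avg_Rintegral R H _ (borel H) mu setT
     (gauss_steps e s k) U 0 measurableT (fun z => iT (mU z) (U_norm z)).
  by [].
have mgQ k : measurable_fun [set: borel H]
    ((fun x : H => gavg e s k (fun z => U z x ^+ 2) * (h x)^-1) : borel H -> R).
  have [/measurable_int/measurable_EFinP + _] := @avg_Rintegral R H _ (borel H) mu setT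
     (gauss_steps e s k) Q 0 measurableT (fun z => iT (mQ z) (Q_le z)).
  congr measurable_fun; apply/funext => x.
  by rewrite /gavg mulrC -avg_scale; apply: eq_avg => z; rewrite /Q mulrC.
have L1 : \int[N]_(x in A) gavg e s k (fun z => U z x) @[k --> \oo] --> \int[N]_(x in A) bell s x.
  by apply: (@bounded_cvg_Rintegral _ (borel H) _ N A mA NA _ _ 2) => // x; exact: gU_cvg.
have L2 : \int[N]_(x in A) (gavg e s k (fun z => U z x ^+ 2) * (h x)^-1) @[k --> \oo] -->
    \int[N]_(x in A) (G x * (h x)^-1).
  apply: (@bounded_cvg_Rintegral _ (borel H) _ N A mA NA _ _ (4 * eta^-1)) => // x.
  by apply: cvgMl; have [] := GE x.
have L3 : \int[mu]_x gavg e s k (fun z => U z x) @[k --> \oo] --> \int[mu]_x bell s x.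
  by apply: (@bounded_cvg_Rintegral _ (borel H) _ mu setT measurableT muT _ _ 2) => // x; exact: gU_cvg.
have h0 : 0 <= \int[N]_(x in A) h x by apply: Rintegral_ge0 => x _; rewrite ltW.
have L : \int[N]_(x in A) bell s x <= 1 + 12^-1 * \int[N]_(x in A) (G x * (h x)^-1) +
    (6 * \int[N]_(x in A) h x) * \int[mu]_x bell s x.
  apply: (ler_cvg_to L1 _ (nearW _ gavg_key)).
  apply: cvgD; last by apply: cvgMr.
  by apply: cvgD; [exact: cvg_cst|apply: cvgMr].
have G0 x : 0 <= G x.
  have [cG _] := GE x; rewrite -(cvg_lim _ cG)//.
  apply: limr_ge; first by apply/cvg_ex; eexists; exact: cG.
  by apply: nearW => k; rewrite -(avg_cst (gauss_steps e s k) 0 0); apply: avg_le => z; exact: sqr_ge0.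
have Gh x : G x * (h x)^-1 <= 3 * h x.
  rewrite ler_pdivrMr//; have [_ hG] := GE x; apply: (le_trans hG).
  rewrite -mulrA ler_wpM2l// expr2 ler_pM ?bell_ge0//; rewrite lerDl ltW//.
have i3 := iA mh h_norm.
have IG : \int[N]_(x in A) (G x * (h x)^-1) <= 3 * \int[N]_(x in A) h x.
  rewrite -RintegralZl//; apply: le_Rintegral => //.
    apply: (@iA _ (3 * (1 + eta))).
      apply: (@measurable_fun_cvg _ (borel H) R setT _ _ mgQ) => x _.
      by apply: cvgMl; have [] := GE x.
    move=> x; rewrite ger0_norm; last by rewrite mulr_ge0// invr_ge0 ltW.
    by rewrite (le_trans (Gh x))// ler_wpM2l// (le_trans (ler_norm _)).
  exact: (integrableZl mA 3 i3).
have Ih : \int[N]_(x in A) h x = \int[N]_(x in A) bell s x + eta * fine (N A).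
  rewrite RintegralD//; first by rewrite Rintegral_cst.
    apply: (iA (measurable_bell s) (K := 1)) => x.
    by rewrite ger0_norm ?bell_ge0// bell_le1.
  by apply: (@iA (fun=> eta) `|eta|) => //; exact: measurable_cst.
have eN : eta * fine (N A) <= 1.
  by rewrite /eta mulrC ler_pdivrMr ?mul1r ?lerDl// ltr_wpDl.
have hmu : (6 * \int[N]_(x in A) h x) * \int[mu]_x bell s x <= 6 * \int[N]_(x in A) h x * 48^-1.
  by rewrite ler_wpM2l// mulr_ge0.
lra.
Qed.

End FiniteSet.

(** [N] is not yet known to be sigma-finite, so sets of finite mass are built from the only
    integrable functions at hand, the [U y]: superlevel sets of finite sums of them have finite mass
    by Markov, and they exhaust the complement of the origin. *)
Lemma bell_integral_fin : exists2 s : R, 0 < s & (\int[N]_x (bell s x)%:E < +oo)%E.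
Proof.
have [s s0 hs] := small_s; exists s => //.
pose F (j : nat) (x : H) : R := \sum_(i < j) \sum_(k < j) U (k.+1%:R^-1 *: e i) x.
pose A j : set H := [set x | j.+1%:R^-1 <= F j x].
have mF j : measurable_fun [set: borel H] (F j : borel H -> R).
  by apply: measurable_sum => i; apply: measurable_sum => k; exact: mU.
have mA j : measurable (A j : set (borel H)).
  rewrite (_ : A j = F j @^-1` `[j.+1%:R^-1, +oo[%classic); last first.
    by apply/seteqP; split => x /=; rewrite in_itv/= andbT.
  by rewrite -[X in measurable X]setTI; exact: mF.
have F0 j x : 0 <= F j x by apply: sumr_ge0 => i _; apply: sumr_ge0.
have Fmono x i j : (i <= j)%N -> F i x <= F j x.
  move=> ij; rewrite /F -(subnKC ij) big_split_ord/=.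
  apply: (@le_trans _ _ (\sum_(i0 < i) \sum_(k < i + (j - i)) U (k.+1%:R^-1 *: e i0) x)); last first.
    by rewrite lerDl; apply: sumr_ge0 => l _; apply: sumr_ge0.
  apply: ler_sum => l _; rewrite big_split_ord/= lerDl.
  by apply: sumr_ge0.
have Amono : nondecreasing_seq A.
  move=> i j ij; apply/subsetPset => x /=; rewrite /A/= => h.
  rewrite (le_trans _ (le_trans h (Fmono x _ _ ij)))// lef_pV2 ?posrE//.
  by rewrite ler_nat.
have A0 j : A j `<=` [set~ 0].
  move=> x + x0; rewrite /A/= x0 /F big1 ?lt_geF ?invr_gt0// => i _.
  by rewrite big1// => k _; rewrite /U (ip0r hip) cos0 subrr.
have Aoo j : (N (A j) < +oo)%E.
  have iF : N.-integrable [set~ (0 : H)] (EFin \o (F j : borel H -> R)).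
    have -> : EFin \o (F j : borel H -> R) =
       (fun x : borel H => \sum_(i < j) (\sum_(k < j) (U (k.+1%:R^-1 *: e i) x)%:E)%E)%E.
      by apply/funext => x /=; rewrite -sumEFin; apply: eq_bigr => i _; rewrite sumEFin.
    by apply: integrable_sum => // i _; apply: integrable_sum => // k _; exact: hint.
  have := @le_integral_abse _ (borel H) R N [set~ 0] mC0 (EFin \o (F j : borel H -> R))
     j.+1%:R^-1 (measurable_int _ iF).
  rewrite invr_gt0 ltr0n => /(_ isT).
  have -> : [set~ (0 : H)] `&` [set x | (j.+1%:R^-1%:E <= `|(EFin \o F j) x|)%E] = A j.
    apply/seteqP; split => x /=.
      by move=> [_]; rewrite lee_fin ger0_norm// F0.
    by move=> Ax; split; [exact: (A0 j)|rewrite lee_fin ger0_norm// F0].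
  have /integrableP[_ ioo] := iF.
  move=> /le_lt_trans/(_ ioo); rewrite !ltey; apply: contra => /eqP ->.
  by rewrite gt0_muley// lte_fin invr_gt0.
have UA : \bigcup_j A j = [set~ 0].
  apply/seteqP; split => [x [j _]|x x0]; first exact: A0.
  have /existsNP[i ei] : ~ forall i, ip x (e i) = 0.
    move=> h; apply: x0; apply/eqP; rewrite -normr_eq0 -sqrf_eq0; apply/eqP.
    have [_ _ hp _] := he; have := hp x.
    rewrite (_ : (fun n => _) = (fun=> 0)); last first.
      by apply/funext => n; rewrite big1// => i _; rewrite h expr0n.
    by move=> h0; exact: (cvg_unique _ h0 (cvg_cst 0)).
  pose t := `|ip x (e i)|.
  have t0 : 0 < t by rewrite normr_gt0; exact/eqP.
  (* A nonzero coordinate scaled into []0, 1]] has cosine different from 1, whereas [t] itself might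
     be a multiple of [2 pi]. *)
  have [k tk] : exists k : nat, t / k.+1%:R <= 1.
    exists (Num.truncn t); rewrite ler_pdivrMr// mul1r.
    by rewrite ltW// truncnS_gt.
  have Uik : 0 < U (k.+1%:R^-1 *: e i) x.
    rewrite /U (ipZl hip) (ipC hip) -cos_norm normrM ger0_norm ?invr_ge0//.
    rewrite -/t mulrC subr_gt0.
    have tk0 : 0 < t / k.+1%:R by rewrite divr_gt0.
    have := pi_ge2 R => pi2; rewrite -[ltRHS]cos0 ltr_cos//.
      by rewrite in_itv/= lexx/=; lra.
    by rewrite in_itv/= (ltW tk0)/=; apply: (le_trans tk); lra.
  pose v := U (k.+1%:R^-1 *: e i) x.
  pose j := maxn (maxn i.+1 k.+1) (Num.truncn v^-1).
  exists j => //; rewrite /A /=; apply: (@le_trans _ _ v).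
    rewrite -[leRHS]invrK lef_pV2 ?posrE ?invr_gt0//.
    have := truncnS_gt v^-1 => /ltW/le_trans; apply.
    by rewrite ler_nat ltnS leq_maxr.
  have ij : (i < j)%N by rewrite /j !leq_max leqnn.
  have kj : (k < j)%N by rewrite /j !leq_max leqnn orbT.
  rewrite /F (bigD1 (Ordinal ij))//= (bigD1 (Ordinal kj))//= -addrA lerDl addr_ge0//.
    exact: sumr_ge0.
  by apply: sumr_ge0 => l _; exact: sumr_ge0.
have bA j : (\int[N]_(x in A j) (bell s x)%:E <= (11 / 5)%:E)%E.
  have := bell_bound (mA j) (Aoo j) (@A0 j) hs.
  rewrite -lee_fin /Rintegral fineK//; apply: integrable_fin_num => //.
  apply: (bounded_integrable (mA j) (Aoo j) (measurable_bell s) (K := 1)) => x.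
  by rewrite ger0_norm ?bell_ge0// bell_le1.
have mbE (D : set (borel H)) : measurable_fun D (EFin \o (bell s : borel H -> R)).
  by apply/measurable_EFinP; apply: measurable_funTS; exact: measurable_bell.
have cA := @ge0_nondecreasing_set_cvg_integral _ (borel H) R A (EFin \o (bell s : borel H -> R)) N
  Amono mA.
have {cA} : (\int[N]_(x in [set~ (0%R : H)]) (bell s x)%:E <= (11 / 5)%:E)%E.
  have cA' : (\int[N]_(x in A i) (bell s x)%:E)%E @[i --> \oo] -->
      (\int[N]_(x in [set~ (0%R : H)]) (bell s x)%:E)%E.
    rewrite -UA; apply: cA => //.
    by move=> n x _; rewrite lee_fin bell_ge0.
  rewrite -(cvg_lim _ cA')//; apply: lime_le; first by apply/cvg_ex; eexists; exact: cA'.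
  exact: nearW.
move=> h; apply: (@le_lt_trans _ _ (11 / 5)%:E); last exact: ltry.
apply: le_trans h; rewrite le_eqVlt; apply/orP; left; apply/eqP.
rewrite [RHS]integral_mkcond; apply: eq_integral => x _.
rewrite patchE; case: ifPn => // ; rewrite notin_setE /= => /contrapT ->.
by rewrite /bell normr0 expr0n/= mulr0 mul0r oppr0 expR0 subrr.
Qed.

End Necessity.

Section LevyNecessity.
Context {R : realType} {H : completeNormedModType R} (ip : H -> H -> R).
Local Notation law := (probability (borel H) R).
Hypothesis hip : inner_product ip.
Hypothesis hsep : separable H.

Definition sq_trunc (x : H) : R := Num.min 1 (`|x| ^+ 2).

Lemma sq_trunc_ge0 x : 0 <= sq_trunc x.
Proof. by rewrite le_min ler01 sqr_ge0. Qed.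

Lemma measurable_sq_trunc : measurable_fun [set: borel H] (sq_trunc : borel H -> R).
Proof.
have m2 := @measurable_funX _ (borel H) _ _ _ 2%N (@measurable_norm_borel R H).
have m1 : measurable_fun [set: borel H] (fun=> 1 : R) by exact: measurable_cst.
exact: (@measurable_minr _ (borel H) _ _ _ _ m1 m2).
Qed.

(** With [m] the truncated square and [q = s ^ 2 / 2], [bell s x >= 1 - exp (- q m) >= q m / (1 + q
    m)], and [q m <= q] bounds the denominator. *)
Lemma sq_trunc_le_bell (s : R) x : 0 < s ->
  sq_trunc x <= 2 * (1 + 2 / s ^+ 2) * bell s x.
Proof.
move=> s0; set q := s ^+ 2 / 2.
have q0 : 0 < q by rewrite divr_gt0// exprn_gt0.
have -> : 2 / s ^+ 2 = q^-1 by rewrite /q invf_div.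
pose m := sq_trunc x.
have m0 : 0 <= m by exact: sq_trunc_ge0.
have m1 : m <= 1 by rewrite /m /sq_trunc ge_min lexx.
have mx : m <= `|x| ^+ 2 by rewrite /m /sq_trunc ge_min lexx orbT.
have b1 : 1 - expR (- (q * m)) <= bell s x.
  rewrite /bell lerD2l lerN2 ler_expR lerN2.
  have -> : s ^+ 2 * `|x| ^+ 2 / 2 = q * `|x| ^+ 2 by rewrite /q; ring.
  by rewrite ler_wpM2l// ltW.
have qm : 0 <= q * m by rewrite mulr_ge0// ltW.
have b2 : q * m / (1 + q * m) <= 1 - expR (- (q * m)).
  have e1 := expR_ge1Dx (q * m).
  have : (expR (q * m))^-1 <= (1 + q * m)^-1.
    by rewrite lef_pV2 ?posrE ?expR_gt0// ltr_pwDl.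
  rewrite expRN => h.
  have -> : q * m / (1 + q * m) = 1 - (1 + q * m)^-1 by field; rewrite gt_eqF// ltr_pwDl.
  by rewrite lerD2l lerN2.
rewrite -/m; apply: (@le_trans _ _ (2 * (1 + q^-1) * (q * m / (1 + q * m)))); last first.
  rewrite ler_wpM2l//; last exact: le_trans b2 b1.
  by rewrite mulr_ge0// addr_ge0// invr_ge0 ltW.
have -> : 2 * (1 + q^-1) * (q * m / (1 + q * m)) = m * (2 * (q + 1) / (1 + q * m)).
  by field; rewrite !gt_eqF// ltr_pwDl.
rewrite ler_peMr// ler_pdivlMr ?mul1r; last by rewrite ltr_pwDl.
have : q * m <= q by rewrite ler_piMr// ltW.
by move: q0; lra.
Qed.

Lemma lk_kernel_Re (y x : H) : complex.Re (lk_kernel ip y x) = cos (ip y x) - 1.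
Proof. by rewrite /lk_kernel /cexp /= expR0 mul1r subr0. Qed.

Lemma lk_kernel_Im (y x : H) : complex.Im (lk_kernel ip y x) =
  sin (ip y x) - ip y x * \1_[set z : H | `|z| <= 1] x.
Proof. by rewrite /lk_kernel /cexp /= expR0 mul1r subr0. Qed.

Lemma measurable_norm_le (r : R) : measurable ([set x : H | `|x| <= r] : set (borel H)).
Proof.
by have := @measurable_norm_borel R H measurableT _ (measurable_itv `]-oo, r]);
  rewrite setTI; congr measurable; apply/seteqP; split => x /=; rewrite in_itv.
Qed.

Lemma measurable_lk_Re y :
  measurable_fun [set: borel H] (fun x : borel H => complex.Re (lk_kernel ip y x)).
Proof.
rewrite (_ : (fun x => _) = fun x : H => cos (ip y x) - 1); last first.
  by apply/funext => x; rewrite lk_kernel_Re.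
apply: measurable_funB; last exact: measurable_cst.
exact: (@measurable_cos _ (borel H) R _ (measurable_ip hip y)).
Qed.

Lemma measurable_lk_Im y :
  measurable_fun [set: borel H] (fun x : borel H => complex.Im (lk_kernel ip y x)).
Proof.
rewrite (_ : (fun x => _) = fun x : H => sin (ip y x) - ip y x * \1_[set z : H | `|z| <= 1] x).
  apply: measurable_funB; first exact: (@measurable_sin _ (borel H) R _ (measurable_ip hip y)).
  apply: (@measurable_funM _ (borel H) _ _ _ _ (measurable_ip hip y)).
  by apply: (@measurable_indic _ (borel H)); exact: measurable_norm_le.
by apply/funext => x; rewrite lk_kernel_Im.
Qed.

Lemma sq_trunc_integrable_levy (N : {measure set (borel H) -> \bar R})
    (mu : law) (a : H) (Q : {linear H -> H}) :
  gaussian_covariance ip Q -> levy_khintchine ip mu a Q N ->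
  (\int[N]_x (sq_trunc x)%:E < +oo)%E.
Proof.
move=> [_ _ [g hg]] hlk.
have [e he] := exists_parseval_basis hip hsep.
(* Positivity is not part of [gaussian_covariance]; it follows because the real part of a
   characteristic function is at most 1. *)
have Q0 y : 0 <= ip (Q y) y.
  have : complex.Re (char_fun ip g y) <= 1.
    rewrite char_funE /=.
    rewrite -[leRHS](Rintegral_probability_cst g).
    have gT : (g setT < +oo)%E by rewrite probability_setT ltry.
    have mc := @measurable_cos _ (borel H) R _ (measurable_ip hip y).
    apply: le_Rintegral => //.
    - by apply: (bounded_integrable measurableT gT mc (K := 1)) => x; exact: cos_max.
    - exact: bounded_integrable_cst.
  by rewrite hg /cexp /= cos0 mulr1 expR_le1 oppr_le0; lra.
pose U y x : R := 1 - cos (ip y x).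
have intU y : N.-integrable [set~ (0 : H)] (EFin \o (U y : borel H -> R)).
  have [[iR _] _] := hlk y; have := integrableN iR.
  congr (_.-integrable _ _); apply/funext => x /=.
  by rewrite expR0 mul1r subr0 opprB.
have mC0 : measurable ([set~ (0 : H)] : set (borel H)).
  by apply: measurableC; exact: measurable_set0_borel.
have muT : (mu setT < +oo)%E by rewrite probability_setT ltry.
(* In the real part of the Levy-Khintchine formula, the Gaussian factor and the cosine of the
   imaginary part can only decrease the value. *)
have hchar y : 1 - \int[mu]_x U y x <= expR (- \int[N]_(x in [set~ (0 : H)]) U y x).
  have [_] := hlk y; rewrite char_funE /cintegral /cexp /= => -[hRe _].
  have mc := @measurable_cos _ (borel H) R _ (measurable_ip hip y).
  have ic := bounded_integrable measurableT muT mc (fun x => cos_max _).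
  have i1 : mu.-integrable setT (EFin \o ((fun=> 1 : R) : borel H -> R)).
    exact: bounded_integrable_cst.
  have -> : 1 - \int[mu]_x U y x = \int[mu]_x cos (ip y x).
    rewrite /U (RintegralB measurableT i1 ic) Rintegral_probability_cst.
    by ring.
  rewrite hRe.
  have -> : \int[N]_(x in [set~ (0 : H)]) complex.Re (lk_kernel ip y x) =
     - \int[N]_(x in [set~ (0 : H)]) U y x.
    rewrite -[RHS]mulN1r -(RintegralZl (-1) mC0 (intU y)); apply: eq_Rintegral => x _.
    by rewrite lk_kernel_Re /U; ring.
  apply: (@le_trans _ _ (expR (0 - ip (Q y) y / 2 - \int[N]_(x in [set~ (0 : H)]) U y x))).
    by rewrite ler_piMr ?expR_ge0// cos_le1.
  by rewrite ler_expR; have := Q0 y; lra.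
have [s s0 hs] := @bell_integral_fin R H ip hip e he mu N intU hchar.
pose C : R := 2 * (1 + 2 / s ^+ 2).
have C0 : 0 <= C by rewrite mulr_ge0// addr_ge0// divr_ge0// sqr_ge0.
have mb := @measurable_bell R H s.
apply: (@le_lt_trans _ _ (\int[N]_x (C%:E * (bell s x)%:E))%E).
  apply: ge0_le_integral => //.
  - by move=> x _; rewrite lee_fin sq_trunc_ge0.
  - by apply/measurable_EFinP; exact: measurable_sq_trunc.
  - by apply: measurable_funeM; apply/measurable_EFinP.
  - by move=> x _; rewrite -EFinM lee_fin sq_trunc_le_bell.
rewrite ge0_integralZl_EFin//.
- by rewrite lte_mul_pinfty// lee_fin.
- by move=> x _; rewrite lee_fin bell_ge0.
- by apply/measurable_EFinP.
Qed.

End LevyNecessity.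

(** * Infinite products of probabilities *)

Section SequenceSpace.
Context d (T : measurableType d).

Definition coordinate_sets : set (set (nat -> T)) :=
  [set A | exists n (B : set T), measurable B /\ A = (fun w : nat -> T => w n) @^-1` B].

Local Notation seq_space := (g_sigma_algebraType coordinate_sets).

Lemma measurable_coord n : measurable_fun [set: seq_space] (fun w : seq_space => w n).
Proof.
move=> _ B mB; rewrite setTI; apply: sub_sigma_algebra.
by exists n, B.
Qed.

Lemma measurable_to_seq d' (S : measurableType d') (f : S -> seq_space) :
  (forall n, measurable_fun [set: S] (fun s => f s n)) -> measurable_fun [set: S] f.
Proof.
move=> mf; apply: (@measurability _ _ _ _ _ _ (coordinate_sets : set (set seq_space))) => //.
move=> _ [_ [n [B [mB ->]]] <-].
by have := mf n measurableT B mB.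
Qed.

Definition upd (w : nat -> T) (n : nat) (x : T) : nat -> T :=
  fun i => if i == n then x else w i.

Lemma measurable_upd n :
  measurable_fun [set: seq_space * T] (fun p : seq_space * T => upd p.1 n p.2 : seq_space).
Proof.
apply: measurable_to_seq => i; rewrite /upd; case: (i == n); first exact: measurable_snd.
exact: (measurableT_comp (measurable_coord i) measurable_fst).
Qed.

Lemma measurable_upd1 n (w : seq_space) :
  measurable_fun [set: T] (fun x : T => upd w n x : seq_space).
Proof.
by apply: measurable_to_seq => i; rewrite /upd; case: (i == n) => //; exact: measurable_cst.
Qed.

Definition agree n (w w' : nat -> T) := forall i, (i < n)%N -> w i = w' i.

Lemma agree_upd n w x : agree n (upd w n x) w.
Proof. by move=> i ni; rewrite /upd ltn_eqF. Qed.

Lemma agree_upd2 n w w' x : agree n w w' -> agree n.+1 (upd w n x) (upd w' n x).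
Proof.
move=> ww i; rewrite ltnS leq_eqVlt /upd => /predU1P[->|ni]; first by rewrite eqxx.
by rewrite ltn_eqF// ww.
Qed.

Lemma agreeW m n w w' : (m <= n)%N -> agree n w w' -> agree m w w'.
Proof. by move=> mn ww i im; apply: ww; exact: leq_trans mn. Qed.

Definition dep U n (f : (nat -> T) -> U) := forall w w', agree n w w' -> f w = f w'.

Lemma depW U m n (f : (nat -> T) -> U) : (m <= n)%N -> dep m f -> dep n f.
Proof. by move=> mn df w w' /(agreeW mn); exact: df. Qed.

(** Finite dependence plus measurability in the sequence space, so that no base set in a finite
    product has to be carried along. *)
Definition cylinder (A : set (nat -> T)) :=
  measurable (A : set seq_space) /\ exists n, dep n A.

Lemma cylinder0 : cylinder set0.
Proof. by split=> //; exists 0%N. Qed.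

Lemma cylinderU : setU_closed cylinder.
Proof.
move=> A B [mA [m dA]] [mB [n dB]]; split; first exact: measurableU.
exists (maxn m n) => w w' ww; rewrite /setU/=.
by rewrite (dA _ _ (agreeW (leq_maxl _ _) ww)) (dB _ _ (agreeW (leq_maxr _ _) ww)).
Qed.

Lemma cylinderC : setC_closed cylinder.
Proof.
move=> A [mA [m dA]]; split; first exact: measurableC.
by exists m => w w' /dA; rewrite /setC/= => ->.
Qed.

(** A separate name for the sequence space, carrying only the algebra of cylinders, on which the
    content is defined before extension. *)
Definition cylinder_space := nat -> T.
HB.instance Definition _ := Pointed.on cylinder_space.
HB.instance Definition _ := @isAlgebraOfSets.Build d cylinder_space cylinder
  cylinder0 cylinderU cylinderC.

End SequenceSpace.

Section BuildMeasures.
Context d (T : measurableType d) (R : realType).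

Definition measure_of (m : set T -> \bar R) (m0 : m set0 = 0%E)
    (mge0 : forall A, (0 <= m A)%E) (msa : semi_sigma_additive m) :
    {measure set T -> \bar R} :=
  HB.pack m (isMeasure.Build _ T R m m0 mge0 msa).

(* The proof is an argument only so that the probability instance can be attached to this name. *)
Definition normalized (m : {measure set T -> \bar R}) (_ : m [set: T] = 1%E) :
  set T -> \bar R := m.

Section Normalized.
Variables (m : {measure set T -> \bar R}) (m1 : m [set: T] = 1%E).
HB.instance Definition _ := Measure.copy (normalized m1) m.
HB.instance Definition _ := Measure_isProbability.Build _ T R (normalized m1) m1.
Definition probability_of : probability T R := normalized m1.
End Normalized.

End BuildMeasures.

Section ImageMeasure.
Context d (T : measurableType d) (R : realType).
Context d2 (T' : measurableType d2) (f : T -> T') (mf : measurable_fun [set: T] f).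

Section Push.
Variable m : {measure set T -> \bar R}.

Let push0 : m (f @^-1` set0) = 0%E.
Proof. by rewrite preimage_set0 measure0. Qed.

Let push_ge0 A : (0 <= m (f @^-1` A))%E.
Proof. exact: measure_ge0. Qed.

Let push_sigma_additive : semi_sigma_additive (fun A => m (f @^-1` A)).
Proof.
move=> F mF tF mUF; rewrite preimage_bigcup.
apply: measure_semi_sigma_additive.
- by move=> n; rewrite -[X in measurable X]setTI; exact: mf.
- apply/trivIsetP => /= i j _ _ ij; rewrite -preimage_setI.
  by move/trivIsetP : tF => /(_ _ _ _ _ ij) ->//; rewrite preimage_set0.
- by rewrite -preimage_bigcup -[X in measurable X]setTI; exact: mf.
Qed.

Definition push : {measure set T' -> \bar R} :=
  @measure_of _ T' R (fun A => m (f @^-1` A)) push0 push_ge0 push_sigma_additive.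

End Push.

Lemma pushE m A : push m A = m (f @^-1` A).
Proof. by []. Qed.

Let push1 (P : probability T R) : push P [set: T'] = 1%E.
Proof. by rewrite pushE preimage_setT; exact: probability_setT. Qed.

Definition ppush (P : probability T R) : probability T' R := probability_of (push1 P).

Lemma ppushE P A : ppush P A = P (f @^-1` A).
Proof. by []. Qed.

End ImageMeasure.

(** * The product content on cylinders and its extension *)

Section IteratedIntegral.
Context d (T : measurableType d) (R : realType) (rho : nat -> probability T R).
Local Notation W := (g_sigma_algebraType (@coordinate_sets _ T)).
Local Open Scope ereal_scope.
Implicit Types f g : W -> \bar R.

(** Overwriting one coordinate keeps every partial integral a function on the whole sequence space,
    which avoids finite product spaces. *)
Definition integrate n f (w : W) : \bar R := \int[rho n]_x f (upd w n x).

Lemma integrate_ge0 n f : (forall w, 0 <= f w) -> forall w, 0 <= integrate n f w.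
Proof. by move=> f0 w; exact: integral_ge0. Qed.

Lemma measurable_integrate n f : (forall w, 0 <= f w) ->
  measurable_fun [set: W] f -> measurable_fun [set: W] (integrate n f).
Proof.
move=> f0 mf.
apply: (@measurable_fun_fubini_tonelli_F _ _ W T R (rho n) (fun p => f (upd p.1 n p.2))) => //.
exact: (measurableT_comp mf (measurable_upd n)).
Qed.

Lemma measurable_slice n f w : measurable_fun [set: W] f ->
  measurable_fun [set: T] (fun x => f (upd w n x)).
Proof. by move=> mf; exact: (measurableT_comp mf (measurable_upd1 n w)). Qed.

Lemma le_integrate n f g : (forall w, 0 <= f w) -> measurable_fun [set: W] f ->
  measurable_fun [set: W] g -> (forall w, f w <= g w) ->
  forall w, integrate n f w <= integrate n g w.
Proof.
by move=> f0 mf mg fg w; apply: ge0_le_integral => //; exact: measurable_slice.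
Qed.

Lemma integrate_dep n m f : (m <= n)%N -> dep m f -> integrate n f = f.
Proof.
move=> mn df; apply/funext => w; rewrite /integrate.
under eq_integral do rewrite (df _ _ (agreeW mn (@agree_upd _ T n w _))).
rewrite integral_cst// -[RHS]mule1; congr (_ * _).
exact: probability_setT.
Qed.

(* The mean of [f] over the coordinates [k, ..., k + m - 1], the others being frozen. *)
Fixpoint iterate k m f : W -> \bar R :=
  if m is m'.+1 then integrate k (iterate k.+1 m' f) else f.

Lemma iterate_ge0 k m f : (forall w, 0 <= f w) -> forall w, 0 <= iterate k m f w.
Proof. by move=> f0; elim: m k => // m ih k; exact: integrate_ge0. Qed.

Lemma measurable_iterate k m f : (forall w, 0 <= f w) ->
  measurable_fun [set: W] f -> measurable_fun [set: W] (iterate k m f).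
Proof.
move=> f0 mf; elim: m k => // m ih k.
by apply: measurable_integrate => //; exact: iterate_ge0.
Qed.

Lemma le_iterate k m f g : (forall w, 0 <= f w) -> measurable_fun [set: W] f ->
  measurable_fun [set: W] g -> (forall w, f w <= g w) ->
  forall w, iterate k m f w <= iterate k m g w.
Proof.
move=> f0 mf mg fg; have g0 w : 0 <= g w by exact: le_trans (f0 w) (fg w).
elim: m k => // m ih k; apply: le_integrate => //;
  by [exact: iterate_ge0|exact: measurable_iterate].
Qed.

Lemma iterateD k m f g : (forall w, 0 <= f w) -> (forall w, 0 <= g w) ->
  measurable_fun [set: W] f -> measurable_fun [set: W] g ->
  iterate k m (fun w => f w + g w) = (fun w => iterate k m f w + iterate k m g w).
Proof.
move=> f0 g0 mf mg; elim: m k => // m ih k /=; rewrite ih.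
apply/funext => w; rewrite /integrate ge0_integralD//.
- by move=> x _; exact: iterate_ge0.
- by apply: measurable_slice; exact: measurable_iterate.
- by move=> x _; exact: iterate_ge0.
- by apply: measurable_slice; exact: measurable_iterate.
Qed.

Lemma iterateZ k m f (c : R) : (0 <= c)%R -> (forall w, 0 <= f w) ->
  measurable_fun [set: W] f ->
  iterate k m (fun w => c%:E * f w) = (fun w => c%:E * iterate k m f w).
Proof.
move=> c0 f0 mf; elim: m k => // m ih k /=; rewrite ih.
apply/funext => w; rewrite /integrate ge0_integralZl_EFin//.
- by move=> x _; exact: iterate_ge0.
- by apply: measurable_slice; exact: measurable_iterate.
Qed.

Lemma iterate_dep k m n f : (n <= k)%N -> dep n f -> iterate k m f = f.
Proof.
move=> nk df; elim: m k nk => // m ih k nk /=.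
by rewrite ih ?(leq_trans nk)// (integrate_dep nk).
Qed.

Lemma iterate_add k m m' f : iterate k (m + m') f = iterate k m (iterate (k + m) m' f).
Proof.
elim: m k => [|m ih] k /=; first by rewrite add0n addn0.
by rewrite ih addSnnS.
Qed.

Lemma iterate_eq k m m' n f : dep n f -> (n <= k + m)%N -> (n <= k + m')%N ->
  iterate k m f = iterate k m' f.
Proof.
move=> df; wlog mm : m m' / (m <= m')%N.
  move=> h h1 h2; have [/h|/ltnW/h] := leqP m m'; first exact.
  by move=> e; apply/esym; exact: e.
move=> nm _; rewrite -(subnKC mm) iterate_add.
by rewrite (iterate_dep _ nm).
Qed.

Definition ind (A : set W) (w : W) : \bar R := (\1_A w)%:E.

Lemma ind_ge0 A w : 0 <= ind A w.
Proof. by rewrite lee_fin. Qed.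

Lemma measurable_ind (A : set W) : measurable A -> measurable_fun [set: W] (ind A).
Proof. by move=> mA; apply/measurable_EFinP; exact: measurable_indic. Qed.

Lemma dep_ind n (A : set W) : dep n A -> dep n (ind A).
Proof.
move=> dA w w' /dA e; rewrite /ind !indicE.
by have -> : (w \in A) = (w' \in A) by apply/idP/idP; rewrite !inE e.
Qed.

Lemma ind_le1 A w : ind A w <= 1.
Proof. by rewrite lee_fin indicE lern1; case: (_ \in _). Qed.

Lemma iterate_cst k m (c : \bar R) : iterate k m (fun=> c) = (fun=> c).
Proof. by apply: (@iterate_dep k m 0%N). Qed.

Lemma iterate_ind_le1 k m A w : measurable A -> iterate k m (ind A) w <= 1.
Proof.
move=> mA; have := @le_iterate k m (ind A) (fun=> 1) (@ind_ge0 A) (measurable_ind mA).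
rewrite iterate_cst; apply; [exact: measurable_cst|exact: ind_le1].
Qed.

Let w0 : W := fun=> point.

(** A bound on the number of relevant coordinates is chosen; [cyl_contentE] shows that any other
    bound gives the same value. The default 0 concerns sets without such a bound. *)
Definition cyl_content (A : set (cylinder_space T)) : \bar R :=
  if pselect (exists n, dep n A) is left h
  then iterate 0 (projT1 (cid h)) (ind A) w0 else 0.

Lemma cyl_contentE n (A : set W) : dep n A -> cyl_content A = iterate 0 n (ind A) w0.
Proof.
move=> dA; rewrite /cyl_content; case: pselect => [h|[]]; last by exists n.
case: cid => m dm /=; rewrite (@iterate_eq 0 m (maxn m n) m _ (dep_ind dm))//.
- by rewrite (@iterate_eq 0 n (maxn m n) n _ (dep_ind dA))// leq_maxr.
- by rewrite leq_maxl.
Qed.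

Lemma cyl_content_ge0 A : 0 <= cyl_content A.
Proof.
rewrite /cyl_content; case: pselect => // h.
by apply: iterate_ge0; exact: ind_ge0.
Qed.

Lemma cyl_content0 : cyl_content set0 = 0.
Proof.
rewrite (@cyl_contentE 0%N)//=.
by rewrite /ind indic0.
Qed.

Lemma cyl_contentT : cyl_content [set: W] = 1.
Proof.
rewrite (@cyl_contentE 0%N)//=.
by rewrite /ind indicT.
Qed.

Lemma cyl_content_le1 A : cylinder A -> cyl_content A <= 1.
Proof. by move=> [mA [n dA]]; rewrite (cyl_contentE dA) iterate_ind_le1. Qed.

Lemma cyl_content_fin A : cylinder A -> cyl_content A \is a fin_num.
Proof.
move=> cA; rewrite ge0_fin_numE ?cyl_content_ge0//.
by rewrite (le_lt_trans (cyl_content_le1 cA))// ltry.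
Qed.

Lemma cyl_contentU A B : cylinder A -> cylinder B -> A `&` B = set0 ->
  cyl_content (A `|` B) = cyl_content A + cyl_content B.
Proof.
move=> [mA [m dA]] [mB [n dB]] AB; pose k := maxn m n.
have dA' : dep k A by apply: depW dA; exact: leq_maxl.
have dB' : dep k B by apply: depW dB; exact: leq_maxr.
have dU : dep k (A `|` B).
  by move=> w w' ww; rewrite /setU/= (dA' _ _ ww) (dB' _ _ ww).
rewrite (cyl_contentE dA') (cyl_contentE dB') (cyl_contentE dU).
have -> : ind (A `|` B) = (fun w => ind A w + ind B w).
  apply/funext => w; rewrite /ind -EFinD !indicE in_setU.
  have : ~ (w \in A /\ w \in B).
    by rewrite !inE => -[wA wB]; have : (A `&` B) w by []; rewrite AB.
  case: (w \in A); case: (w \in B); rewrite ?add0r ?addr0//.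
  by move=> h; exfalso; apply: h.
by rewrite iterateD//; [exact: ind_ge0|exact: ind_ge0|exact: measurable_ind|exact: measurable_ind].
Qed.

(* Kakutani's argument: if the content does not tend to [0], one can choose the coordinates one by
   one so that no conditional content tends to [0], and the sequence obtained lies in every [A j].
   *)
Lemma cyl_content_cvg0 (A : nat -> set W) : (forall j, cylinder (A j)) ->
  (forall i j, (i <= j)%N -> A j `<=` A i) -> \bigcap_j A j = set0 ->
  cyl_content (A j) @[j --> \oo] --> 0.
Proof.
move=> cA dA A0; apply: contrapT => nP.
have mA j : measurable (A j : set W) by have [] := cA j.
pose n j := projT1 (cid (cA j).2).
have dn j : dep (n j) (A j) by rewrite /n; case: cid.
pose h k j := iterate k (n j) (ind (A j)).
have hE k m j : (n j <= k + m)%N -> h k j = iterate k m (ind (A j)).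
  by move=> nm; apply: (iterate_eq (dep_ind (dn j))) => //; exact: leq_addl.
have hS k j : h k j = integrate k (h k.+1 j).
  by rewrite (@hE k (n j).+1)// addnS ltnW// ltnS leq_addl.
have h_mono k i j w : (i <= j)%N -> h k j w <= h k i w.
  move=> ij; pose m := maxn (n i) (n j).
  rewrite (@hE k m i) ?(@hE k m j); last 2 first.
  - by rewrite (leq_trans _ (leq_addl _ _))// leq_maxr.
  - by rewrite (leq_trans _ (leq_addl _ _))// leq_maxl.
  apply: le_iterate; [exact: ind_ge0|exact: measurable_ind|exact: measurable_ind|].
  move=> v; rewrite lee_fin !indicE ler_nat.
  case: (boolP (v \in A j)) => //; rewrite inE => /(dA _ _ ij) Aiv.
  by rewrite mem_set.
have h0 k j w : 0 <= h k j w by apply: iterate_ge0; exact: ind_ge0.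
have h1 k j w : h k j w <= 1 by exact: iterate_ind_le1.
have step k w : ~ (h k j w @[j --> \oo] --> 0) ->
    exists x, ~ (h k.+1 j (upd w k x) @[j --> \oo] --> 0).
  move=> nh; apply: contrapT => /forallNP hx; apply: nh.
  have {}hx x : h k.+1 j (upd w k x) @[j --> \oo] --> 0 by exact: contrapT (hx x).
  rewrite [X in X @ _](_ : _ = (fun j => \int[rho k]_x h k.+1 j (upd w k x))); last first.
    by apply/funext => j; rewrite hS.
  rewrite -[X in _ --> X](integral0 (rho k) setT).
  apply: (@dominated_cvg _ _ _ (rho k) setT measurableT _ _ (cst 1)) => //.
  - move=> j; apply: measurable_slice; apply: measurable_iterate; first exact: ind_ge0.
    exact: measurable_ind.
  - exact: (finite_measure_integrable_cst (rho k) 1%R).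
  - by move=> j x _; rewrite gee0_abs.
have start : ~ (h 0%N j w0 @[j --> \oo] --> 0).
  apply: contra_not nP => hh.
  rewrite (_ : (fun j => cyl_content (A j)) = (fun j => h 0%N j w0))//.
  by apply/funext => j; rewrite (cyl_contentE (dn j)).
pose good k w := ~ (h k j w @[j --> \oo] --> 0).
have choice k w : exists x, good k w -> good k.+1 (upd w k x).
  have [gk|ngk] := pselect (good k w); last by exists point.
  by have [x hx] := step k w gk; exists x.
pose x_ k w := projT1 (cid (choice k w)).
have x_P k w : good k w -> good k.+1 (upd w k (x_ k w)) by rewrite /x_; case: cid.
pose fix v k := if k is k'.+1 then upd (v k') k' (x_ k' (v k')) else w0.
have vgood k : good k (v k).
  by elim: k => [|k ih]; [exact: start|exact: x_P].
have vagree (k m : nat) : agree k (v (k + m)%N) (v k).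
  elim: m => [|m ih] i ik; first by rewrite addn0.
  rewrite addnS /= /upd ltn_eqF; first exact: ih.
  by rewrite (leq_trans ik)// leq_addr.
pose w i := v i.+1 i.
have wv k : agree k w (v k).
  move=> i ik; rewrite /w -(@vagree i.+1 (k - i.+1)%N i (leqnn _)).
  by rewrite subnKC.
suff : (\bigcap_j A j) w by rewrite A0.
move=> j _; apply: contrapT => nAj; apply: (vgood (n j)).
have hj : h (n j) j (v (n j)) = 0.
  rewrite /h (iterate_dep _ (leqnn _) (dep_ind (dn j))).
  rewrite -(dep_ind (dn j) (wv (n j))) /ind indicE memNset//.
apply: cvg_near_cst; exists j => // i /= ji.
by apply/eqP; rewrite eq_le h0 andbT -hj h_mono.
Qed.

(** The content is finite and additive, so continuity at the empty set suffices: the remainders [U]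
    minus [G n] decrease to the empty set. *)
Lemma cyl_content_sigma_additive :
  semi_sigma_additive (cyl_content : set (cylinder_space T) -> \bar R).
Proof.
move=> F mF tF mUF.
pose G n := \big[setU/set0]_(i < n) F i.
pose U := \bigcup_n F n.
have cG n : cylinder (G n).
  elim: n => [|n ih]; rewrite /G ?big_ord0 ?big_ord_recr/=; first exact: cylinder0.
  by apply: cylinderU; [exact: ih|exact: mF].
have cD n : cylinder (U `\` G n).
  by apply: (@measurableD _ (cylinder_space T)) => //; exact: cG.
have GE n : \sum_(0 <= i < n) cyl_content (F i) = cyl_content (G n).
  elim: n => [|n ih]; first by rewrite big_geq// /G big_ord0 cyl_content0.
  rewrite big_nat_recr//= ih /G big_ord_recr/= cyl_contentU//; [exact: (cG n)|exact: mF|].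
  apply/seteqP; split => // x; rewrite -bigcup_mkord => -[[i /= ni Fi] Fn].
  have e : i = n by apply: tF => //; exists x.
  by rewrite e ltnn in ni.
have UE n : cyl_content U = cyl_content (G n) + cyl_content (U `\` G n).
  rewrite -cyl_contentU ?setDIK//.
  rewrite setUDr setDv setD0.
  congr cyl_content; apply/esym/setUidPr.
  by rewrite /G -bigcup_mkord; apply: bigcup_sub => i _; exact: bigcup_sup.
under eq_fun do rewrite GE.
have D0 : cyl_content (U `\` G n) @[n --> \oo] --> 0.
  apply: cyl_content_cvg0 => //.
    move=> i j ij; apply: setDS; rewrite /G -!bigcup_mkord.
    by apply: bigcup_sub => k /= ki; apply: bigcup_sup => /=; exact: leq_trans ij.
  apply/seteqP; split => // x hx.
  have [[i _ Fi] _] := hx 0%N I.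
  have [_ []] := hx i.+1 I.
  by rewrite /G -bigcup_mkord; exists i => /=.
have -> : (fun n => cyl_content (G n)) = (fun n => cyl_content U - cyl_content (U `\` G n)).
  apply/funext => n; rewrite (UE n) addeK//.
  exact: cyl_content_fin.
suff : cyl_content U - cyl_content (U `\` G n) @[n --> \oo] --> cyl_content U - 0.
  by rewrite sube0.
apply: cvgeB => //; last exact: cvg_cst.
by rewrite fin_num_adde_defl.
Qed.

HB.instance Definition _ := isMeasure.Build _ (cylinder_space T) R cyl_content
  cyl_content0 cyl_content_ge0 cyl_content_sigma_additive.

(** Independence is recorded one step at a time, coordinate [n] against the preceding ones; this is
    the form used by induction on partial sums. *)
Lemma infinite_product : exists P : probability W R,
  forall n (B : set W) (C : set T), measurable B -> dep n B -> measurable C ->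
    P (B `&` [set w | C (w n)]) = P B * rho n C.
Proof.
pose V := g_sigma_algebraType (@measurable _ (cylinder_space T)).
pose ext : {measure set V -> \bar R} := measure_extension cyl_content.
have extE A : cylinder A -> ext A = cyl_content A.
  by move=> cA; exact: (@measurable_mu_extE _ R (cylinder_space T) cyl_content A cA).
(* The extension lives on the sigma-algebra generated by cylinders; the identity carries it over to
   the one generated by coordinates. *)
have mid : measurable_fun [set: V] (fun w : V => w : W).
  apply: (@measurability _ _ _ _ _ _ (@coordinate_sets _ T : set (set W))) => //.
  move=> _ [_ [n [B [mB ->]]] <-]; rewrite setTI; apply: sub_sigma_algebra.
  split; first by apply: sub_sigma_algebra; exists n, B.
  by exists n.+1 => w w' ww; rewrite /preimage/= ww.
have P1 : push mid ext [set: W] = 1.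
  by rewrite pushE preimage_setT extE; [exact: cyl_contentT|exact: (@measurableT _ (cylinder_space T))].
exists (probability_of P1) => n B C mB dB mC.
have mCn : measurable ([set w | C (w n)] : set W).
  by have := measurable_coord n measurableT mC; rewrite setTI.
have dC : dep n.+1 [set w : W | C (w n)] by move=> w w' ww /=; rewrite ww.
have dBC : dep n.+1 (B `&` [set w : W | C (w n)]).
  move=> w w' ww; have e : C (w n) = C (w' n) := dC _ _ ww.
  by rewrite /setI/= e (dB _ _ (agreeW (leqnSn n) ww)).
have cB : cylinder B by split => //; exists n.
have cBC : cylinder (B `&` [set w : W | C (w n)]).
  by split; [exact: measurableI|exists n.+1].
transitivity (ext (B `&` [set w : W | C (w n)])) => //.
rewrite (extE _ cBC); transitivity (ext B * rho n C) => //.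
rewrite (extE _ cB) (cyl_contentE dBC) (cyl_contentE dB).
(* Coordinate [n] is integrated innermost; it affects only the indicator of [C] and produces the
   constant factor [rho n C]. *)
rewrite -addn1 iterate_add add0n /=.
have -> : integrate n (ind (B `&` [set w : W | C (w n)])) =
    (fun w => (fine (rho n C))%:E * ind B w).
  apply/funext => w; rewrite /integrate.
  have e x : ind (B `&` [set w : W | C (w n)]) (upd w n x) = (\1_B w)%:E * (\1_C x)%:E.
    rewrite /ind -EFinM !indicE in_setI; congr (_%:E).
    have -> : (upd w n x \in B) = (w \in B).
      by apply/idP/idP; rewrite !inE (dB _ _ (@agree_upd _ T n w x)).
    have -> : (upd w n x \in [set w1 : W | C (w1 n)]) = (x \in C).
      by apply/idP/idP; rewrite !inE /= /upd eqxx.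
    by case: (w \in B); case: (x \in C); rewrite /= ?mulr1 ?mulr0.
  under eq_integral do rewrite e.
  rewrite ge0_integralZl_EFin//.
  - by rewrite integral_indic// setIT fineK ?fin_num_measure// muleC.
  - by apply/measurable_EFinP; exact: measurable_indic.
rewrite iterateZ//; [|exact: fine_ge0|exact: ind_ge0|exact: measurable_ind].
by rewrite fineK ?fin_num_measure// muleC.
Qed.

End IteratedIntegral.

(** * Convolution and compound Poisson laws *)

Section IntegralTransfer.
Context d (T : measurableType d) (R : realType).

Lemma Rintegral_scaled (m1 m2 : {measure set T -> \bar R}) (D1 D2 : set T) (c : R) (f : T -> R) :
  (forall g : T -> \bar R, (forall x, 0 <= g x)%E -> measurable_fun [set: T] g ->
    \int[m1]_(x in D1) g x = c%:E * \int[m2]_(x in D2) g x)%E ->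
  measurable D2 -> measurable_fun [set: T] f -> m2.-integrable D2 (EFin \o f) ->
  \int[m1]_(x in D1) f x = c * \int[m2]_(x in D2) f x.
Proof.
move=> h mD2 mf fi.
have mfE : measurable_fun [set: T] (EFin \o f) by exact/measurable_EFinP.
rewrite /Rintegral.
have [p n] : (\int[m2]_(x in D2) (EFin \o f)^\+ x)%E \is a fin_num /\
    (\int[m2]_(x in D2) (EFin \o f)^\- x)%E \is a fin_num.
  by split; [exact: integrable_pos_fin_num|exact: integrable_neg_fin_num].
have -> : (\int[m1]_(x in D1) (f x)%:E = c%:E * \int[m2]_(x in D2) (f x)%:E)%E.
  rewrite integralE [in RHS]integralE h//; last exact: measurable_funepos.
  rewrite h//; last exact: measurable_funeneg.
  by rewrite -(fineK p) -(fineK n) -!EFinM -!EFinB mulrBr.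
by rewrite fineM// integrable_fin_num.
Qed.

Lemma Rintegral_prod d' (T' : measurableType d') (P : probability T R) (Q : probability T' R)
    (f : T -> R) (g : T' -> R) (K : R) :
  measurable_fun [set: T] f -> measurable_fun [set: T'] g ->
  (forall x, `|f x| <= K) -> (forall x, `|g x| <= K) ->
  \int[(P \x Q)%E]_z (f z.1 * g z.2) = \int[P]_x f x * \int[Q]_x g x.
Proof.
move=> mf mg fK gK.
have fin (d1 : measure_display) (T1 : measurableType d1) (P1 : probability T1 R) :
    (P1 setT < +oo)%E by rewrite probability_setT ltry.
have mfg : measurable_fun [set: T * T'] (fun z => f z.1 * g z.2).
  by apply: measurable_funM; apply: measurableT_comp.
have ifg : ((P \x Q)%E : probability _ _).-integrable setT (EFin \o (fun z => f z.1 * g z.2)).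
  apply: (bounded_integrable measurableT (fin _ _ _) mfg (K := K * K)) => z.
  by rewrite normrM ler_pM.
have iF := bounded_integrable measurableT (fin _ _ P) mf fK.
have ig := bounded_integrable measurableT (fin _ _ Q) mg gK.
rewrite {1}/Rintegral -(integral12_prod_meas1 ifg).
rewrite -(RintegralZr _ measurableT iF) /Rintegral; congr fine.
apply: eq_integral => x _; rewrite /fubini_F /=.
under eq_integral do rewrite EFinM.
rewrite integralZl//.
by rewrite EFinM fineK// integrable_fin_num.
Qed.

Lemma Rintegral_ppush d' (T' : measurableType d') (f : T -> T')
    (mf : measurable_fun [set: T] f) (P : probability T R) (g : T' -> R) (K : R) :
  measurable_fun [set: T'] g -> (forall x, `|g x| <= K) ->
  \int[ppush mf P]_x g x = \int[P]_x g (f x).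
Proof.
move=> mg gK; rewrite /Rintegral; congr fine.
have mgE : measurable_fun [set: T'] (EFin \o g) by exact/measurable_EFinP.
have PT : (P setT < +oo)%E by rewrite probability_setT ltry.
rewrite -[X in (\int[P]_(x in X) _)%E](preimage_setT f).
rewrite -(integral_pushforward mf mgE)//.
rewrite preimage_setT.
exact: (bounded_integrable measurableT PT (measurableT_comp mg mf) (fun x => gK (f x))).
Qed.

End IntegralTransfer.

Section Convolution.
Context {R : realType} {H : completeNormedModType R} (ip : H -> H -> R).
Hypothesis hip : inner_product ip.
Variable e : nat -> H.
Hypothesis he : parseval_basis ip e.
Hypothesis hsep : separable H.
Local Notation law := (probability (borel H) R).

Lemma measurable_cos_ip y : measurable_fun [set: borel H] (fun x : borel H => cos (ip y x)).
Proof. exact: (@measurable_cos _ (borel H) R _ (measurable_ip hip y)). Qed.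

Lemma measurable_sin_ip y : measurable_fun [set: borel H] (fun x : borel H => sin (ip y x)).
Proof. exact: (@measurable_sin _ (borel H) R _ (measurable_ip hip y)). Qed.

Lemma norm_cos_le1 (x : R) : `|cos x| <= 1.
Proof. exact: cos_max. Qed.

Lemma norm_sin_le1 (x : R) : `|sin x| <= 1.
Proof. exact: sin_max. Qed.

Lemma eq_char_fun (P Q : law) y : (forall A : set (borel H), measurable A -> P A = Q A) ->
  char_fun ip P y = char_fun ip Q y.
Proof.
by move=> PQ; rewrite !char_funE /Rintegral; congr (fine _ +i* fine _)%C;
  apply: eq_measure_integral => A mA _; exact: PQ.
Qed.

Lemma char_fun_ppush d (T : measurableType d) (f : T -> borel H)
    (mf : measurable_fun [set: T] f) (P : probability T R) y :
  char_fun ip (ppush mf P) y =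
    (\int[P]_w cos (ip y (f w)) +i* \int[P]_w sin (ip y (f w)))%C.
Proof.
rewrite char_funE; congr (_ +i* _)%C.
  exact: (Rintegral_ppush mf P (measurable_cos_ip y) (fun x => norm_cos_le1 _)).
exact: (Rintegral_ppush mf P (measurable_sin_ip y) (fun x => norm_sin_le1 _)).
Qed.

Lemma char_fun_dirac0 y : char_fun ip (@dirac _ (borel H) (0 : H) R) y = 1%C.
Proof.
rewrite char_funE /Rintegral !integral_dirac//.
- by rewrite !diracT !mul1e /= (ip0r hip) cos0 sin0.
- by apply/measurable_EFinP; exact: measurable_sin_ip.
- by apply/measurable_EFinP; exact: measurable_cos_ip.
Qed.

(** A bundled law, so that product integration applies; [convE] identifies it on Borel sets with the
    set function [convolution]. *)
Definition conv (P Q : law) : law :=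
  ppush (measurable_addH hip he hsep) ((P \x Q)%E : probability _ R).

Lemma convE (P Q : law) (A : set (borel H)) : measurable A -> conv P Q A = convolution P Q A.
Proof.
move=> mA; rewrite /conv ppushE /product_measure1 /convolution.
by apply: eq_integral => x _ /=; congr (Q _); apply/seteqP; split => y /=;
  rewrite /xsection/= ?inE.
Qed.

Lemma char_fun_conv (P Q : law) y : char_fun ip (conv P Q) y = (char_fun ip P y * char_fun ip Q y)%C.
Proof.
rewrite char_fun_ppush !char_funE.
pose PQ : probability (borel H * borel H)%type R := (P \x Q)%E.
have fin : (PQ setT < +oo)%E by rewrite probability_setT ltry.
have mc := measurable_cos_ip y; have ms := measurable_sin_ip y.
have cK x := norm_cos_le1 (ip y x); have sK x := norm_sin_le1 (ip y x).
have i2 (f g : borel H -> R) : measurable_fun [set: borel H] f ->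
    measurable_fun [set: borel H] g -> (forall x, `|f x| <= 1) -> (forall x, `|g x| <= 1) ->
    PQ.-integrable setT (EFin \o (fun z => f z.1 * g z.2)).
  move=> mf mg f1 g1; apply: (bounded_integrable measurableT fin (K := 1)) => [|z].
    by apply: measurable_funM; apply: measurableT_comp.
  by rewrite normrM mulr_ile1.
congr (_ +i* _)%C.
- under eq_Rintegral do rewrite (ipDr hip) cosD.
  rewrite (RintegralB measurableT (i2 _ _ mc mc cK cK) (i2 _ _ ms ms sK sK)).
  by rewrite (Rintegral_prod P Q mc mc cK cK) (Rintegral_prod P Q ms ms sK sK).
- under eq_Rintegral do rewrite (ipDr hip) sinD.
  rewrite (RintegralD measurableT (i2 _ _ ms mc sK cK) (i2 _ _ mc ms cK sK)).
  rewrite (Rintegral_prod P Q ms mc sK cK) (Rintegral_prod P Q mc ms cK sK).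
  by rewrite addrC.
Qed.

Definition convn (P : law) (n : nat) : law := iter n (conv P) (@dirac _ (borel H) (0 : H) R : law).

Lemma convnE (P : law) n (A : set (borel H)) : measurable A -> convn P n A = conv_pow P n A.
Proof.
elim: n A => // n ih A mA; rewrite /convn iterS -/(convn P n) convE//.
rewrite /conv_pow iterS -/(conv_pow P n) /convolution.
apply: eq_integral => x _; apply: ih.
by have := measurable_shift hip he hsep x measurableT mA; rewrite setTI.
Qed.

Lemma char_fun_convn (P : law) n y : char_fun ip (convn P n) y = (char_fun ip P y ^+ n)%C.
Proof.
elim: n => [|n ih]; first exact: char_fun_dirac0.
by rewrite /convn iterS char_fun_conv -/(convn P n) ih exprS.
Qed.

End Convolution.

(** * Poisson mixtures of laws *)

Section PoissonMixture.
Context d (T : measurableType d) (R : realType).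
Variables (c : R) (c0 : 0 <= c) (P : nat -> probability T R).

Lemma poisson_weight_ge0 k : 0 <= expR (- c) * (c ^+ k / k`!%:R).
Proof. by rewrite mulr_ge0 ?expR_ge0// divr_ge0// exprn_ge0. Qed.

Definition poisson_weight k : {nonneg R} := NngNum (poisson_weight_ge0 k).

Definition poisson_mix : {measure set T -> \bar R} :=
  mseries (fun k => mscale (poisson_weight k) (P k)) 0.

Lemma ge0_integral_poisson_mix (f : T -> R) (a : nat -> R) (L : R) :
  measurable_fun [set: T] f -> (forall x, 0 <= f x) ->
  (forall k, \int[P k]_x (f x)%:E = (a k)%:E)%E ->
  \sum_(k < n) c ^+ k * a k / k`!%:R @[n --> \oo] --> L ->
  (\int[poisson_mix]_x (f x)%:E = (expR (- c) * L)%:E)%E.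
Proof.
move=> mf f0 fa aL.
have mfE : measurable_fun [set: T] (EFin \o f) by exact/measurable_EFinP.
rewrite ge0_integral_measure_series//; last by move=> x _; rewrite lee_fin.
rewrite (eq_eseriesr (g := fun k => (expR (- c) * (c ^+ k * a k / k`!%:R))%:E)); last first.
  move=> k _; rewrite ge0_integral_mscale//; last by move=> x _; rewrite lee_fin.
  by rewrite fa /= -EFinM; congr (_%:E); ring.
apply: cvg_lim => //.
under eq_fun do rewrite sumEFin big_mkord.
apply: cvg_EFin; first exact: nearW.
under eq_fun do rewrite -mulr_sumr.
by apply: cvgM => //; exact: cvg_cst.
Qed.

Lemma exp_series_cvg : \sum_(k < n) c ^+ k / k`!%:R @[n --> \oo] --> expR c.
Proof.
have := @cexp_series_Re R c 0 (fun k => c ^+ k) (fun=> 0) erefl erefl.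
rewrite cos0 mulr1; apply=> k; first by rewrite exprS mul0r subr0.
by rewrite mulr0 mul0r addr0.
Qed.

Lemma poisson_mix_setT : poisson_mix [set: T] = 1%E.
Proof.
rewrite -[LHS]mul1e -(integral_cst _ measurableT 1%E).
rewrite (@ge0_integral_poisson_mix (fun=> 1) (fun=> 1) (expR c))//.
- by rewrite -expRD addNr expR0.
- by move=> k; rewrite integral_cst// mul1e; exact: probability_setT.
- by under eq_fun do under eq_bigr do rewrite mulr1; exact: exp_series_cvg.
Qed.

Definition poisson_law : probability T R := probability_of poisson_mix_setT.

Lemma Rintegral_poisson_law (f : T -> R) (L : R) :
  measurable_fun [set: T] f -> (forall x, `|f x| <= 1) ->
  \sum_(k < n) c ^+ k * (\int[P k]_x f x) / k`!%:R @[n --> \oo] --> L ->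
  \int[poisson_law]_x f x = expR (- c) * L.
Proof.
move=> mf f1 fL.
have fin (Q : probability T R) : (Q setT < +oo)%E by rewrite probability_setT ltry.
have int1 (Q : probability T R) : Q.-integrable setT (EFin \o (fun=> 1 : R)).
  exact: (bounded_integrable_cst measurableT (fin Q) 1).
have intf (Q : probability T R) := bounded_integrable measurableT (fin Q) mf f1.
have mf1 : measurable_fun [set: T] (fun x => 1 + f x) by exact: measurable_funD.
have E (Q : probability T R) : (\int[Q]_x (1 + f x)%:E = (1 + \int[Q]_x f x)%:E)%E.
  rewrite -[in RHS](Rintegral_probability_cst Q 1) -(RintegralD measurableT (int1 Q) (intf Q)).
  rewrite /Rintegral fineK//; apply: integrable_fin_num => //.
  by apply: eq_integrable (integrableD measurableT (int1 Q) (intf Q)) => // x _.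
(* The integral against a series of measures is computed for nonnegative functions; adding 1 makes
   [f] nonnegative, and the contribution of the constant cancels. *)
suff : (\int[poisson_law]_x (1 + f x)%:E = (expR (- c) * (expR c + L))%:E)%E.
  by rewrite E => -[]; rewrite mulrDr -expRD addNr expR0 => /addrI.
apply: (@ge0_integral_poisson_mix _ (fun k => 1 + \int[P k]_x f x)) => //.
  by move=> x; have := f1 x; rewrite ler_norml => /andP[h _]; rewrite -lerBlDl sub0r.
under eq_fun do under eq_bigr do rewrite mulrDr mulr1 mulrDl.
under eq_fun do rewrite big_split/=.
by apply: cvgD => //; exact: exp_series_cvg.
Qed.

End PoissonMixture.

Section CompoundPoisson.
Context {R : realType} {H : completeNormedModType R} (ip : H -> H -> R).
Hypothesis hip : inner_product ip.
Variable e : nat -> H.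
Hypothesis he : parseval_basis ip e.
Hypothesis hsep : separable H.
Local Notation law := (probability (borel H) R).
Local Open Scope complex_scope.

(** The Poisson mixture of the convolution powers of [nu]. The real and imaginary parts of the
    powers of [c] times the characteristic function obey the recursion of [cexp_series_Re], and the
    weight [exp (- c)] accounts for the [- 1]. *)
Lemma compound_poisson (c : R) (nu : law) : 0 <= c -> exists rho : law, forall y,
  char_fun ip rho y = cexp ((c * (complex.Re (char_fun ip nu y) - 1)) +i*
                            (c * complex.Im (char_fun ip nu y))).
Proof.
move=> c0; exists (poisson_law c0 (convn hip he hsep nu)) => y.
rewrite [LHS]char_funE /cexp /=.
pose a k := c ^+ k * complex.Re (char_fun ip nu y ^+ k).
pose b k := c ^+ k * complex.Im (char_fun ip nu y ^+ k).
have aE k : \int[convn hip he hsep nu k]_x cos (ip y x) = complex.Re (char_fun ip nu y ^+ k).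
  by rewrite -(char_fun_convn hip he hsep) char_funE.
have bE k : \int[convn hip he hsep nu k]_x sin (ip y x) = complex.Im (char_fun ip nu y ^+ k).
  by rewrite -(char_fun_convn hip he hsep) char_funE.
have ReM (z w : R[i]) :
    complex.Re (z * w) = complex.Re z * complex.Re w - complex.Im z * complex.Im w.
  by case: z w => ? ? [].
have ImM (z w : R[i]) :
    complex.Im (z * w) = complex.Re z * complex.Im w + complex.Im z * complex.Re w.
  by case: z w => ? ? [].
have aS k : a k.+1 = c * complex.Re (char_fun ip nu y) * a k - c * complex.Im (char_fun ip nu y) * b k.
  by rewrite /a /b !exprS ReM; ring.
have bS k : b k.+1 = c * complex.Re (char_fun ip nu y) * b k + c * complex.Im (char_fun ip nu y) * a k.
  by rewrite /a /b !exprS ImM; ring.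
have a0 : a 0%N = 1 by rewrite /a !expr0 mul1r.
have b0 : b 0%N = 0 by rewrite /b !expr0 mul1r.
have mc := measurable_cos_ip hip y; have ms := measurable_sin_ip hip y.
rewrite mulrBr mulr1 addrC expRD -!mulrA; congr (_ +i* _).
- apply: (@Rintegral_poisson_law _ (borel H) R c c0 _ _ _ mc (fun x => norm_cos_le1 _)).
  by under eq_fun do under eq_bigr do rewrite aE; exact: (@cexp_series_Re R _ _ a b).
- apply: (@Rintegral_poisson_law _ (borel H) R c c0 _ _ _ ms (fun x => norm_sin_le1 _)).
  by under eq_fun do under eq_bigr do rewrite bE; exact: (@cexp_series_Im R _ _ a b).
Qed.

Lemma char_fun_shift (P : law) (v y : H) :
  char_fun ip (ppush (measurable_shift hip he hsep v) P) y =
    cexp (0 +i* ip y v) * char_fun ip P y.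
Proof.
rewrite (char_fun_ppush hip) char_funE /cexp /= expR0 !mul1r.
have PT : (P setT < +oo)%E by rewrite probability_setT ltry.
have ic := bounded_integrable measurableT PT (measurable_cos_ip hip y) (fun x => norm_cos_le1 _).
have is_ := bounded_integrable measurableT PT (measurable_sin_ip hip y) (fun x => norm_sin_le1 _).
have iZ (r : R) (f : borel H -> R) : P.-integrable setT (EFin \o f) ->
    P.-integrable setT (EFin \o (fun x => r * f x)).
  by move=> hf; have := integrableZl measurableT r hf; apply: eq_integrable.
congr (_ +i* _).
- under eq_Rintegral do rewrite (ipDr hip) cosD.
  by rewrite (RintegralB measurableT (iZ _ _ ic) (iZ _ _ is_)) (RintegralZl _ measurableT ic)
    (RintegralZl _ measurableT is_).
- under eq_Rintegral do rewrite (ipDr hip) sinD.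
  by rewrite (RintegralD measurableT (iZ _ _ ic) (iZ _ _ is_)) (RintegralZl _ measurableT ic)
    (RintegralZl _ measurableT is_) addrC.
Qed.

Lemma finite_restr_scaled (N : {measure set (borel H) -> \bar R}) (C : set (borel H)) :
  measurable C -> (N C < +oo)%E ->
  exists nu : law, forall g : borel H -> \bar R, (forall x, 0 <= g x)%E ->
    measurable_fun [set: borel H] g ->
    (\int[N]_(x in C) g x = (fine (N C))%:E * \int[nu]_x g x)%E.
Proof.
move=> mC NC; pose delta : law := @dirac _ (borel H) (0 : H) R.
have NCf : N C \is a fin_num by rewrite ge0_fin_numE.
pose m : {measure set (borel H) -> \bar R} := mrestr N mC.
have mT : m setT = N C by rewrite -[in RHS](setTI C).
pose nu : law := mnormalize m delta; exists nu => g g0 mg.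
have [NC0|NC0] := eqVneq (N C) 0%E.
  by rewrite NC0 mul0e; apply: null_set_integral => //; exact: measurable_funTS.
have r0 : 0 <= (fine (N C))^-1 by rewrite invr_ge0 fine_ge0.
have -> : (\int[nu]_x g x = \int[mscale (NngNum r0) m]_x g x)%E.
  apply: eq_measure_integral => A mA _.
  change (mnormalize m delta A = mscale (NngNum r0) m A).
  rewrite /mnormalize mT (negPf NC0).
  have -> : (N C == +oo)%E = false by apply/negbTE; rewrite -ltey.
  by rewrite /= muleC.
rewrite ge0_integral_mscale//= muleA -EFinM divff ?mul1e; last by rewrite fine_eq0.
rewrite -(setUv C) ge0_integral_setU//; last 3 first.
- exact: measurableC.
- by rewrite setUv.
- by apply/disj_setPS; rewrite setICr.
rewrite [X in (_ + X)%E](_ : _ = 0%E) ?adde0.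
  apply: eq_measure_integral => A mA AC.
  by rewrite -[in LHS](_ : A `&` C = A)//; exact/setIidPl.
apply: null_set_integral => //; first exact: measurableC.
- exact: measurable_funTS.
- by rewrite -(measure0 N) -(setICl C).
Qed.

(* The compound Poisson law with jump measure [N] on [C], recentred by the vector representing the
   mean of the small jumps. *)
Lemma levy_compound_poisson (N : {measure set (borel H) -> \bar R}) (C : set (borel H)) :
  measurable C -> (N C < +oo)%E -> exists rho : law, forall y,
    char_fun ip rho y = cexp (cintegral N C (lk_kernel ip y)).
Proof.
move=> mC NC; have [nu hnu] := finite_restr_scaled mC NC.
pose c := fine (N C); have c0 : 0 <= c by exact: fine_ge0.
have [rho hrho] := compound_poisson nu c0.
pose B : set H := [set z | `|z| <= 1].
have mB : measurable (B : set (borel H)) by exact: measurable_norm_le.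
pose k y x : R := ip y x * \1_B x.
have mk y : measurable_fun [set: borel H] (k y : borel H -> R).
  apply: (@measurable_funM _ (borel H) _ _ _ _ (measurable_ip hip y)).
  exact: (@measurable_indic _ (borel H)).
have kK y x : `|k y x| <= `|y|.
  rewrite /k indicE; have [xB|xB] := boolP (x \in B); last by rewrite mulr0 normr0.
  rewrite mulr1 (le_trans (cauchy_schwarz hip _ _))// ler_piMr//.
  by move: xB; rewrite inE.
have ik y := bounded_integrable mC NC (mk y) (kK y).
pose L y := \int[N]_(x in C) k y x.
have Llin a y z : L (a *: y + z) = a * L y + L z.
  rewrite /L -(RintegralZl a mC (ik y)).
  have iak : N.-integrable C (EFin \o (fun x : borel H => a * k y x)).
    by have := integrableZl mC a (ik y); apply: eq_integrable.
  rewrite -(RintegralD mC iak (ik z)); apply: eq_Rintegral => x _.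
  by rewrite /k (ipDl hip) (ipZl hip); ring.
have LK y : `|L y| <= c * `|y|.
  rewrite (le_trans (le_normr_Rintegral mC (ik y)))// mulrC.
  rewrite /c -(Rintegral_cst N mC `|y|).
  apply: le_Rintegral => //.
  - by have := integrable_norm (ik y).
  - by apply: (@bounded_integrable _ (borel H) _ N C mC NC (fun=> `|y|) `|y|) => // x; rewrite normr_id.
have [v hv] := riesz hip he Llin LK.
exists (ppush (measurable_shift hip he hsep (- v)) rho) => y.
rewrite char_fun_shift hrho -cexpD; congr cexp.
have mc := measurable_cos_ip hip y; have ms := measurable_sin_ip hip y.
have ic := bounded_integrable mC NC mc (fun x => norm_cos_le1 _).
have is_ := bounded_integrable mC NC ms (fun x => norm_sin_le1 _).
have i1 : N.-integrable C (EFin \o (fun=> 1 : R)).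
  exact: bounded_integrable_cst.
have nuT : (nu setT < +oo)%E by rewrite probability_setT ltry.
have icn := bounded_integrable measurableT nuT mc (fun x => norm_cos_le1 _).
have isn := bounded_integrable measurableT nuT ms (fun x => norm_sin_le1 _).
have E1 := Rintegral_scaled hnu measurableT mc icn.
have E2 := Rintegral_scaled hnu measurableT ms isn.
rewrite /cintegral; under eq_Rintegral do rewrite lk_kernel_Re.
have -> : \int[N]_(x in C) complex.Im (lk_kernel ip y x) = \int[N]_(x in C) (sin (ip y x) - k y x).
  by apply: eq_Rintegral => x _; rewrite lk_kernel_Im.
rewrite (RintegralB mC ic i1) (RintegralB mC is_ (ik y)) -/(L y) hv.
rewrite E1 E2 Rintegral_cst// -/c !char_funE /=.
rewrite (ipNr hip); apply/eqP; rewrite eq_complex /=.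
by apply/andP; split; apply/eqP; ring.
Qed.

End CompoundPoisson.

(** * Construction of a law with a given Levy measure *)

Lemma fatou_le d (T : measurableType d) (R : realType) (mu : {measure set T -> \bar R})
    (D : set T) (f_ : nat -> T -> R) (f : T -> R) (K : \bar R) :
  measurable D -> (forall n, measurable_fun [set: T] (f_ n)) ->
  (forall n x, 0 <= f_ n x) -> (forall x, f_ n x @[n --> \oo] --> f x) ->
  (forall n, \int[mu]_(x in D) (f_ n x)%:E <= K)%E ->
  (\int[mu]_(x in D) (f x)%:E <= K)%E.
Proof.
move=> mD mf f0 ff fK.
have -> : (\int[mu]_(x in D) (f x)%:E = \int[mu]_(x in D) limn_einf (fun n => (f_ n x)%:E))%E.
  apply: eq_integral => x _; apply/esym.
  by rewrite (cvg_limn_einf_sup (l := (f x)%:E))//; apply: cvg_EFin; [exact: nearW|exact: ff].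
apply: le_trans (fatou _ mD _ _) _.
- by move=> n; apply/measurable_EFinP; exact: measurable_funTS.
- by move=> n x _; rewrite lee_fin.
rewrite limn_einf_lim; apply: lime_le; first exact: is_cvg_einfs.
apply: nearW => n; apply: le_trans (fK n).
by apply: ereal_inf_lbound; exists n => /=.
Qed.

(** * Second moments of centred compound Poisson laws *)

Section SecondMoment.
Context {R : realType} {H : completeNormedModType R} (ip : H -> H -> R).
Hypothesis hip : inner_product ip.
Variable e : nat -> H.
Hypothesis he : parseval_basis ip e.
Variables (N : {measure set (borel H) -> \bar R}) (C : set (borel H)).
Hypotheses (mC : measurable C) (NC : (N C < +oo)%E) (C1 : forall x : H, C x -> `|x| <= 1).
Variable rho : probability (borel H) R.
Hypothesis hrho : forall y, char_fun ip rho y = cexp (cintegral N C (lk_kernel ip y)).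

(** The left side is [(1 - exp A) + exp A * (1 - cos B)]; the first term is at most [- A], and the
    second at most [1 - cos B], hence at most [|B|]. *)
Lemma cos_sub_le (A B : R) : A <= 0 -> 1 - expR A * cos B <= - A + `|B|.
Proof.
move=> A0; have h1 : expR A <= 1 by rewrite -expR0 ler_expR.
have h2 : 1 + A <= expR A by exact: expR_ge1Dx.
have h3 : 1 - cos B <= `|B|.
  have [B2|B2] := leP `|B| 2.
    rewrite (le_trans (one_sub_cos_le B))// -real_normK ?num_real//.
    rewrite ler_pdivrMr// expr2 ler_wpM2l//.
  by have := cos_geN1 B; move: B2; lra.
have h4 : expR A * (1 - cos B) <= 1 - cos B.
  by rewrite ler_piMl// subr_ge0 cos_le1.
by lra.
Qed.

Lemma ip_sq_measurable y : measurable_fun [set: borel H] (fun x : borel H => ip y x ^+ 2).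
Proof. exact: (@measurable_funX _ (borel H) _ _ _ 2%N (measurable_ip hip y)). Qed.

Lemma ip_sq_le y x : C x -> ip y x ^+ 2 <= `|y| ^+ 2.
Proof.
move=> Cx; rewrite -[leLHS]real_normK ?num_real// lerXn2r ?nnegrE//.
by rewrite (le_trans (cauchy_schwarz hip _ _))// ler_piMr// C1.
Qed.

Lemma integrable_ip_sq y : N.-integrable C (EFin \o (fun x : borel H => ip y x ^+ 2)).
Proof.
apply: measurable_bounded_integrable => //; first by apply: measurable_funTS; exact: ip_sq_measurable.
exists (`|y| ^+ 2); split; first exact: num_real.
move=> M KM x Cx /=; rewrite ger0_norm ?sqr_ge0// (le_trans _ (ltW KM))//.
exact: ip_sq_le.
Qed.

(** [3 / 2] is [1 / 2 + 1]: the real part of the exponent costs [u ^ 2 / 2] by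
    [1 - cos u <= u ^ 2 / 2], the imaginary part costs [u ^ 2] by [norm_sin_sub_id]. The compensator
    is the full linear term because [C] lies in the unit ball. *)
Lemma one_sub_char_le y :
  1 - \int[rho]_x cos (ip y x) <= 3 / 2 * \int[N]_(x in C) (ip y x ^+ 2).
Proof.
have -> : \int[rho]_x cos (ip y x) =
    expR (\int[N]_(x in C) complex.Re (lk_kernel ip y x)) *
    cos (\int[N]_(x in C) complex.Im (lk_kernel ip y x)).
  by have := congr1 (@complex.Re R) (hrho y); rewrite char_funE.
have i2 := integrable_ip_sq y.
set s := \int[N]_(x in C) (ip y x ^+ 2).
have ic : N.-integrable C (EFin \o (fun x : borel H => cos (ip y x) - 1)).
  apply: (bounded_integrable mC NC (K := 2)) => [|x].
    by apply: measurable_funB; [exact: measurable_cos_ip|exact: measurable_cst].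
  by rewrite (le_trans (ler_normB _ _))// normr1 -[2]/(1 + 1) lerD2r cos_max.
have ich : N.-integrable C (EFin \o (fun x : borel H => - (1 / 2) * ip y x ^+ 2)).
  by have := integrableZl mC (- (1 / 2)) i2; apply: eq_integrable.
set A := \int[N]_(x in C) complex.Re _; set B := \int[N]_(x in C) complex.Im _.
have A0 : A <= 0.
  rewrite -oppr_ge0 /A -mulN1r.
  under eq_Rintegral do rewrite lk_kernel_Re.
  rewrite -(RintegralZl _ mC ic); apply: Rintegral_ge0 => x _.
  by rewrite mulN1r opprB subr_ge0 cos_le1.
have As : - (1 / 2) * s <= A.
  rewrite /A; under [leRHS]eq_Rintegral do rewrite lk_kernel_Re.
  rewrite -(RintegralZl _ mC i2); apply: le_Rintegral => // x _.
  by have := one_sub_cos_le (ip y x); lra.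
have Bs : `|B| <= s.
  have BE : B = \int[N]_(x in C) (sin (ip y x) - ip y x).
    apply: eq_Rintegral => x; rewrite inE => Cx; rewrite lk_kernel_Im indicE mem_set ?mulr1//.
    exact: C1.
  have iB : N.-integrable C (EFin \o (fun x : borel H => sin (ip y x) - ip y x)).
    apply: le_integrable i2 => //.
    - apply/measurable_EFinP/measurable_funTS; apply: measurable_funB.
        exact: measurable_sin_ip.
      exact: measurable_ip.
    - by move=> x _; rewrite lee_fin [leRHS]ger0_norm ?sqr_ge0// norm_sin_sub_id.
  rewrite BE (le_trans (le_normr_Rintegral mC iB))//; apply: le_Rintegral => //.
    by have := integrable_norm iB.
  by move=> x _; exact: norm_sin_sub_id.
apply: le_trans (cos_sub_le B A0) _.
by move: As Bs; lra.
Qed.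

(** Moments of [rho] are not known to exist beforehand, so they are reached as limits of bounded
    integrands. Scaling [y] by [t] multiplies the bound of [one_sub_char_le] by [t ^ 2], which
    cancels [2 / t ^ 2] and leaves the factor 3. *)
Lemma ip_second_moment y :
  (\int[rho]_x (ip y x ^+ 2)%:E <= (3 * \int[N]_(x in C) (ip y x ^+ 2))%:E)%E.
Proof.
pose t (n : nat) : R := n.+1%:R^-1.
have t0 n : 0 < t n by rewrite invr_gt0.
pose f n (x : H) : R := 2 / t n ^+ 2 * (1 - cos (ip (t n *: y) x)).
have f0 n x : 0 <= f n x.
  by rewrite mulr_ge0 ?subr_ge0 ?cos_le1// divr_ge0// sqr_ge0.
have rT : (rho setT < +oo)%E by rewrite probability_setT ltry.
have mf n : measurable_fun [set: borel H] (f n : borel H -> R).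
  apply: (@measurable_funM _ (borel H)); first exact: measurable_cst.
  by apply: measurable_onem; exact: measurable_cos_ip.
apply: (@fatou_le _ (borel H) R rho setT f) => //.
- move=> x; set q := ip y x.
  have t2 : t n ^+ 2 * (q ^+ 4 / 12) @[n --> \oo] --> (0 : R).
    rewrite -(mul0r (q ^+ 4 / 12)); apply: cvgM; last exact: cvg_cst.
    have := @cvgM R nat _ _ t t 0 0 cvg_harmonic cvg_harmonic; rewrite mulr0.
    exact.
  have cq : (fun=> q ^+ 2) n @[n --> \oo] --> q ^+ 2 by exact: cvg_cst.
  apply: (cvg_of_norm_le cq t2) => n.
  rewrite /f (ipZl hip) -/q.
  have t2n : 0 < t n ^+ 2 by rewrite exprn_gt0.
  have h1 := one_sub_cos_le (t n * q); have h2 := cos_le_quartic (t n * q).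
  have e1 : 2 / t n ^+ 2 * ((t n * q) ^+ 2 / 2) = q ^+ 2 by field; rewrite gt_eqF.
  have e2 : 2 / t n ^+ 2 * ((t n * q) ^+ 4 / 24) = t n ^+ 2 * (q ^+ 4 / 12).
    by field; rewrite gt_eqF.
  have c0 : 0 <= 2 / t n ^+ 2 by rewrite divr_ge0// ltW.
  have h1' := ler_wpM2l c0 h1.
  have h2' : 2 / t n ^+ 2 * ((t n * q) ^+ 2 / 2 - (t n * q) ^+ 4 / 24) <=
      2 / t n ^+ 2 * (1 - cos (t n * q)) by rewrite ler_wpM2l//; lra.
  have q4 : 0 <= t n ^+ 2 * (q ^+ 4 / 12).
    by apply: mulr_ge0; [exact: ltW|rewrite divr_ge0// (exprM q 2 2) sqr_ge0].
  rewrite mulrBr e1 e2 in h2'; rewrite e1 in h1'.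
  by rewrite ler_norml; apply/andP; split; lra.
- move=> n.
  have ic := bounded_integrable measurableT rT (measurable_cos_ip hip (t n *: y)) (fun x => norm_cos_le1 _).
  have i1 : rho.-integrable setT (EFin \o (fun=> 1 : R)).
    exact: bounded_integrable_cst.
  have i1c := integrableB measurableT i1 ic.
  have i1c' : rho.-integrable setT (EFin \o (fun x : borel H => 1 - cos (ip (t n *: y) x))).
    by apply: eq_integrable i1c.
  have -> : (\int[rho]_x (f n x)%:E = (\int[rho]_x f n x)%:E)%E.
    rewrite /Rintegral fineK//; apply: integrable_fin_num => //.
    by have := integrableZl measurableT (2 / t n ^+ 2) i1c'; apply: eq_integrable.
  rewrite lee_fin /f (RintegralZl _ measurableT i1c') (RintegralB measurableT i1 ic).
  rewrite Rintegral_probability_cst.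
  have := one_sub_char_le (t n *: y).
  have -> : \int[N]_(x in C) (ip (t n *: y) x ^+ 2) = t n ^+ 2 * \int[N]_(x in C) (ip y x ^+ 2).
    rewrite -(RintegralZl _ mC (integrable_ip_sq y)); apply: eq_Rintegral => x _.
    by rewrite (ipZl hip) exprMn.
  rewrite -(ler_pM2l (x := 2 / t n ^+ 2)) ?divr_gt0 ?exprn_gt0// => /le_trans; apply.
  by rewrite le_eqVlt; apply/orP; left; apply/eqP; field; rewrite gt_eqF.
Qed.

(** The bounds along basis vectors are added: Parseval recovers [|x| ^ 2] in the limit under [rho],
    and bounds every finite sum under [N]. *)
Lemma second_moment :
  (\int[rho]_x (`|x : H| ^+ 2)%:E <= 3%:E * \int[N]_(x in C) (`|x : H| ^+ 2)%:E)%E.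
Proof.
have mn : measurable_fun [set: borel H] (fun x : borel H => `|x : H| ^+ 2).
  exact: (@measurable_funX _ (borel H) _ _ _ 2%N measurable_norm_borel).
have mi i : measurable_fun [set: borel H] (fun x : borel H => (ip (e i) x ^+ 2)%:E).
  by apply/measurable_EFinP; exact: ip_sq_measurable.
apply: (@fatou_le _ (borel H) R rho setT (fun n x => \sum_(i < n) ip (e i) x ^+ 2)) => //.
- by move=> n; apply: measurable_sum => i; exact: ip_sq_measurable.
- by move=> n x; apply: sumr_ge0 => i _; exact: sqr_ge0.
- by move=> x; under eq_fun do under eq_bigr do rewrite (ipC hip); exact: (@parseval _ _ _ _ he).
move=> n; under eq_integral do rewrite -sumEFin.
rewrite ge0_integral_sum//; last by move=> i x _; rewrite lee_fin sqr_ge0.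
apply: (@le_trans _ _ (\sum_(i < n) (3%:E * \int[N]_(x in C) (ip (e i) x ^+ 2)%:E))%E).
  apply: lee_sum => i _; apply: le_trans (ip_second_moment _) _.
  by rewrite EFinM /Rintegral fineK//; apply: integrable_fin_num => //; exact: integrable_ip_sq.
rewrite -ge0_sume_distrr; last by move=> i _; apply: integral_ge0 => x _; rewrite lee_fin sqr_ge0.
rewrite lee_pmul2l// -ge0_integral_sum//; last 2 first.
- by move=> i; exact: measurable_funTS.
- by move=> i x _; rewrite lee_fin sqr_ge0.
apply: ge0_le_integral => //.
- by move=> x _; rewrite sume_ge0// => i _; rewrite lee_fin sqr_ge0.
- by apply: emeasurable_sum => i; exact: measurable_funTS.
- by apply/measurable_EFinP; exact: measurable_funTS.
move=> x _; rewrite sumEFin lee_fin.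
by under eq_bigr do rewrite (ipC hip); exact: (parseval_le he n x).
Qed.

End SecondMoment.

(** * Almost surely convergent sums of independent vectors *)

Section IndependentSum.
Context {R : realType} {H : completeNormedModType R} (ip : H -> H -> R).
Hypothesis hip : inner_product ip.
Variable e : nat -> H.
Hypothesis he : parseval_basis ip e.
Hypothesis hsep : separable H.
Local Notation law := (probability (borel H) R).
Variable rho : nat -> law.
Local Notation W := (g_sigma_algebraType (@coordinate_sets _ (borel H))).

Fixpoint conv_upto n : law :=
  if n is n'.+1 then conv hip he hsep (conv_upto n') (rho n')
  else @dirac _ (borel H) (0 : H) R.

(** The sum starts at index 1: [rho 0] will carry the large jumps and may have no first moment. *)
Hypothesis hrho : (\sum_(0 <= k <oo) \int[rho k.+1]_x (`|x : H|)%:E < +oo)%E.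
Variable P : probability W R.
Hypothesis hP : forall n (B : set W) (C : set (borel H)), measurable B -> dep n B ->
  measurable C -> P (B `&` [set w | C (w n)]) = (P B * rho n C)%E.

Definition psum n (w : W) : borel H := (\sum_(k < n) (w k : H))%R.

Lemma psumS n w : psum n.+1 w = (psum n w : H) + w n.
Proof. by rewrite /psum big_ord_recr. Qed.

Lemma dep_psum n (A : set H) : dep n [set w : W | A (psum n w)].
Proof.
move=> w w' ww /=; congr A; apply: eq_bigr => i _; apply: ww; exact: ltn_ord.
Qed.

Lemma measurable_ip_coord y k : measurable_fun [set: W] (fun w : W => ip y (w k)).
Proof. exact: (measurableT_comp (measurable_ip hip y) (measurable_coord k)). Qed.

Lemma measurable_psum n : measurable_fun [set: W] (psum n).
Proof.
apply: (measurable_to_borel hip he hsep) => i.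
rewrite [X in measurable_fun _ X](_ : _ = fun w : W => \sum_(k < n) ip (e i) (w k)); last first.
  by apply/funext => w; rewrite (ipC hip) (ip_sumr hip).
by apply: measurable_sum => k; exact: measurable_ip_coord.
Qed.

(** The joint law of [psum n] and coordinate [n] agrees with the product measure on rectangles,
    hence equals it by uniqueness. *)
Lemma ppush_psum n (A : set (borel H)) : measurable A ->
  ppush (measurable_psum n) P A = conv_upto n A.
Proof.
elim: n A => [|n ih] A mA.
  rewrite ppushE /= diracE; have [A0|A0] := boolP ((0 : H) \in A).
    rewrite (_ : _ @^-1` _ = setT) ?probability_setT//; apply/seteqP; split => // w _.
    by rewrite /preimage/= /psum big_ord0; rewrite inE in A0.
  rewrite (_ : _ @^-1` _ = set0) ?measure0//; apply/seteqP; split => // w.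
  by rewrite /preimage/= /psum big_ord0 => hA; move/negP: A0; apply; rewrite inE.
have mpair : measurable_fun [set: W] (fun w : W => (psum n w, w n) : borel H * borel H).
  by apply: measurable_fun_pair; [exact: measurable_psum|exact: measurable_coord].
have mX : measurable ((fun p : borel H * borel H => (p.1 : H) + (p.2 : H)) @^-1` A
    : set (borel H * borel H)).
  by have := measurable_addH hip he hsep measurableT mA; rewrite setTI.
rewrite ppushE; transitivity (product_measure1 (conv_upto n) (rho n)
    ((fun p : borel H * borel H => (p.1 : H) + (p.2 : H)) @^-1` A)) => //.
rewrite (@product_measure_unique _ _ _ _ _ _ _ (ppush mpair P : {measure set _ -> \bar R}) _ _ mX).
- rewrite [RHS]ppushE; congr (P _); apply/seteqP; split => w; rewrite /preimage/=;
    by rewrite psumS.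
- move=> B C mB mC; transitivity (P ((psum n @^-1` B) `&` [set w : W | C (w n)])) => //.
  have mB' : measurable (psum n @^-1` B : set W).
    by have := measurable_psum n measurableT mB; rewrite setTI.
  rewrite (hP mB' (@dep_psum n B) mC).
  exact: (congr1 (fun z => z * rho n C)%E (ih B mB)).
Qed.

Lemma char_fun_psum n y : char_fun ip (ppush (measurable_psum n) P) y = char_fun ip (conv_upto n) y.
Proof. by apply: eq_char_fun => A mA; exact: ppush_psum. Qed.

Let G (w : W) : \bar R := (\sum_(0 <= k <oo) (`|w k.+1 : H|)%:E)%E.

Lemma measurable_norm_coord k : measurable_fun [set: W] (fun w : W => (`|w k : H|)%:E).
Proof.
apply/measurable_EFinP; exact: (measurableT_comp measurable_norm_borel (measurable_coord k)).
Qed.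

Let mG : measurable_fun [set: W] G.
Proof.
apply: (@ge0_emeasurable_sum _ W R setT (fun k w => (`|w k.+1 : H|)%:E) predT) => //.
by move=> k _; exact: measurable_norm_coord.
Qed.

Let intG : (\int[P]_w G w < +oo)%E.
Proof.
rewrite /G integral_nneseries//; last by move=> k; exact: measurable_norm_coord.
apply: le_lt_trans hrho; apply: lee_nneseries; first by move=> k _ _; exact: integral_ge0.
move=> k _.
have mnE : measurable_fun [set: borel H] (fun x : borel H => (`|x : H|)%:E).
  by apply/measurable_EFinP; exact: measurable_norm_borel.
rewrite -[X in (\int[P]_(w in X) _)%E](preimage_setT (fun w : W => w k.+1)).
rewrite -(ge0_integral_pushforward (measurable_coord k.+1) P measurableT mnE)//.
  rewrite le_eqVlt; apply/orP; left; apply/eqP.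
  transitivity (\int[ppush (measurable_coord k.+1) P]_y (`|y : H|)%:E)%E => //.
  apply: eq_measure_integral => A mA _.
  transitivity (P (setT `&` [set w | A (w k.+1)])); first by rewrite setTI.
  rewrite hP//.
  by rewrite -[RHS]mul1e; congr (_ * _)%E; exact: probability_setT.
Qed.

Let E : set W := [set w | (G w < +oo)%E].

Let mE : measurable E.
Proof.
have := mG measurableT (emeasurable_itv `]-oo%E, +oo%E[); rewrite setTI.
by congr measurable; apply/seteqP; split => w; rewrite /E/preimage/= in_itv/=;
  [case/andP|move=> ->; rewrite andbT (lt_le_trans (ltNyr 0))// nneseries_ge0].
Qed.

Let G_ae : {ae P, forall w, E w}.
Proof.
have iG : P.-integrable setT G.
  apply/integrableP; split => //; under eq_integral do rewrite gee0_abs ?nneseries_ge0//.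
  exact: intG.
have := integrable_ae measurableT iG; apply: filterS => w /(_ I).
by rewrite ge0_fin_numE// nneseries_ge0.
Qed.

(** Multiplying by the indicator of the event of absolute convergence makes the limit exist
    everywhere, hence measurable, and changes the partial sums only on a null set. *)
Let X n (w : W) : borel H := \1_E w *: (psum n w : H).

Let mip n y : measurable_fun [set: W] (fun w => ip y (psum n w)).
Proof. exact: (measurableT_comp (measurable_ip hip y) (measurable_psum n)). Qed.

Let mX n y : measurable_fun [set: W] (fun w => ip y (X n w)).
Proof.
rewrite [X in measurable_fun _ X](_ : _ = fun w : W => \1_E w * ip y (psum n w)); last first.
  by apply/funext => w; rewrite /X (ipZr hip).
by apply: measurable_funM => //; exact: measurable_indic.
Qed.

Let is_cvg_X w : cvgn (fun n => X n w : H).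
Proof.
rewrite /X indicE; have [wE|wE] := boolP (w \in E); last first.
  by under eq_fun do rewrite scale0r; exact: is_cvg_cst.
under eq_fun do rewrite scale1r.
have -> : (fun n => psum n w : H) = series (fun k => w k : H).
  by apply/funext => n; rewrite /series/= big_mkord.
apply: (@normed_cvg _ H); apply: nondecreasing_is_cvgn.
  apply/nondecreasing_seqP => n; rewrite [leRHS](_ : _ = [normed series (fun k => w k : H)] n + `|w n : H|).
    by rewrite lerDl.
  by rewrite /normed_series_of /series/= big_nat_recr.
exists (`|w 0%N : H| + fine (G w)) => _ [n _ <-].
have Gfin : G w \is a fin_num.
  by rewrite ge0_fin_numE ?nneseries_ge0//; rewrite inE in wE.
rewrite /series/= (@le_trans _ _ (\sum_(0 <= k < n.+1) `|w k : H|))//.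
  by rewrite big_nat_recr//= lerDl.
rewrite big_nat_recl//= lerD2l -lee_fin fineK// -sumEFin.
by apply: nneseries_lim_ge => k _; rewrite lee_fin.
Qed.

Let S (w : W) : borel H := limn (fun n => X n w : H).

Let measurable_S : measurable_fun [set: W] S.
Proof.
apply: (measurable_to_borel hip he hsep) => i.
rewrite [X in measurable_fun _ X](_ : _ = fun w : W => ip (e i) (S w)); last first.
  by apply/funext => w; rewrite (ipC hip).
apply: (@measurable_fun_cvg _ _ _ _ (fun n w => ip (e i) (X n w))).
  by move=> n; exact: mX.
move=> w _; apply: continuous_cvg; first exact: ip_continuous.
exact: is_cvg_X.
Qed.

Let char_cvg (h : R -> R) y : continuous h -> (forall x, `|h x| <= 1) ->
  \int[P]_w h (ip y (psum n w)) @[n --> \oo] --> \int[P]_w h (ip y (S w)).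
Proof.
move=> ch h1.
have mh d (T : measurableType d) (f : T -> R) : measurable_fun [set: T] f ->
    measurable_fun [set: T] (fun x => h (f x)).
  by move=> mf; apply: (measurableT_comp (f := h)) => //; exact: continuous_measurable_fun.
rewrite (_ : (fun n => _) = (fun n => \int[P]_w h (ip y (X n w)))).
  have PT : (P setT < +oo)%E by rewrite probability_setT ltry.
  apply: (@bounded_cvg_Rintegral _ _ _ P setT measurableT PT _ _ 1) => // [n|w].
    by apply: mh.
  apply: continuous_cvg; first exact: ch.
  apply: continuous_cvg; first exact: ip_continuous.
  exact: is_cvg_X.
apply/funext => n; rewrite /Rintegral; congr fine.
apply: ae_eq_integral => //.
- by apply/measurable_EFinP; exact: mh.
- by apply/measurable_EFinP; exact: mh.
apply: filterS G_ae => w Ew _; rewrite /X indicE mem_set// scale1r//.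
Qed.

Lemma independent_sum : exists mu : law, forall y,
  complex.Re (char_fun ip (conv_upto n) y) @[n --> \oo] --> complex.Re (char_fun ip mu y) /\
  complex.Im (char_fun ip (conv_upto n) y) @[n --> \oo] --> complex.Im (char_fun ip mu y).
Proof.
exists (ppush measurable_S P) => y; rewrite (char_fun_ppush hip measurable_S); split.
- rewrite (_ : (fun n => _) = (fun n => \int[P]_w cos (ip y (psum n w)))); last first.
    by apply/funext => n; rewrite -char_fun_psum (char_fun_ppush hip).
  by apply: char_cvg; [exact: continuous_cos|exact: norm_cos_le1].
- rewrite (_ : (fun n => _) = (fun n => \int[P]_w sin (ip y (psum n w)))); last first.
    by apply/funext => n; rewrite -char_fun_psum (char_fun_ppush hip).
  by apply: char_cvg; [exact: continuous_sin|exact: norm_sin_le1].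
Qed.

End IndependentSum.

Lemma cvg_Rintegral_setU d (T : measurableType d) (R : realType) (mu : {measure set T -> \bar R})
    (U : nat -> set T) (D : set T) (g : T -> R) :
  measurable D -> (forall n, measurable (U n)) -> {homo U : m n / (m <= n)%N >-> m `<=` n} ->
  \bigcup_n U n = D -> mu.-integrable D (EFin \o g) ->
  \int[mu]_(x in U n) g x @[n --> \oo] --> \int[mu]_(x in D) g x.
Proof.
move=> mD mU ndU UD ig.
have UE n : U n = D `&` U n.
  by apply/esym/setIidPr; rewrite -UD; exact: bigcup_sup.
under eq_fun do rewrite UE Rintegral_mkcondr.
have mg : measurable_fun D g by apply/measurable_EFinP; case/integrableP : ig.
have mgU n : measurable_fun D (g \_ (U n)).
  apply/(measurable_restrict _ (mU n) mD); apply: measurable_funS mg => //.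
apply: fine_cvg; rewrite fineK; last exact: integrable_fin_num.
apply: (@dominated_cvg _ _ _ mu D mD _ _ (fun x => `|(g x)%:E|%E)) => //.
- by move=> n; apply/measurable_EFinP; exact: mgU.
- move=> x; rewrite -UD => -[n _ Unx].
  apply: cvg_near_cst; exists n => // m /= nm.
  by rewrite patchT// inE; exact: ndU Unx.
- exact: integrable_abse.
- by move=> n x _; rewrite lee_fin /patch; case: ifP; rewrite ?normr0.
Qed.

Section LevyLaw.
Context {R : realType} {H : completeNormedModType R} (ip : H -> H -> R).
Hypothesis hip : inner_product ip.
Hypothesis hsep : separable H.
Local Notation law := (probability (borel H) R).

Lemma measurable_norm_gt (r : R) : measurable ([set x : H | r < `|x|] : set (borel H)).
Proof.
by have := @measurable_norm_borel R H measurableT _ (measurable_itv `]r, +oo[);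
  rewrite setTI; congr measurable; apply/seteqP; split => x /=; rewrite in_itv/= andbT.
Qed.

Lemma measurable_norm_sqr : measurable_fun [set: borel H] (fun x : borel H => `|x : H| ^+ 2).
Proof. exact: (@measurable_funX _ (borel H) _ _ _ 2%N measurable_norm_borel). Qed.

Lemma sq_trunc_small (x : H) : `|x| <= 1 -> sq_trunc x = `|x| ^+ 2.
Proof. by move=> x1; rewrite /sq_trunc; apply/min_idPr; rewrite exprn_ile1. Qed.

Lemma sq_trunc_large (x : H) : 1 <= `|x| -> sq_trunc x = 1.
Proof. by move=> x1; rewrite /sq_trunc; apply/min_idPl; rewrite exprn_ege1. Qed.

Lemma norm_lk_Re_le (y x : H) : `|cos (ip y x) - 1| <= (2 + `|y| ^+ 2) * sq_trunc x.
Proof.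
rewrite distrC ger0_norm ?subr_ge0 ?cos_le1//.
have y2 : 0 <= `|y| ^+ 2 := sqr_ge0 _.
have [x1|x1] := leP `|x| 1.
  rewrite sq_trunc_small// (le_trans (one_sub_cos_le _))//.
  have := cauchy_schwarz_sq hip y x.
  have : 0 <= `|x| ^+ 2 := sqr_ge0 _.
  have : 0 <= `|y| ^+ 2 * `|x| ^+ 2 by rewrite mulr_ge0.
  by rewrite mulrDl; lra.
rewrite sq_trunc_large; last exact: ltW.
rewrite mulr1.
by have := cos_geN1 (ip y x); lra.
Qed.

Lemma norm_lk_Im_le (y x : H) :
  `|sin (ip y x) - ip y x * \1_[set z : H | `|z| <= 1] x| <= (2 + `|y| ^+ 2) * sq_trunc x.
Proof.
have y2 : 0 <= `|y| ^+ 2 := sqr_ge0 _.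
have x2 : 0 <= `|x| ^+ 2 := sqr_ge0 _.
rewrite indicE; have [x1|x1] := leP `|x| 1.
  rewrite mem_set// mulr1 sq_trunc_small// (le_trans (norm_sin_sub_id _))//.
  have := cauchy_schwarz_sq hip y x.
  have : 0 <= `|y| ^+ 2 * `|x| ^+ 2 by rewrite mulr_ge0.
  by move: x2 y2 => _ _; rewrite mulrDl; have : 0 <= `|x| ^+ 2 := sqr_ge0 _; lra.
rewrite memNset ?mulr0 ?subr0; last by move=> /=; rewrite leNgt x1.
rewrite sq_trunc_large; last exact: ltW.
rewrite mulr1.
by have := norm_sin_le1 (ip y x); lra.
Qed.

Variable N : {measure set (borel H) -> \bar R}.
Hypothesis hN : (\int[N]_x (sq_trunc (x : H))%:E < +oo)%E.

Let mtE : measurable_fun [set: borel H] (fun x : borel H => (sq_trunc (x : H))%:E).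
Proof. by apply/measurable_EFinP; exact: measurable_sq_trunc. Qed.

Let mD : measurable ([set~ (0 : H)] : set (borel H)).
Proof. by apply: measurableC; exact: measurable_set0_borel. Qed.

Lemma integrable_sq_trunc (D : set (borel H)) : measurable D ->
  N.-integrable D (EFin \o (sq_trunc : borel H -> R)).
Proof.
move=> mD'; apply: (@integrableS _ _ _ N setT D) => //.
apply/integrableP; split => //.
under eq_integral do rewrite gee0_abs ?lee_fin ?sq_trunc_ge0//.
exact: hN.
Qed.

Lemma cintegrable_lk y : cintegrable N [set~ (0 : H)] (lk_kernel ip y).
Proof.
have it := integrableZl mD (2 + `|y| ^+ 2) (integrable_sq_trunc mD).
split.
- apply: le_integrable it => //.
    by apply/measurable_EFinP; apply: measurable_funTS; exact: measurable_lk_Re.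
  move=> x _; rewrite lk_kernel_Re /= lee_fin.
  by rewrite (le_trans (norm_lk_Re_le y x))// real_ler_norm// num_real.
- apply: le_integrable it => //.
    by apply/measurable_EFinP; apply: measurable_funTS; exact: measurable_lk_Im.
  move=> x _; rewrite lk_kernel_Im /= lee_fin.
  by rewrite (le_trans (norm_lk_Im_le y x))// real_ler_norm// num_real.
Qed.

Lemma norm_gt_fin (r : R) : 0 < r -> r <= 1 -> (N [set x : H | (r < `|x|)%R] < +oo)%E.
Proof.
move=> r0 r1; have mF := measurable_norm_gt r.
have r20 : 0 < r ^+ 2 by rewrite exprn_gt0.
suff : ((r ^+ 2)%:E * N [set x : H | (r < `|x|)%R] < +oo)%E.
  have := measure_ge0 N [set x : H | (r < `|x|)%R].
  case: (N [set x : H | (r < `|x|)%R]) => //= [s _ _|_]; first exact: ltry.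
  by rewrite gt0_muley.
apply: le_lt_trans hN; rewrite -(integral_cst _ mF) integral_mkcond.
apply: ge0_le_integral => //.
- by move=> x _; rewrite /patch; case: ifP => // _; rewrite lee_fin sqr_ge0.
- apply/(measurable_restrictT _ mF); exact: measurable_cst.
- move=> x _; rewrite /patch; case: ifPn => [|_]; last by rewrite lee_fin sq_trunc_ge0.
  rewrite inE /= => rx; rewrite lee_fin /sq_trunc le_min exprn_ile1 ?(ltW r0)//=.
  by rewrite lerXn2r ?nnegrE ?(ltW r0)// ltW.
Qed.

(** Dominated convergence with the truncated square: at each [x] the integrand is eventually 0, and
    at the origin it is 0 throughout. *)
Lemma small_ball_moment (eps : R) : 0 < eps -> \forall n \near \oo,
  (\int[N]_(x in [set x : H | (`|x| <= n.+1%:R^-1)%R]) (`|x : H| ^+ 2)%:E <= eps%:E)%E.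
Proof.
move=> eps0.
pose B n : set H := [set x | `|x| <= n.+1%:R^-1].
pose f (n : nat) (x : borel H) : \bar R := (\1_(B n) x * `|x : H| ^+ 2)%:E.
have mB n : measurable (B n : set (borel H)) by exact: measurable_norm_le.
have mf n : measurable_fun [set: borel H] (f n).
  apply/measurable_EFinP; apply: (@measurable_funM _ (borel H)).
    exact: (@measurable_indic _ (borel H)).
  exact: measurable_norm_sqr.
have f_cvg : (\int[N]_x f n x @[n --> \oo] --> 0)%E.
  rewrite -(integral0 N setT).
  apply: (@dominated_cvg _ _ _ N setT measurableT f (fun=> 0%E) (fun x => (sq_trunc (x : H))%:E)) => //.
  - move=> x _; have [x0|x0] := eqVneq (x : H) 0.
      by rewrite /f x0; apply: cvg_near_cst; apply: nearW => n; rewrite normr0 expr0n mulr0.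
    have xp : 0 < `|x : H| by rewrite normr_gt0.
    have /= h := near_infty_natSinv_lt (PosNum xp); apply: cvg_near_cst; apply: filterS h => n /= nx.
    by rewrite /f indicE memNset ?mul0r// /B/= leNgt nx.
  - exact: integrable_sq_trunc.
  - move=> n x _; rewrite lee_fin indicE.
    have [|_] := boolP (x \in B n); last by rewrite mul0r normr0 sq_trunc_ge0.
    rewrite inE /B /= => xn; rewrite mul1r ger0_norm ?sqr_ge0// sq_trunc_small//.
    by rewrite (le_trans xn)// invf_le1// ler1n.
have := f_cvg; move/fine_cvgP => [fin /cvgrPdist_le /(_ _ eps0)].
apply: filterS2 fin => n fin.
rewrite /= sub0r normrN -lee_fin -abse_EFin fineK// gee0_abs; last first.
  by apply: integral_ge0 => x _; rewrite lee_fin mulr_ge0// sqr_ge0.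
apply: le_trans; rewrite integral_mkcond le_eqVlt; apply/orP; left; apply/eqP.
apply: eq_integral => x _; rewrite /f /patch indicE -/(B n).
by case: ifP => _; rewrite ?mul1r ?mul0r.
Qed.

Lemma exists_levy_law : exists mu : law, forall y,
  char_fun ip mu y = cexp (cintegral N [set~ (0 : H)] (lk_kernel ip y)).
Proof.
have [e he] := exists_parseval_basis hip hsep.
pose q k : R := (1 / 2) ^+ k.
have q0 k : 0 < q k by rewrite exprn_gt0.
(* [k <= n] forces the radii to 0, so that the shells exhaust the complement of the origin; the
   bound [q k ^+ 2] makes the first moments summable. *)
have hr k : exists n, (k <= n)%N /\
    (\int[N]_(x in [set x : H | (`|x| <= n.+1%:R^-1)%R]) (`|x : H| ^+ 2)%:E <= (q k ^+ 2)%:E)%E.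
  have := small_ball_moment (exprn_gt0 2 (q0 k)) => -[n _ hn].
  by exists (maxn k n); split; [exact: leq_maxl|apply: hn; rewrite /= leq_maxr].
pose r k : R := (projT1 (cid (hr k))).+1%:R^-1.
have r0 k : 0 < r k by rewrite /r invr_gt0.
have r1 k : r k <= 1 by rewrite /r invf_le1// ler1n.
have rk k : r k <= k.+1%:R^-1.
  by rewrite /r lef_pV2 ?posrE// ler_nat ltnS; case: cid => n [].
have rV k : (\int[N]_(x in [set x : H | (`|x| <= r k)%R]) (`|x : H| ^+ 2)%:E <= (q k ^+ 2)%:E)%E.
  by rewrite /r; case: cid => n [].
pose F k : set (borel H) := [set x : H | r k < `|x|].
have mF k : measurable (F k) by exact: measurable_norm_gt.
(* The shells are disjoint. [C 0] holds the large jumps and is only used through its finite mass;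
   [C k.+1] lies in the ball of radius [r k], where the moment bound applies. *)
pose C := seqDU F.
have mC k : measurable (C k) by apply: measurableD => //; exact: bigsetU_measurable.
have CF k : C k `<=` F k by exact: subDsetl.
have NC k : (N (C k) < +oo)%E.
  apply: le_lt_trans (norm_gt_fin (r0 k) (r1 k)); apply: le_measure; rewrite ?inE//; exact: mF.
have CB k : C k.+1 `<=` [set x : H | `|x| <= r k].
  move=> x [_ nF] /=; rewrite leNgt; apply/negP => rx; apply: nF.
  by rewrite -bigcup_mkord; exists k => /=.
have C1 k (x : H) : C k.+1 x -> `|x| <= 1 by move=> /CB /le_trans; exact.
have CT : \bigcup_k C k = [set~ (0 : H)].
  rewrite /C -seqDU_bigcup_eq; apply/seteqP; split => [x [k _ /= kx] x0|x /= x0].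
    by move: kx; rewrite /F/= x0 normr0 ltNge (ltW (r0 k)).
  have x1 : 0 < `|x : H| by rewrite normr_gt0; exact/eqP.
  have [n _ hn] := near_infty_natSinv_lt (PosNum x1).
  by exists n => //=; rewrite /F /= (le_lt_trans (rk n))//; exact: (hn n (leqnn n)).
have [rho hrho] := choice (fun k => levy_compound_poisson hip he hsep (mC k) (NC k)).
have m1 k : (\int[rho k.+1]_x (`|x : H|)%:E <= (4 * q k)%:E)%E.
  have m2 := second_moment hip he (mC k.+1) (NC k.+1) (@C1 k) (hrho k.+1).
  have m3 : (\int[rho k.+1]_x (`|x : H| ^+ 2)%:E <= (3 * q k ^+ 2)%:E)%E.
    apply: le_trans m2 _; rewrite EFinM lee_pmul2l//; apply: le_trans (rV k).
    apply: ge0_subset_integral => //; first exact: measurable_norm_le.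
    by apply/measurable_EFinP; apply: measurable_funTS; exact: measurable_norm_sqr.
  (* The inequality [z <= q + z ^ 2 / q] turns the second moment bound [3 q ^ 2] into the first
     moment bound [4 q]. *)
  apply: (@le_trans _ _ (\int[rho k.+1]_x ((q k)%:E + ((q k)^-1)%:E * (`|x : H| ^+ 2)%:E))%E).
    apply: ge0_le_integral => //.
    - by apply/measurable_EFinP; exact: measurable_norm_borel.
    - apply: emeasurable_funD; first exact: measurable_cst.
      apply: emeasurable_funM; first exact: measurable_cst.
      by apply/measurable_EFinP; exact: measurable_norm_sqr.
    - move=> x _; rewrite -EFinM -EFinD lee_fin.
      have := sqr_ge0 (q k - `|x : H|); have : 0 <= `|x : H| by [].
      move: (`|x : H|) => z z0 h.
      rewrite -(ler_pM2l (q0 k)) mulrDr mulrA divff ?gt_eqF// mul1r.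
      have : 0 <= q k * z by rewrite mulr_ge0// ltW.
      by move: h; lra.
  rewrite ge0_integralD//; last 3 first.
  - by move=> x _; rewrite lee_fin ltW.
  - by move=> x _; rewrite -EFinM lee_fin mulr_ge0 ?sqr_ge0// invr_ge0 ltW.
  - apply: emeasurable_funM; first exact: measurable_cst.
    by apply/measurable_EFinP; exact: measurable_norm_sqr.
  have -> : (\int[rho k.+1]__ (q k)%:E = (q k)%:E)%E.
    rewrite (integral_cst (rho k.+1) measurableT) -[RHS]mule1; congr (_ * _)%E.
    exact: probability_setT.
  rewrite ge0_integralZl_EFin//; last 2 first.
  - by apply/measurable_EFinP; exact: measurable_norm_sqr.
  - by rewrite invr_ge0 ltW.
  apply: (@le_trans _ _ ((q k)%:E + ((q k)^-1)%:E * (3 * q k ^+ 2)%:E)%E).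
    by rewrite leeD2l// lee_pmul2l// lte_fin invr_gt0.
  rewrite -EFinM -EFinD lee_fin le_eqVlt; apply/orP; left; apply/eqP.
  by field; rewrite gt_eqF.
have msum : (\sum_(0 <= k <oo) \int[rho k.+1]_x (`|x : H|)%:E < +oo)%E.
  apply: (@le_lt_trans _ _ (\sum_(0 <= k <oo) (4 * q k)%:E)%E).
    by apply: lee_nneseries => [k _ _|k _]; [exact: integral_ge0|exact: m1].
  have h2 : `|1 / 2 : R| < 1 by rewrite ger0_norm//; lra.
  rewrite (_ : limn _ = (4 / (1 - 1 / 2))%:E) ?ltry//; apply: cvg_lim => //.
  under eq_fun do rewrite sumEFin.
  by apply: cvg_EFin; [exact: nearW|exact: (@cvg_geometric_series R 4 (1 / 2) h2)].
have [P hP] := infinite_product rho.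
have [mu hmu] := independent_sum hip he hsep msum hP.
exists mu => y; have [muRe muIm] := hmu y.
pose U n := \big[setU/set0]_(k < n) C k.
have mU n : measurable (U n) by apply: bigsetU_measurable.
have [iRe iIm] := cintegrable_lk y.
have US n : U n `<=` [set~ (0 : H)].
  by rewrite -CT /U -bigcup_mkord; apply: bigcup_sub => i _; exact: bigcup_sup.
have addC (g : borel H -> R) n : N.-integrable [set~ (0 : H)] (EFin \o g) ->
    \int[N]_(x in U n.+1) g x = \int[N]_(x in U n) g x + \int[N]_(x in C n) g x.
  move=> ig; rewrite /U big_ord_recr/= Rintegral_setU//.
  - exact: (mU n).
  - apply: (integrableS mD _ _ ig); first exact: measurableU (mU n) (mC n).
    by rewrite subUset; split; [exact: US|rewrite -CT; exact: bigcup_sup].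
  - apply/disj_setPS => x [Ux [_]]; rewrite -bigcup_mkord => h.
    apply: h; move: Ux; rewrite /U -bigcup_mkord => -[i ni Cx]; exists i => //.
    exact: CF.
have charU n : char_fun ip (conv_upto hip he hsep rho n) y = cexp (cintegral N (U n) (lk_kernel ip y)).
  elim: n => [|n ih].
    rewrite /= (char_fun_dirac0 hip) /U big_ord0 /cintegral !Rintegral_set0.
    by rewrite /cexp /= expR0 cos0 sin0 mulr1 mulr0.
  rewrite /= (char_fun_conv hip) ih hrho -cexpD; congr cexp.
  by rewrite /cintegral (addC _ n iRe) (addC _ n iIm).
have ndU : {homo U : m n / (m <= n)%N >-> m `<=` n}.
  move=> m n mn; rewrite /U -!bigcup_mkord; apply: bigcup_sub => i /= im.
  by apply: bigcup_sup => /=; exact: leq_trans mn.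
have UT : \bigcup_n U n = [set~ (0 : H)].
  rewrite -CT; apply/seteqP; split => x [n _ nx].
    by move: nx; rewrite /U -bigcup_mkord => -[i _ ix]; exists i.
  by exists n.+1 => //; rewrite /U -bigcup_mkord; exists n => /=.
have cRe := @cvg_Rintegral_setU _ _ _ N U _ _ mD mU ndU UT iRe.
have cIm := @cvg_Rintegral_setU _ _ _ N U _ _ mD mU ndU UT iIm.
have cE : expR (\int[N]_(x in U n) complex.Re (lk_kernel ip y x)) @[n --> \oo] -->
    expR (\int[N]_(x in [set~ (0 : H)]) complex.Re (lk_kernel ip y x)).
  by apply: continuous_cvg => //; exact: continuous_expR.
have cC : cos (\int[N]_(x in U n) complex.Im (lk_kernel ip y x)) @[n --> \oo] -->
    cos (\int[N]_(x in [set~ (0 : H)]) complex.Im (lk_kernel ip y x)).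
  by apply: continuous_cvg => //; exact: continuous_cos.
have cS : sin (\int[N]_(x in U n) complex.Im (lk_kernel ip y x)) @[n --> \oo] -->
    sin (\int[N]_(x in [set~ (0 : H)]) complex.Im (lk_kernel ip y x)).
  by apply: continuous_cvg => //; exact: continuous_sin.
have E1 : complex.Re (char_fun ip mu y) = complex.Re (cexp (cintegral N [set~ (0 : H)] (lk_kernel ip y))).
  apply: (cvg_unique _ muRe) => //; rewrite (_ : (fun n => _) = (fun n =>
    expR (\int[N]_(x in U n) complex.Re (lk_kernel ip y x)) *
    cos (\int[N]_(x in U n) complex.Im (lk_kernel ip y x)))); last first.
    by apply/funext => n; rewrite charU.
  exact: cvgM cE cC.
have E2 : complex.Im (char_fun ip mu y) = complex.Im (cexp (cintegral N [set~ (0 : H)] (lk_kernel ip y))).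
  apply: (cvg_unique _ muIm) => //; rewrite (_ : (fun n => _) = (fun n =>
    expR (\int[N]_(x in U n) complex.Re (lk_kernel ip y x)) *
    sin (\int[N]_(x in U n) complex.Im (lk_kernel ip y x)))); last first.
    by apply/funext => n; rewrite charU.
  exact: cvgM cE cS.
by apply/eqP; rewrite eq_complex E1 E2 !eqxx.
Qed.

End LevyLaw.

Section LevySpectral.
Context {R : realType} {H : completeNormedModType R} (ip : H -> H -> R).
Hypothesis hip : inner_product ip.
Hypothesis hsep : separable H.

Lemma cintegral_mscale (N : {measure set (borel H) -> \bar R}) y :
  (\int[N]_x (sq_trunc (x : H))%:E < +oo)%E -> forall (c : {nonneg R}),
  cintegral (mscale c N) [set~ (0 : H)] (lk_kernel ip y) =
    ((c%:num * complex.Re (cintegral N [set~ (0 : H)] (lk_kernel ip y))) +i*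
     (c%:num * complex.Im (cintegral N [set~ (0 : H)] (lk_kernel ip y))))%C.
Proof.
move=> hN c.
have mD : measurable ([set~ (0 : H)] : set (borel H)).
  by apply: measurableC; exact: measurable_set0_borel.
have hsc (g : borel H -> \bar R) : (forall x, 0 <= g x)%E -> measurable_fun [set: borel H] g ->
    (\int[mscale c N]_(x in [set~ (0%R : H)]) g x = c%:num%:E * \int[N]_(x in [set~ (0%R : H)]) g x)%E.
  by move=> g0 mg; rewrite ge0_integral_mscale//; exact: measurable_funTS.
have [iRe iIm] := cintegrable_lk hip hN y.
rewrite /cintegral; congr (_ +i* _)%C; apply: Rintegral_scaled hsc mD _ _ => //.
- exact: measurable_lk_Re.
- exact: measurable_lk_Im.
Qed.

Lemma cexp_natmul (a b : R) n : (cexp (a +i* b) ^+ n = cexp ((n%:R * a) +i* (n%:R * b)))%C.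
Proof.
elim: n => [|n ih].
  by rewrite expr0 !mul0r /cexp /= expR0 cos0 sin0 mulr1 mulr0.
rewrite exprS ih -cexpD; congr cexp; apply/eqP; rewrite eq_complex /=.
by apply/andP; split; apply/eqP; rewrite -natr1; ring.
Qed.

(** The witness has shift 0 and covariance 0, the latter being that of the Dirac law at the origin.
    The [n]-th convolution root is the law built from [N / n]. *)
Lemma levy_spectral_suff (m : set H -> \bar R) (N : {measure set (borel H) -> \bar R}) :
  (forall A : set (borel H), measurable A -> m A = N A) -> N [set (0 : H)] = 0%E ->
  (\int[N]_x (sq_trunc (x : H))%:E < +oo)%E -> levy_spectral ip m.
Proof.
move=> mN N0 hN; exists N; split => //.
have [e he] := exists_parseval_basis hip hsep.
have [mu hmu] := exists_levy_law hip hsep hN.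
exists mu, 0, (\0 : {linear H -> H}); split.
- move=> n n0; have c0 : 0 <= (n%:R^-1 : R) by rewrite invr_ge0.
  pose Nn : {measure set (borel H) -> \bar R} := mscale (NngNum c0) N.
  have hNn : (\int[Nn]_x (sq_trunc (x : H))%:E < +oo)%E.
    rewrite ge0_integral_mscale//.
    - by rewrite lte_mul_pinfty// lee_fin.
    - by apply/measurable_EFinP; exact: measurable_sq_trunc.
    - by move=> x _; rewrite lee_fin sq_trunc_ge0.
  have [nu hnu] := exists_levy_law hip hsep hNn.
  exists nu => A mA; rewrite -(convnE hip he hsep)//.
  apply: (char_fun_inj hip hsep _ mA) => y.
  rewrite (char_fun_convn hip he hsep) hnu hmu cintegral_mscale// cexp_natmul; congr cexp.
  case: (cintegral N _ _) => a b /=.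
  by rewrite !mulrA divff ?mul1r// pnatr_eq0 -lt0n.
- split.
  + by move=> x; exact: cvg_cst.
  + by move=> x y /=; rewrite (ip0l hip) (ip0r hip).
  + exists (@dirac _ (borel H) (0 : H) R) => y.
    rewrite (char_fun_dirac0 hip) /cexp /= (ip0l hip) mul0r oppr0 expR0 cos0 sin0.
    by rewrite mulr1 mulr0.
- move=> y; split; first exact: cintegrable_lk.
  rewrite hmu; congr cexp; rewrite (ip0r hip) /= (ip0l hip) mul0r.
  by case: (cintegral N _ _) => a b; apply/eqP; rewrite eq_complex /= !subr0 !add0r !eqxx.
Qed.

Lemma levy_spectral_nec (m : set H -> \bar R) : levy_spectral ip m ->
  exists N : {measure set (borel H) -> \bar R},
    [/\ forall A : set (borel H), measurable A -> m A = N A, N [set (0 : H)] = 0%E &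
        (\int[N]_x (sq_trunc (x : H))%:E < +oo)%E].
Proof.
move=> [N [mN N0 [mu [a [Q [_ gQ lk]]]]]]; exists N; split => //.
exact: (sq_trunc_integrable_levy hip hsep gQ lk).
Qed.

End LevySpectral.

(** * Mixtures *)

(** Superlevel sets within the half-line are intervals. *)
Lemma measurable_nondecreasing_ereal (R : realType) (f : R -> \bar R) :
  (forall s t : R, 0 < s -> s <= t -> (f s <= f t)%E) ->
  measurable_fun (`]0%R, +oo[%classic : set (measurableTypeR R)) f.
Proof.
move=> ndf; apply: (measurability _ (ErealGenOInfty.measurableE R)).
move=> _ [_ [r ->] <-]; apply: is_interval_measurable => s t /= [s0 rs] [t0 rt] u.
move=> /andP[su ut]; move: s0 rs; rewrite /= !in_itv/= !andbT => s0 rs.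
have u0 : 0 < u by exact: lt_le_trans su.
by split => //; apply: lt_le_trans rs _; exact: ndf.
Qed.

(* The map [t |-> M (t^-1 A)] need not be measurable, so monotonicity of the integral is needed
   without any measurability. *)
Lemma ge0_le_integral_any d (T : measurableType d) (R : realType)
    (mu : {measure set T -> \bar R}) (D : set T) (f g : T -> \bar R) :
  (forall x, D x -> 0 <= f x)%E -> (forall x, D x -> f x <= g x)%E ->
  (\int[mu]_(x in D) f x <= \int[mu]_(x in D) g x)%E.
Proof.
move=> f0 fg; rewrite !ge0_integralE//; last by move=> x Dx; exact: le_trans (f0 x Dx) (fg x Dx).
apply: le_ereal_sup => _ [h hf <-]; exists h => // x; apply: le_trans (hf x) _; rewrite /patch.
by case: ifPn => //; rewrite inE; exact: fg.
Qed.

(** * A dyadic layer-cake decomposition *)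

Section DyadicLayers.
Context (R : realType).

Definition layer (k : nat) : R := (1 / 2) ^+ k.

Lemma layer_gt0 k : 0 < layer k.
Proof. by rewrite exprn_gt0. Qed.

Lemma layerS k : layer k.+1 = layer k / 2.
Proof. by rewrite /layer exprS; ring. Qed.

Lemma sum_layer m n : (m <= n)%N -> \sum_(m <= k < n) layer k = 2 * (layer m - layer n).
Proof.
move=> mn; elim: n mn => [|n ih].
  by rewrite leqn0 => /eqP->; rewrite big_geq// subrr mulr0.
rewrite leq_eqVlt => /predU1P[->|]; first by rewrite big_geq// subrr mulr0.
by rewrite ltnS => mn; rewrite big_nat_recr//= ih// layerS; field.
Qed.

Lemma layer_index (s : R) : 0 < s -> s <= 1 -> exists k, layer k.+1 < s <= layer k.
Proof.
move=> s0 s1.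
have [n hn] : exists n, layer n.+1 < s.
  have h2 : `|1 / 2 : R| < 1 by rewrite ger0_norm//; lra.
  have := @cvg_expr R (1 / 2) h2; move/cvgrPdist_lt => /(_ _ s0) [n _ hn].
  exists n; have := hn n.+1 (leqnSn n); rewrite /= sub0r normrN ger0_norm; first exact.
  by rewrite exprn_ge0//; lra.
elim: n hn => [|n ih] hn.
  by exists 0%N; rewrite hn/=.
by have [h|h] := ltP (layer n.+1) s; [exact: ih|exists n.+1; rewrite hn h].
Qed.

(** A substitute for [s], up to a factor 4, made of indicators of superlevel sets only. Integrals of
    the truncated square thereby become series of measures of radial sets. *)
Definition layers (s : R) : \bar R :=
  (\sum_(0 <= k <oo) (layer k * (layer k.+1 < s)%R%:R)%:E)%E.

Let layers_ge0 s k : (0 <= (layer k * (layer k.+1 < s)%R%:R)%:E)%E.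
Proof. by rewrite lee_fin mulr_ge0// ltW// layer_gt0. Qed.

Lemma le_layers (s : R) : 0 <= s -> s <= 1 -> (s%:E <= layers s)%E.
Proof.
rewrite le_eqVlt => /predU1P[<- _|s0 s1]; first exact: nneseries_ge0.
have [k /andP[ks sk]] := layer_index s0 s1.
apply: (@le_trans _ _ (\sum_(0 <= i < k.+1) (layer i * (layer i.+1 < s)%R%:R)%:E)%E); last first.
  by apply: nneseries_lim_ge => i _ _; exact: layers_ge0.
rewrite big_nat_recr//= ks mulr1.
by rewrite -[leLHS]add0e leeD ?lee_fin// sume_ge0// => i _; exact: layers_ge0.
Qed.

(** If [2 ^- (k + 1) < s <= 2 ^- k], the terms before [k] vanish and the geometric tail is at most
    [2 * 2 ^- k], which is below [4 s]. *)
Lemma layers_le (s : R) : 0 <= s -> s <= 1 -> (layers s <= (4 * s)%:E)%E.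
Proof.
rewrite le_eqVlt => /predU1P[<- _|s0 s1].
  rewrite mulr0 /layers eseries0// => k _ _.
  by rewrite ltNge (ltW (layer_gt0 _)) mulr0.
have [k /andP[ks sk]] := layer_index s0 s1.
apply: lime_le; first by apply: is_cvg_nneseries => i _ _; exact: layers_ge0.
apply: nearW => n; rewrite sumEFin lee_fin.
have mono i j : (i <= j)%N -> layer j <= layer i.
  by move=> ij; rewrite /layer ler_wiXn2l//; lra.
apply: (@le_trans _ _ (\sum_(0 <= i < n) (if (k <= i)%N then layer i else 0))).
  apply: ler_sum => i _; case: ifPn => [_|].
    by case: (_ < _); rewrite ?mulr1// mulr0 ltW// layer_gt0.
  rewrite -ltnNge => ik; rewrite ltNge (le_trans sk) ?mulr0//; exact: mono.
have [nk|kn] := leqP n k.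
  rewrite big_nat big1 ?mulr_ge0 ?(ltW s0)// => i /andP[_ ni].
  by rewrite leqNgt (leq_trans ni nk).
rewrite (big_cat_nat (n := k))//=; last exact: ltnW.
rewrite big_nat big1 ?add0r; last by move=> i /andP[_ ik]; rewrite leqNgt ik.
rewrite big_nat (eq_bigr layer); last by move=> i /andP[-> _].
rewrite -big_nat sum_layer 1?ltnW//.
have := layer_gt0 n; move: ks; rewrite layerS; lra.
Qed.

End DyadicLayers.

Lemma measurable_nonpos (R : realType) : measurable ([set t : R | t <= 0] : set (measurableTypeR R)).
Proof.
rewrite (_ : [set t | _] = `]-oo, 0%R]%classic); first exact: measurable_itv.
by apply/seteqP; split => t /=; rewrite in_itv.
Qed.

Lemma setT_pos_nonpos (R : realType) :
  [set: measurableTypeR R] = `]0%R, +oo[%classic `|` [set t : R | t <= 0].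
Proof.
by apply/seteqP; split => // t _ /=; rewrite in_itv/= andbT; have [h|h] := leP t 0; [right|left].
Qed.

Section Mixture.
Context {R : realType} {H : completeNormedModType R}.
Variables (M : {measure set (borel H) -> \bar R}) (hM : M [set (0 : H)] = 0%E).
Variables (lambda : {measure set (measurableTypeR R) -> \bar R}).
Hypothesis hlambda : lambda [set t : R | t <= 0] = 0%E.

Local Notation Rpos := (`]0%R, +oo[%classic : set (measurableTypeR R)).

Lemma measurable_scale_borel (t : R) :
  measurable_fun [set: borel H] ((fun x : borel H => t *: (x : H)) : borel H -> borel H).
Proof.
apply: (@measurability _ _ (borel H) (borel H) _ _ (@open H : set (set (borel H)))) => //.
move=> _ [A oA <-]; rewrite setTI.
apply: open_borel; apply: (@open_comp _ _ (fun x : H => t *: x)) => //.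
by move=> x _; exact: scaler_continuous.
Qed.

Lemma measurable_sq_trunc_scale (t : R) :
  measurable_fun [set: borel H] (fun x : borel H => sq_trunc (t *: (x : H))).
Proof. exact: (measurableT_comp measurable_sq_trunc (measurable_scale_borel t)). Qed.

Lemma sq_trunc_scaleE (t : R) (x : H) :
  sq_trunc (t *: x) = Num.min 1 (t ^+ 2 * `|x| ^+ 2).
Proof. by rewrite /sq_trunc normrZ exprMn real_normK ?num_real. Qed.

Lemma sq_trunc_le1 (x : H) : sq_trunc x <= 1.
Proof. by rewrite /sq_trunc ge_min lexx. Qed.

Lemma sq_trunc_scale_le (s t : R) (x : H) : 0 < s -> s <= t ->
  sq_trunc (s *: x) <= sq_trunc (t *: x).
Proof.
move=> s0 st; rewrite !sq_trunc_scaleE le_min ge_min lexx /= ge_min; apply/orP; right.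
by rewrite ler_wpM2r ?sqr_ge0// lerXn2r ?nnegrE ?(ltW s0)// (le_trans (ltW s0)).
Qed.

Definition scaled_mass (t : R) : \bar R := (\int[M]_x (sq_trunc (t *: (x : H)))%:E)%E.

Lemma scaled_mass_ge0 t : (0 <= scaled_mass t)%E.
Proof. by apply: integral_ge0 => x _; rewrite lee_fin sq_trunc_ge0. Qed.

Lemma rhs_integrandE (t : R) : 0 < t ->
  ((t ^+ 2)%:E * \int[M]_(x in [set x : H | (0 < `|x| <= t^-1)%R]) (`|x : H| ^+ 2)%:E
    + M [set x : H | (t^-1 < `|x|)%R] = scaled_mass t)%E.
Proof.
move=> t0; pose B : set (borel H) := [set x : H | `|x| <= t^-1].
have mB : measurable B by exact: measurable_norm_le.
have BcE : [set x : H | t^-1 < `|x|] = ~` B.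
  by apply/seteqP; split => x /=; rewrite /B/= ltNge => /negP.
have tx (x : H) : B x -> sq_trunc (t *: x) = t ^+ 2 * `|x| ^+ 2.
  move=> Bx; rewrite sq_trunc_scaleE; apply/min_idPr; rewrite -exprMn exprn_ile1//.
    by rewrite mulr_ge0// ltW.
  by rewrite mulrC -ler_pdivlMr// mul1r.
rewrite /scaled_mass -(setUv B) ge0_integral_setU//; last 4 first.
- exact: measurableC.
- by apply/measurable_EFinP; apply: measurable_funTS; exact: measurable_sq_trunc_scale.
- by move=> x _; rewrite lee_fin sq_trunc_ge0.
- by apply/disj_setPS; rewrite setICr.
congr (_ + _)%E.
  transitivity ((t ^+ 2)%:E * \int[M]_(x in B) (`|x : H| ^+ 2)%:E)%E.
    congr (_ * _)%E; rewrite integral_mkcond [RHS]integral_mkcond.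
    apply: eq_integral => x _; rewrite /patch.
    (* The origin belongs to [B] but not to the original domain; the integrand vanishes there. *)
    have [x0|x0] := eqVneq (x : H) 0.
      by rewrite x0 normr0 expr0n; case: ifP => _; case: ifP.
    have e : ((x : H) \in [set x : H | 0 < `|x| <= t^-1]) = ((x : H) \in B).
      by apply/idP/idP; rewrite !inE /B/= normr_gt0 x0.
    by rewrite e.
  rewrite -ge0_integralZl_EFin//; last 2 first.
  - by apply/measurable_EFinP; apply: measurable_funTS; exact: measurable_norm_sqr.
  - exact: sqr_ge0.
  by apply: eq_integral => x; rewrite inE => Bx; rewrite tx.
rewrite BcE -[LHS]mul1e -(integral_cst M (measurableC mB)); apply: eq_integral => x.
rewrite inE => Bx; rewrite sq_trunc_scaleE; apply/esym; congr (_%:E); apply/min_idPl.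
have : t^-1 < `|x : H| by rewrite ltNge; exact/negP.
by move=> h; rewrite -exprMn exprn_ege1// mulrC -ler_pdivrMr// mul1r ltW.
Qed.

Lemma measurable_sq_trunc_scalel (x : H) :
  measurable_fun [set: measurableTypeR R] (fun t : R => sq_trunc (t *: x)).
Proof.
rewrite (_ : (fun t => _) = fun t : R => Num.min 1 (t ^+ 2 * `|x| ^+ 2)); last first.
  by apply/funext => t; rewrite sq_trunc_scaleE.
apply: measurable_minr; first exact: measurable_cst.
by apply: measurable_funM; [exact: measurable_funX|exact: measurable_cst].
Qed.

Lemma lhs_integrandE (x : H) : x != 0 ->
  ((`|x| ^+ 2)%:E * \int[lambda]_(t in `]0%R, (`|x|^-1)%R]) ((t : R) ^+ 2)%:E
    + lambda [set s : R | (`|x|^-1 < s)%R] =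
  \int[lambda]_(t in `]0%R, +oo[) (sq_trunc (t *: x))%:E)%E.
Proof.
move=> x0; have nx0 : 0 < `|x| by rewrite normr_gt0.
have ix0 : 0 < `|x|^-1 by rewrite invr_gt0.
pose A : set (measurableTypeR R) := `]0%R, (`|x|^-1)%R]%classic.
pose B : set (measurableTypeR R) := [set s : R | `|x|^-1 < s].
have mA : measurable A by exact: measurable_itv.
have BE : B = `](`|x|^-1)%R, +oo[%classic.
  by apply/seteqP; split => s /=; rewrite in_itv/= andbT.
have mB : measurable B by rewrite BE; exact: measurable_itv.
have AB : Rpos = A `|` B.
  apply/seteqP; split => s /=; rewrite /A/B/= !in_itv/= andbT.
    by move=> s0; have [h|h] := leP s (`|x|^-1); [left; rewrite s0|right].
  by case=> [/andP[]//|]; exact: lt_trans.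
rewrite AB ge0_integral_setU//; last 3 first.
- by apply/measurable_EFinP; apply: measurable_funTS; exact: measurable_sq_trunc_scalel.
- by move=> t _; rewrite lee_fin sq_trunc_ge0.
- apply/disj_setPS => s [] /=; rewrite /A/B/= in_itv/= => /andP[_ h1] h2.
  by move: (le_lt_trans h1 h2); rewrite ltxx.
congr (_ + _)%E.
  rewrite -ge0_integralZl_EFin//; last 2 first.
  - by move=> t _; rewrite lee_fin sqr_ge0.
  - by apply/measurable_EFinP; apply: measurable_funTS; exact: measurable_funX.
  apply: eq_integral => t; rewrite inE /A/= in_itv/= => /andP[t0 tx].
  rewrite sq_trunc_scaleE -EFinM mulrC; congr (_%:E); apply/esym/min_idPr.
  rewrite -exprMn exprn_ile1// ?mulr_ge0 ?(ltW t0)//.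
  by rewrite -ler_pdivlMr// mul1r.
rewrite -/B -[LHS]mul1e -(integral_cst lambda mB); apply: eq_integral => t.
rewrite inE /B/= => tx.
rewrite sq_trunc_scaleE; apply/esym; congr (_%:E); apply/min_idPl.
by rewrite -exprMn exprn_ege1// -ler_pdivrMr// mul1r ltW.
Qed.

Lemma mixture_radial (r : R) : 0 <= r -> mixture lambda M [set x : H | r < sq_trunc x] =
  (\int[lambda]_(t in `]0%R, +oo[) M [set x : H | (r < sq_trunc (t *: x))%R])%E.
Proof.
move=> r0; apply: eq_integral => t _.
have m0 : measurable ([set~ (0 : H)] : set (borel H)).
  by apply: measurableC; exact: measurable_set0_borel.
have mA : measurable ([set x : H | r < sq_trunc (t *: x)] : set (borel H)).
  have := measurable_sq_trunc_scale t measurableT (measurable_itv `]r, +oo[); rewrite setTI.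
  by congr measurable; apply/seteqP; split => x /=; rewrite in_itv/= andbT.
have -> : M [set x : H | (r < sq_trunc (t *: x))%R] =
    M ([set x : H | (r < sq_trunc (t *: x))%R] `&` [set~ (0%R : H)]).
  congr (M _); apply/esym/setIidPl => x /= rx x0; move: rx.
  by rewrite x0 scaler0 /sq_trunc normr0 expr0n /= ltNge ge_min r0 orbT.
by rewrite -integral_indic.
Qed.

Lemma scaled_mass_fin (N : {measure set (borel H) -> \bar R}) :
  (forall A : set (borel H), measurable A -> mixture lambda M A = N A) ->
  (\int[N]_x (sq_trunc (x : H))%:E < +oo)%E ->
  (\int[lambda]_(t in `]0%R, +oo[) scaled_mass t < +oo)%E.
Proof.
move=> mN hN.
pose A (k : nat) (t : R) : set (borel H) := [set x : H | layer R k.+1 < sq_trunc (t *: x)].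
pose A1 (k : nat) : set (borel H) := [set x : H | layer R k.+1 < sq_trunc x].
have mA k t : measurable (A k t).
  have := measurable_sq_trunc_scale t measurableT (measurable_itv `]layer R k.+1, +oo[).
  by rewrite setTI; congr measurable; apply/seteqP; split => x /=; rewrite in_itv/= andbT.
have mA1 k : measurable (A1 k).
  have := @measurable_sq_trunc R H measurableT _ (measurable_itv `]layer R k.+1, +oo[).
  by rewrite setTI; congr measurable; apply/seteqP; split => x /=; rewrite in_itv/= andbT.
have l0 k : 0 <= layer R k by rewrite ltW// layer_gt0.
have mt : measurable_fun [set: borel H] (fun x : borel H => (sq_trunc (x : H))%:E).
  by apply/measurable_EFinP; exact: measurable_sq_trunc.
have layerE (mu : {measure set (borel H) -> \bar R}) (B : nat -> set (borel H)) (f : borel H -> R) :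
    (forall k, measurable (B k)) -> (forall k x, (layer R k.+1 < f x) = (x \in B k)) ->
    (\int[mu]_x layers (f x) = \sum_(0 <= k <oo) (layer R k)%:E * mu (B k))%E.
  move=> mB fB; rewrite /layers integral_nneseries//; last 2 first.
  - move=> k; under eq_fun do rewrite fB EFinM.
    apply: emeasurable_funM; first exact: measurable_cst.
    by apply/measurable_EFinP; exact: (measurable_indic (mB k)).
  - by move=> k x _; rewrite lee_fin mulr_ge0.
  apply: eq_eseriesr => k _; under eq_integral do rewrite fB EFinM.
  rewrite ge0_integralZl_EFin//.
  - congr (_ * _)%E; rewrite -(setIT (B k)) -(integral_indic mu measurableT (mB k)).
    by apply: eq_integral => x _; rewrite indicE setIT.
  - by apply/measurable_EFinP; exact: (measurable_indic (mB k)).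
(* [A k t] grows with [t], so its mass is measurable in [t] even if [M] is not sigma-finite. *)
have mono k : measurable_fun Rpos (fun t => M (A k t)).
  apply: measurable_nondecreasing_ereal => s t s0 st; apply: le_measure; rewrite ?inE//.
  by move=> x /= h; apply: lt_le_trans h _; exact: sq_trunc_scale_le.
apply: (@le_lt_trans _ _ (\int[lambda]_(t in `]0%R, +oo[)
    \sum_(0 <= k <oo) (layer R k)%:E * M (A k t))%E).
  apply: ge0_le_integral_any => t _; first exact: scaled_mass_ge0.
  rewrite -(layerE M (A ^~ t) (fun x => sq_trunc (t *: x))) => [|k|k x]; [|exact: mA|]; last first.
    by apply/idP/idP; rewrite inE.
  apply: ge0_le_integral_any => x _; first by rewrite lee_fin sq_trunc_ge0.
  exact: le_layers (sq_trunc_ge0 _) (sq_trunc_le1 _).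
rewrite integral_nneseries//; last 2 first.
- by move=> k; apply: emeasurable_funM => //; exact: measurable_cst.
- by move=> k t _; rewrite mule_ge0// lee_fin.
rewrite (eq_eseriesr (g := fun k => ((layer R k)%:E * N (A1 k))%E)); last first.
  move=> k _; rewrite ge0_integralZl_EFin//; congr (_ * _)%E.
  by rewrite -mN// /A1 mixture_radial.
rewrite -(layerE N A1 (@sq_trunc R H)) => [|//|k x]; last by apply/idP/idP; rewrite inE.
apply: (@le_lt_trans _ _ (\int[N]_x (4 * sq_trunc (x : H))%:E)%E).
  apply: ge0_le_integral_any => x _; last exact: layers_le (sq_trunc_ge0 _) (sq_trunc_le1 _).
  by apply: nneseries_ge0 => k _ _; rewrite lee_fin mulr_ge0.
under eq_integral do rewrite EFinM.
rewrite ge0_integralZl_EFin//; first by rewrite lte_mul_pinfty// lee_fin.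
by move=> x _; rewrite lee_fin sq_trunc_ge0.
Qed.

Hypothesis hfin : (\int[lambda]_(t in `]0%R, +oo[) scaled_mass t < +oo)%E.

Lemma lambda_pos : lambda Rpos = lambda [set: measurableTypeR R].
Proof.
have mneg := @measurable_nonpos R.
rewrite [in RHS]setT_pos_nonpos.
rewrite measureU//.
  by transitivity (lambda Rpos + 0)%E; [rewrite adde0|congr (_ + _)%E; exact/esym].
apply/seteqP; split => // t [] /=; rewrite in_itv/= andbT => h1 h2.
by move: (lt_le_trans h1 h2); rewrite ltxx.
Qed.

(** A nonzero [lambda] leaves some [t > 0] with [scaled_mass t] finite, and the truncated square at
    [x] is at most [1 + t ^- 2] times its value at [t x]. *)
Lemma sq_trunc_integrable_M : lambda setT <> 0%E -> (\int[M]_x (sq_trunc (x : H))%:E < +oo)%E.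
Proof.
move=> l0.
have [t t0 tfin] : exists2 t : R, 0 < t & (scaled_mass t < +oo)%E.
  apply: contrapT => h; apply: l0; rewrite -lambda_pos; apply: contrapT => lp.
  have : (\int[lambda]_(t in `]0%R, +oo[) scaled_mass t = +oo)%E.
    rewrite (@eq_integral _ _ _ lambda Rpos (fun=> +oo%E)); last first.
      move=> t; rewrite inE /= in_itv/= andbT => t0; apply/eqP; rewrite -leye_eq leNgt.
      by apply/negP => tf; apply: h; exists t.
    rewrite integral_cst; last exact: measurable_itv.
    by rewrite gt0_mulye// lt0e measure_ge0 andbT; apply/eqP.
  by move=> e; move: hfin; rewrite e ltxx.
pose c : R := 1 + (t ^+ 2)^-1.
have t20 : 0 < t ^+ 2 by rewrite exprn_gt0.
have c0 : 0 <= c by rewrite addr_ge0// invr_ge0 ltW.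
apply: (@le_lt_trans _ _ (\int[M]_x (c%:E * (sq_trunc (t *: (x : H)))%:E))%E).
  apply: ge0_le_integral_any => x _; first by rewrite lee_fin sq_trunc_ge0.
  rewrite -EFinM lee_fin sq_trunc_scaleE minr_pMr// le_min mulr1.
  apply/andP; split.
    by rewrite /sq_trunc ge_min /c lerDl invr_ge0 ltW.
  rewrite /sq_trunc ge_min; apply/orP; right.
  have -> : c * (t ^+ 2 * `|x : H| ^+ 2) = t ^+ 2 * `|x : H| ^+ 2 + `|x : H| ^+ 2.
    by rewrite /c; field; rewrite gt_eqF.
  by rewrite lerDr mulr_ge0// ltW.
rewrite ge0_integralZl_EFin//.
- by rewrite lte_mul_pinfty// lee_fin.
- by move=> x _; rewrite lee_fin sq_trunc_ge0.
- by apply/measurable_EFinP; exact: measurable_sq_trunc_scale.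
Qed.

(** A nonzero [M] without mass at 0 charges some set [|x| > r] with [r <= 1], on which the truncated
    square of [t x] is at least [r ^ 2 * min 1 (t ^ 2)]. *)
Lemma sq_trunc_integrable_lambda : M setT <> 0%E ->
  (\int[lambda]_(t in `]0%R, +oo[) (Num.min 1 ((t : R) ^+ 2))%:E < +oo)%E.
Proof.
move=> M0.
pose F (n : nat) : set (borel H) := [set x : H | n.+1%:R^-1 < `|x|].
have mF n : measurable (F n) by exact: measurable_norm_gt.
have [n Fn] : exists n, M (F n) <> 0%E.
  apply: contrapT => /forallNP h; apply: M0.
  have {}h n : M (F n) = 0%E by exact: contrapT (h n).
  have mUF : measurable (\bigcup_n F n) by exact: bigcup_measurable.
  apply/eqP; rewrite eq_le measure_ge0 andbT.
  rewrite (_ : [set: borel H] = (\bigcup_n F n) `|` [set (0 : H)]); last first.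
    apply/seteqP; split => // x _; have [->|x0] := eqVneq (x : H) 0; first by right.
    have xp : 0 < `|x : H| by rewrite normr_gt0.
    have [k _ hk] := near_infty_natSinv_lt (PosNum xp).
    by left; exists k => //; exact: (hk k (leqnn k)).
  apply: le_trans (measureU2 _ mUF _) _; first exact: measurable_set0_borel.
  rewrite [X in (_ + X)%E](_ : _ = 0%E) ?adde0; last exact: hM.
  apply: le_trans (generalized_Boole_inequality _ _ _) _ => //.
  by rewrite eseries0// => k _ _; exact: h.
pose r : R := n.+1%:R^-1; have r0 : 0 < r by rewrite invr_gt0.
have r1 : r <= 1 by rewrite invf_le1// ler1n.
have r20 : 0 < r ^+ 2 by rewrite exprn_gt0.
have mmin : measurable_fun [set: measurableTypeR R] (fun t : R => (Num.min 1 (t ^+ 2))%:E).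
  apply/measurable_EFinP; apply: measurable_minr; first exact: measurable_cst.
  exact: measurable_funX.
have min0 (t : R) : 0 <= Num.min 1 (t ^+ 2) by rewrite le_min ler01 sqr_ge0.
set I := (\int[lambda]_(t in _) _)%E.
have I0 : (0 <= I)%E by apply: integral_ge0 => t _; rewrite lee_fin.
have key : ((r ^+ 2)%:E * M (F n) * I < +oo)%E.
  apply: le_lt_trans hfin.
  rewrite -ge0_integralZl//; last 3 first.
  - by apply: measurable_funTS; exact: mmin.
  - by move=> t _; rewrite lee_fin.
  - by rewrite mule_ge0// lee_fin ltW.
  apply: ge0_le_integral_any => t; rewrite /= in_itv/= andbT => t0.
    by rewrite mule_ge0 ?lee_fin// mule_ge0// lee_fin ltW.
  rewrite muleC muleA -EFinM -integral_cst// /scaled_mass integral_mkcond.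
  apply: ge0_le_integral_any => x _; rewrite /patch; case: ifPn => [xF|_].
  - by rewrite lee_fin mulr_ge0// ltW.
  - by [].
  - move: xF; rewrite inE /F/= -/r => rx; rewrite lee_fin sq_trunc_scaleE.
    rewrite minr_pMl ?(ltW r20)// mul1r le_min !ge_min exprn_ile1 ?(ltW r0)//=.
    apply/orP; right; rewrite ler_wpM2l ?sqr_ge0//.
    by rewrite lerXn2r ?nnegrE ?(ltW r0)// ltW.
  - by rewrite lee_fin sq_trunc_ge0.
have c0 : (0 < (r ^+ 2)%:E * M (F n))%E.
  by rewrite mule_gt0// ?lte_fin// lt0e measure_ge0 andbT; exact/eqP.
by move: key I0; case: I => [s _ _|h _|//]; [exact: ltry|rewrite gt0_muley in h].
Qed.

End Mixture.

Section SigmaFiniteAlias.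
Context d (T : measurableType d) (R : realType).

(* As for [normalized], the proof is an argument only to carry the instance. *)
Definition sigma_finite_alias (m : {measure set T -> \bar R}) (_ : sigma_finite [set: T] m) :
  set T -> \bar R := m.

Variables (m : {measure set T -> \bar R}) (hm : sigma_finite [set: T] m).
HB.instance Definition _ := Measure.copy (sigma_finite_alias hm) m.
HB.instance Definition _ := Measure_isSigmaFinite.Build _ T R (sigma_finite_alias hm) hm.
Definition sigma_finite_of : {sigma_finite_measure set T -> \bar R} := sigma_finite_alias hm.

End SigmaFiniteAlias.

Section SigmaFinite.
Context {R : realType} {H : completeNormedModType R}.

(** The sets [|x| > 1 / (n + 1)] have finite mass but miss the origin, which is adjoined to each of
    them as a null set. *)
Lemma sq_trunc_sigma_finite (M : {measure set (borel H) -> \bar R}) :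
  M [set (0 : H)] = 0%E -> (\int[M]_x (sq_trunc (x : H))%:E < +oo)%E ->
  sigma_finite [set: borel H] M.
Proof.
move=> hM fM.
exists (fun n => [set x : H | n.+1%:R^-1 < `|x|] `|` [set (0 : H)]).
  apply/seteqP; split => // x _; have [->|x0] := eqVneq (x : H) 0; first by exists 0%N => //; right.
  have xp : 0 < `|x : H| by rewrite normr_gt0.
  have [k _ hk] := near_infty_natSinv_lt (PosNum xp).
  by exists k => //; left; exact: (hk k (leqnn k)).
move=> n; have mF := @measurable_norm_gt R H n.+1%:R^-1.
have m0 := @measurable_set0_borel R H.
split; first exact: measurableU.
apply: le_lt_trans (measureU2 _ mF m0) _.
rewrite [X in (_ + X)%E](_ : _ = 0%E) ?adde0; last exact: hM.
by apply: norm_gt_fin => //; rewrite ?invr_gt0// invf_le1// ler1n.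
Qed.

End SigmaFinite.

Section LineMeasure.
Context {R : realType} (lambda : {measure set (measurableTypeR R) -> \bar R}).
Hypothesis hlambda : lambda [set t : R | t <= 0] = 0%E.

Lemma ge0_integral_pos (f : R -> \bar R) : (forall t, 0 <= f t)%E ->
  measurable_fun [set: measurableTypeR R] f ->
  (\int[lambda]_(t in `]0%R, +oo[) f t = \int[lambda]_t f t)%E.
Proof.
move=> f0 mf.
have mneg := @measurable_nonpos R.
rewrite [in RHS]setT_pos_nonpos ge0_integral_setU//; last 2 first.
- by rewrite -setT_pos_nonpos.
- apply/disj_setPS => t [] /=; rewrite in_itv/= andbT => h1 h2.
  by move: (lt_le_trans h1 h2); rewrite ltxx.
rewrite [X in (_ + X)%E]null_set_integral ?adde0//.
exact: measurable_funTS.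
Qed.

Lemma separable_R : separable (R^o : topologicalType).
Proof.
exists (range (@ratr R)); last exact: dense_rat.
by apply: (sub_countable (card_image_le _ _)); exact: countableP.
Qed.

Lemma measurable_to_borel_line : measurable_fun [set: measurableTypeR R]
  ((fun t => t) : measurableTypeR R -> borel R^o).
Proof.
apply: (@measurability _ _ _ (borel R^o) _ _ (@open R^o : set (set (borel R^o)))) => //.
by move=> _ [A oA <-]; rewrite setTI; exact: open_measurable.
Qed.

(** [lambda] moved to the Borel type of [R^o], so that the results for a general Hilbert space can
    be applied to the line. *)
Definition line_measure : {measure set (borel R^o) -> \bar R} := push measurable_to_borel_line lambda.

Hypothesis fin : (\int[lambda]_(t in `]0%R, +oo[) (Num.min 1 ((t : R) ^+ 2))%:E < +oo)%E.

Lemma line_measure0 : line_measure [set (0 : R^o)] = 0%E.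
Proof.
apply/eqP; rewrite eq_le measure_ge0 andbT -[leRHS]hlambda.
have mneg := @measurable_nonpos R.
have m0 := measurable_to_borel_line measurableT (@measurable_set0_borel R R^o).
rewrite setTI in m0.
suff : (lambda ((fun t : R => t) @^-1` [set (0%R : R^o)]) <= lambda [set t : R | (t <= 0)%R])%E by [].
by apply: le_measure; rewrite ?inE// => t /= ->.
Qed.

Lemma line_measure_fin : (\int[line_measure]_x (sq_trunc (x : R^o))%:E < +oo)%E.
Proof.
have mt : measurable_fun [set: borel R^o] (fun x : borel R^o => (sq_trunc (x : R^o))%:E).
  by apply/measurable_EFinP; exact: (@measurable_sq_trunc R R^o).
transitivity (\int[lambda]_t (sq_trunc (t : R^o))%:E < +oo)%E.
  congr (_ < _)%E; rewrite -[in RHS](preimage_setT (fun t : R => t)).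
  by rewrite -(ge0_integral_pushforward measurable_to_borel_line lambda measurableT mt)//;
    move=> x _; rewrite lee_fin sq_trunc_ge0.
rewrite -ge0_integral_pos.
- apply: le_lt_trans fin; apply: ge0_le_integral_any => t _; first by rewrite lee_fin sq_trunc_ge0.
  by rewrite lee_fin /sq_trunc real_normK ?num_real.
- by move=> t; rewrite lee_fin sq_trunc_ge0.
- exact: (measurableT_comp mt measurable_to_borel_line).
Qed.

Lemma sigma_finite_lambda : sigma_finite [set: measurableTypeR R] lambda.
Proof.
have [F FT hF] := sq_trunc_sigma_finite line_measure0 line_measure_fin.
exists F => // n; have [mF lF] := hF n; split => //.
by have := measurable_to_borel_line measurableT mF; rewrite setTI.
Qed.

Lemma levy_spectral_lambda : levy_spectral (fun x y : R^o => x * y : R) lambda.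
Proof.
exact: (levy_spectral_suff (inner_product_R R) separable_R (N := line_measure)
  (fun A _ => erefl) line_measure0 line_measure_fin).
Qed.

End LineMeasure.

(** * Tonelli and the mixture in the sigma-finite case *)

Section SigmaFiniteMixture.
Context {R : realType} {H : completeNormedModType R} (ip : H -> H -> R).
Hypothesis hip : inner_product ip.
Hypothesis hsep : separable H.
Variables (M : {measure set (borel H) -> \bar R}) (hM : M [set (0 : H)] = 0%E).
Variables (lambda : {measure set (measurableTypeR R) -> \bar R}).
Hypothesis hlambda : lambda [set t : R | t <= 0] = 0%E.
Hypothesis sM : sigma_finite [set: borel H] M.
Hypothesis sl : sigma_finite [set: measurableTypeR R] lambda.

Lemma measurable_joint : measurable_fun [set: measurableTypeR R * borel H]
  (fun p : measurableTypeR R * borel H => (sq_trunc ((p.1 : R) *: (p.2 : H)))%:E).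
Proof.
have [e he] := exists_parseval_basis hip hsep.
apply/measurable_EFinP.
exact: (measurableT_comp (@measurable_sq_trunc R H) (measurable_scaleH hip he hsep)).
Qed.

Let joint_ge0 (p : measurableTypeR R * borel H) : (0 <= (sq_trunc ((p.1 : R) *: (p.2 : H)))%:E)%E.
Proof. by rewrite lee_fin sq_trunc_ge0. Qed.

Lemma scaled_mass_swap :
  (\int[lambda]_(t in `]0%R, +oo[) scaled_mass M t =
   \int[M]_(x in [set~ (0%R : H)]) \int[lambda]_(t in `]0%R, +oo[) (sq_trunc (t *: (x : H)))%:E)%E.
Proof.
pose l' := sigma_finite_of sl; pose M' := sigma_finite_of sM.
rewrite ge0_integral_pos//; last 2 first.
- by move=> t; exact: scaled_mass_ge0.
- exact: (@measurable_fun_fubini_tonelli_F _ _ _ _ R M' _ measurable_joint joint_ge0).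
transitivity (\int[M]_x \int[lambda]_t (sq_trunc (t *: (x : H)))%:E)%E.
  exact: (@fubini_tonelli _ _ _ _ R l' M' _ measurable_joint joint_ge0).
rewrite [RHS]integral_mkcond; apply: eq_integral => x _; rewrite /patch.
case: ifPn => [_|]; last first.
  rewrite notin_setE /= => /contrapT ->; rewrite integral0_eq// => t _.
  by rewrite scaler0 /sq_trunc normr0 expr0n /= min_r// ler01.
rewrite ge0_integral_pos//; first by move=> t; rewrite lee_fin sq_trunc_ge0.
by apply/measurable_EFinP; exact: measurable_sq_trunc_scalel.
Qed.

(** [N] is the image of the product of [lambda] and [M] under scaling. It has no mass at 0 because
    [t x = 0] with [t > 0] forces [x = 0]. *)
Lemma mixture_measure : exists N : {measure set (borel H) -> \bar R},
  [/\ forall A : set (borel H), measurable A -> mixture lambda M A = N A,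
      N [set (0 : H)] = 0%E &
      (\int[N]_x (sq_trunc (x : H))%:E = \int[lambda]_(t in `]0%R, +oo[) scaled_mass M t)%E].
Proof.
have [e he] := exists_parseval_basis hip hsep.
pose l' := sigma_finite_of sl; pose M' := sigma_finite_of sM.
have mS := measurable_scaleH hip he hsep.
pose N : {measure set (borel H) -> \bar R} := push mS ((l' \x M')%E : {measure set _ -> \bar R}).
have mpre (A : set (borel H)) : measurable A ->
    measurable ((fun p : measurableTypeR R * borel H => (p.1 : R) *: (p.2 : H)) @^-1` A
      : set (measurableTypeR R * borel H)).
  by move=> mA; have := mS measurableT A mA; rewrite setTI.
have NE (A : set (borel H)) : measurable A ->
    N A = (\int[lambda]_(t in `]0%R, +oo[) M [set x : H | A ((t : R) *: x)])%E.
  move=> mA; rewrite ge0_integral_pos//; last first.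
    have := @measurable_fun_xsection _ _ _ _ R M' _ (mpre A mA).
    congr (measurable_fun _ _); apply/funext => t /=; congr (M _); apply/seteqP.
    by split => x; rewrite /xsection/= inE.
  rewrite /N pushE; apply: eq_integral => t _ /=; congr (M _); apply/seteqP.
  by split => x; rewrite /xsection/= inE.
exists N; split.
- move=> A mA; rewrite NE//; apply: eq_integral => t _.
  have m0 : measurable ([set~ (0 : H)] : set (borel H)).
    by apply: measurableC; exact: measurable_set0_borel.
  have mAt : measurable ([set x : H | A ((t : R) *: x)] : set (borel H)).
    by have := measurable_scale_borel t measurableT mA; rewrite setTI.
  transitivity (M ([set x : H | A ((t : R) *: x)] `&` [set~ (0 : H)])).
    by rewrite -integral_indic.
  rewrite -[in RHS](setIT [set x | _]) -(setvU [set (0 : H)]) setIUr measureU.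
  + rewrite [X in _ = (_ + X)%E](_ : _ = 0%E) ?adde0//.
    apply/eqP; rewrite eq_le measure_ge0 andbT -[leRHS]hM.
    apply: le_measure; rewrite ?inE//; last exact: measurable_set0_borel.
    by apply: measurableI => //; exact: measurable_set0_borel.
  + exact: measurableI.
  + by apply: measurableI => //; exact: measurable_set0_borel.
  + by rewrite setIACA setICl setI0.
- rewrite NE; last exact: measurable_set0_borel.
  rewrite integral0_eq// => t; rewrite /= in_itv/= andbT => t0.
  rewrite -[RHS]hM; congr (M _); apply/seteqP; split => x /= => [/eqP|->]; last by rewrite scaler0.
  by rewrite scaler_eq0 gt_eqF//= => /eqP.
- have mt : measurable_fun [set: borel H] (fun x : borel H => (sq_trunc (x : H))%:E).
    by apply/measurable_EFinP; exact: measurable_sq_trunc.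
  transitivity (\int[(l' \x M')%E]_p (sq_trunc ((p.1 : R) *: (p.2 : H)))%:E)%E.
    transitivity (\int[pushforward (l' \x M')%E
      (fun p : measurableTypeR R * borel H => (p.1 : R) *: (p.2 : H) : borel H)]_x
      (sq_trunc (x : H))%:E)%E => //.
    rewrite (ge0_integral_pushforward mS _ measurableT mt) ?preimage_setT//.
    by move=> x _; rewrite lee_fin sq_trunc_ge0.
  rewrite (fubini_tonelli1 _ measurable_joint joint_ge0) ge0_integral_pos//.
  + by move=> t; exact: scaled_mass_ge0.
  + exact: (@measurable_fun_fubini_tonelli_F _ _ _ _ R M' _ measurable_joint joint_ge0).
Qed.

End SigmaFiniteMixture.

Lemma integral_null d (T : measurableType d) (R : realType) (mu : {measure set T -> \bar R})
    (D : set T) (f : T -> \bar R) : mu [set: T] = 0%E -> (\int[mu]_(x in D) f x = 0)%E.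
Proof.
move=> mu0; rewrite -(integral_measure_zero D f).
apply: eq_measure_integral => A mA _; apply/eqP; rewrite eq_le measure_ge0 andbT.
by apply: (@le_trans _ _ (mu setT)); [apply: le_measure; rewrite ?inE|rewrite mu0].
Qed.

Theorem proposition2 (R : realType) (H : completeNormedModType R)
    (ip : {dot H for idfun}) (hip : hilbert_norm ip) (hsep : separable H)
    (M : {measure set (borel H) -> \bar R}) (hM : M [set (0 : H)] = 0%E)
    (lambda : {measure set (measurableTypeR R) -> \bar R})
    (hlambda : lambda [set t : R | t <= 0] = 0%E) :
  let lhs := (\int[M]_(x in [set~ (0%R : H)])
      ((`|x : H| ^+ 2)%R%:E
         * \int[lambda]_(t in `]0%R, (`|x : H|^-1)%R]) ((t : R) ^+ 2)%R%:E
       + lambda [set s : R | (`|x : H|^-1 < s)%R]))%E in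
  let rhs := (\int[lambda]_(t in `]0%R, +oo[)
      (((t : R) ^+ 2)%R%:E
         * \int[M]_(x in [set x : H | (0 < `|x| <= (t : R)^-1)%R])
             (`|x : H| ^+ 2)%R%:E
       + M [set x : H | ((t : R)^-1 < `|x|)%R]))%E in
  (levy_spectral ip (mixture lambda M) <-> (lhs = rhs /\ (rhs < +oo)%E))
  /\ (levy_spectral ip (mixture lambda M) ->
        (lambda setT <> 0%E -> levy_spectral ip M)
        /\ (M setT <> 0%E ->
            levy_spectral (fun x y : R^o => x * y : R) lambda)).
Proof.
move=> lhs rhs; have hi := inner_product_dot hip.
have rhsE : rhs = (\int[lambda]_(t in `]0%R, +oo[) scaled_mass M t)%E.
  by apply: eq_integral => t; rewrite inE /= in_itv/= andbT => t0; rewrite rhs_integrandE.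
have lhsE : lhs = (\int[M]_(x in [set~ (0%R : H)])
    \int[lambda]_(t in `]0%R, +oo[) (sq_trunc (t *: (x : H)))%:E)%E.
  by apply: eq_integral => x; rewrite inE => /eqP x0; rewrite lhs_integrandE.
have fM : (rhs < +oo)%E -> lambda setT <> 0%E -> (\int[M]_x (sq_trunc (x : H))%:E < +oo)%E.
  by rewrite rhsE => h l0; exact: (sq_trunc_integrable_M hlambda h l0).
have fl : (rhs < +oo)%E -> M setT <> 0%E ->
    (\int[lambda]_(t in `]0%R, +oo[) (Num.min 1 ((t : R) ^+ 2))%:E < +oo)%E.
  by rewrite rhsE => h m0; exact: (sq_trunc_integrable_lambda hM h m0).
have levy_fin : levy_spectral ip (mixture lambda M) -> (rhs < +oo)%E.
  move=> /(levy_spectral_nec hi hsep)[N [mN _ fN]]; rewrite rhsE.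
  exact: scaled_mass_fin mN fN.
(* When one measure is zero the other may fail to be sigma-finite, so this case is settled by direct
   computation. *)
have degenerate : lambda setT = 0%E \/ M setT = 0%E ->
    [/\ lhs = 0%E, rhs = 0%E & forall A, mixture lambda M A = 0%E].
  case=> h0.
    split; [|exact: integral_null|by move=> A; exact: integral_null].
    by rewrite lhsE; apply: integral0_eq => x _; exact: integral_null.
  split; first exact: integral_null.
  - by rewrite rhsE; apply: integral0_eq => t _; exact: integral_null.
  - by move=> A; apply: integral0_eq => t _; exact: integral_null.
split; last first.
  move=> /levy_fin h; split => [l0|m0].
    exact: (levy_spectral_suff hi hsep (fun A _ => erefl) hM (fM h l0)).
  exact: (levy_spectral_lambda hlambda (fl h m0)).
have [/degenerate[-> -> mix0]|] := pselect (lambda setT = 0%E \/ M setT = 0%E).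
  split=> // _; apply: (@levy_spectral_suff _ _ _ hi hsep _ mzero) => //.
    by move=> A _; rewrite mix0.
  by rewrite integral_measure_zero.
move=> /not_orP[l0 m0].
(* Each direction first obtains finiteness of [rhs]; sigma-finiteness of both measures follows, and
   only then are the order of integration and the image measure at hand. *)
have both (h : (rhs < +oo)%E) :
    sigma_finite [set: borel H] M /\ sigma_finite [set: measurableTypeR R] lambda.
  split; first exact: sq_trunc_sigma_finite hM (fM h l0).
  exact: sigma_finite_lambda hlambda (fl h m0).
split => [/levy_fin h|[_ h]]; have [sM sl] := both h.
  by split => //; rewrite lhsE rhsE; exact: esym (scaled_mass_swap hi hsep hlambda sM sl).
have [N [mN N0 NE]] := mixture_measure hi hsep hM hlambda sM sl.
by apply: (levy_spectral_suff hi hsep mN N0); rewrite NE -rhsE.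
Qed.
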